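(* Let $K$ be a field of characteristic zero, let $A_1$ be the first Weyl algebra over $K$ and $Q(A_1)$ its division ring of fractions (the Weyl division ring). (1) The Weyl division ring $Q(A_1)$ satisfies the commutative centralizer condition. (2) The first Weyl algebra $A_1$, the noncommutative deformations $A(\alpha)$ of type-A Kleinian singularities (for any nonzero polynomial $\alpha\in K[H]$), and any noncommutative subalgebra of the Weyl division ring $Q(A_1)$ with Gelfand-Kirillov dimension $<3$ admit the Dixmier partition and satisfy both the homogeneous centralizer condition and the commutative centralizer condition.
   Context: $A_1=K\langle x,\partial\mid\partial x-x\partial=1\rangle$. For a nonzero polynomial $\alpha=\alpha(H)\in K[H]$, $A(\alpha)=K\langle X,Y,H\mid XH=(H-1)X,\ YH=(H+1)Y,\ YX=\alpha(H),\ XY=\alpha(H-1)\rangle$. Let $\overline K$ be the algebraic closure of $K$. For a $K$-algebra $A$ with centre $Z(A)$, put $\overline A=\overline K\otimes_K A$ and identify $A$ with $1\otimes A$. For $a\in A$ let $\operatorname{ad} a: b\mapsto [a,b]=ab-ba$, and put $C(a)=\ker(\operatorname{ad} a)$ (the centralizer of $a$ in $A$); $N(a)=\bigcup_{i\ge0}\ker\big((\operatorname{ad} a)^{i+1}\big)\subseteq A$; $D(a)=A\cap\bigoplus_{\lambda\in\overline K}\{b\in\overline A:[a,b]=\lambda b\}$; $F(a)=\{b\in A:\dim_K K[\operatorname{ad} a]\,b<\infty\}$. Types of elements $a\in A\setminus Z(A)$: $a\in\Delta_1(A)$ (strongly nilpotent) if $N(a)=A$ and $D(a)=C(a)$; $a\in\Delta_2(A)$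 (weakly nilpotent) if $C(a)\ne N(a)\ne A$ and $D(a)=C(a)$; $a\in\Delta_3(A)$ (strongly semi-simple) if $N(a)=C(a)$ and $D(a)=A$; $a\in\Delta_4(A)$ (weakly semi-simple) if $N(a)=C(a)$ and $C(a)\ne D(a)=F(a)\ne A$; $a\in\Delta_5(A)$ (generic) if $N(a)=D(a)=C(a)$. $A$ admits the Dixmier partition if $A\setminus Z(A)=\Delta_1(A)\cup\cdots\cup\Delta_5(A)$. A noncommutative algebra satisfies the commutative centralizer condition if the centralizer of each of its non-central elements is a commutative algebra. A noncommutative algebra $A$ that admits the Dixmier partition satisfies the homogeneous centralizer condition if, for each $a\in A\setminus Z(A)$, the elements of $C(a)\setminus Z(A)$ are of exactly one of the following kinds: (1) all strongly nilpotent; (2) all weakly nilpotent; (3) all generic except for a subset $K^*a'+Z(A)$ of strongly semi-simple elements, for some $a'\in\Delta_3(A)$; (4) all generic except for a subset $K^*a'+Z(A)$ of weakly semi-simple elements, for some $a'\in\Delta_4(A)$; (5) all generic. Here $K^*=K\setminus\{0\}$. *)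

(* Defs.v *)
From HB Require Import structures.
From mathcomp Require Import all_boot all_order all_algebra.
From mathcomp Require Import boolp classical_sets reals ereal sequences exp.
Set Implicit Arguments.
Unset Strict Implicit.
Unset Printing Implicit Defensive.
Import Order.TTheory GRing.Theory Num.Theory.
Local Open Scope classical_set_scope.
Local Open Scope ring_scope.

(** * Algebras given by generators and relations

    [presented E] is K<G | s = t whenever E s t>: noncommutative polynomial
    expressions in the generators [G], modulo the least congruence that contains
    [E] and the axioms of unital associative K-algebras. *)

Inductive ncexpr (K G : Type) : Type :=
| Gen of G
| Cst of K
| Add of ncexpr K G & ncexpr K G
| Mul of ncexpr K G & ncexpr K G.
Arguments Gen {K G}.
Arguments Cst {K G}.

HB.instance Definition _ (K G : Type) := gen_eqMixin (ncexpr K G).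
HB.instance Definition _ (K G : Type) := gen_choiceMixin (ncexpr K G).

Declare Scope ncexpr_scope.
Delimit Scope ncexpr_scope with nc.
Bind Scope ncexpr_scope with ncexpr.
Notation "s + t" := (Add s t) : ncexpr_scope.
Notation "s * t" := (Mul s t) : ncexpr_scope.
Notation "s - t" := (Add s (Mul (Cst (-1)%R) t)) : ncexpr_scope.

Inductive pres_eq (K : fieldType) (G : Type) (E : ncexpr K G -> ncexpr K G -> Prop) :
  ncexpr K G -> ncexpr K G -> Prop :=
| pe_rel s t : E s t -> pres_eq E s t
| pe_refl t : pres_eq E t t
| pe_sym s t : pres_eq E s t -> pres_eq E t s
| pe_trans s t u : pres_eq E s t -> pres_eq E t u -> pres_eq E s u
| pe_add s s' t t' : pres_eq E s s' -> pres_eq E t t' ->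
    pres_eq E (s + t) (s' + t')
| pe_mul s s' t t' : pres_eq E s s' -> pres_eq E t t' ->
    pres_eq E (s * t) (s' * t')
| pe_addA s t u : pres_eq E (s + (t + u)) (s + t + u)
| pe_addC s t : pres_eq E (s + t) (t + s)
| pe_add0 t : pres_eq E (Cst 0%R + t) t
| pe_mulA s t u : pres_eq E (s * (t * u)) (s * t * u)
| pe_mulDl s t u : pres_eq E ((s + t) * u) (s * u + t * u)
| pe_mulDr s t u : pres_eq E (s * (t + u)) (s * t + s * u)
| pe_mul1 t : pres_eq E (Cst 1%R * t) t
| pe_mul0 t : pres_eq E (Cst 0%R * t) (Cst 0%R)
| pe_cstD a b : pres_eq E (Cst (a + b)%R) (Cst a + Cst b)
| pe_cstM a b : pres_eq E (Cst (a * b)%R) (Cst a * Cst b)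
| pe_cstC a t : pres_eq E (Cst a * t) (t * Cst a).

Section Presented.
Variables (K : fieldType) (G : Type) (E : ncexpr K G -> ncexpr K G -> Prop).

Definition pres_rel : rel (ncexpr K G) := fun s t => `[< pres_eq E s t >].

Fact pres_rel_refl : reflexive pres_rel.
Proof. by move=> t; apply/asboolP; exact: pe_refl. Qed.

Fact pres_rel_sym : symmetric pres_rel.
Proof. by move=> s t; apply/asboolP/asboolP; exact: pe_sym. Qed.

Fact pres_rel_trans : transitive pres_rel.
Proof. by move=> t s u /asboolP st /asboolP tu; apply/asboolP/(pe_trans st). Qed.

Canonical pres_equiv :=
  EquivRel pres_rel pres_rel_refl pres_rel_sym pres_rel_trans.

Definition presented := {eq_quot pres_equiv}%qT.
HB.instance Definition _ := Choice.on presented.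

Definition pres_class (t : ncexpr K G) : presented :=
  (\pi_({eq_quot pres_equiv}) t)%qT.
Definition pres_repr (x : presented) : ncexpr K G := (repr x)%qT.

Lemma pres_reprK x : pres_class (pres_repr x) = x.
Proof. exact: reprK. Qed.

Lemma pres_classP s t : pres_class s = pres_class t <-> pres_eq E s t.
Proof.
split=> [/eqmodP /= /asboolP //|st].
by apply/eqmodP/asboolP.
Qed.

Lemma pres_classK t : pres_eq E (pres_repr (pres_class t)) t.
Proof. by apply/pres_classP; rewrite pres_reprK. Qed.

Definition pres_add x y := pres_class (pres_repr x + pres_repr y).
Definition pres_mul x y := pres_class (pres_repr x * pres_repr y).
Definition pres_scale (a : K) x := pres_class (Cst a * pres_repr x).
Definition pres_opp x := pres_scale (-1) x.

Lemma pres_addE s t : pres_add (pres_class s) (pres_class t) = pres_class (s + t).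
Proof. by apply/pres_classP/pe_add; exact: pres_classK. Qed.

Lemma pres_mulE s t : pres_mul (pres_class s) (pres_class t) = pres_class (s * t).
Proof. by apply/pres_classP/pe_mul; exact: pres_classK. Qed.

Lemma pres_scaleE a t : pres_scale a (pres_class t) = pres_class (Cst a * t).
Proof. by apply/pres_classP/pe_mul; [exact: pe_refl|exact: pres_classK]. Qed.

Lemma pres_ind (P : presented -> Prop) : (forall t, P (pres_class t)) -> forall x, P x.
Proof. by move=> Pc x; rewrite -(pres_reprK x). Qed.

Fact pres_addA : associative pres_add.
Proof.
elim/pres_ind=> s; elim/pres_ind=> t; elim/pres_ind=> u.
by rewrite !pres_addE; apply/pres_classP/pe_addA.
Qed.

Fact pres_addC : commutative pres_add.
Proof.
by elim/pres_ind=> s; elim/pres_ind=> t; rewrite !pres_addE; apply/pres_classP/pe_addC.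
Qed.

Fact pres_add0 : left_id (pres_class (Cst 0)) pres_add.
Proof. by elim/pres_ind=> s; rewrite !pres_addE; apply/pres_classP/pe_add0. Qed.

Fact pres_addN : left_inverse (pres_class (Cst 0)) pres_opp pres_add.
Proof.
elim/pres_ind=> s; rewrite /pres_opp pres_scaleE pres_addE; apply/pres_classP.
apply: (@pe_trans _ _ _ _ ((Cst (-1)%R + Cst 1%R) * s)%nc).
  apply: (@pe_trans _ _ _ _ (Cst (-1)%R * s + Cst 1%R * s)%nc).
    by apply: pe_add; [exact: pe_refl|apply: pe_sym; exact: pe_mul1].
  by apply: pe_sym; exact: pe_mulDl.
apply: (@pe_trans _ _ _ _ (Cst 0%R * s)%nc); last exact: pe_mul0.
apply: pe_mul; last exact: pe_refl.
by apply: pe_sym; rewrite -[in X in pres_eq _ X _](addNr (1 : K)); exact: pe_cstD.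
Qed.

HB.instance Definition _ :=
  GRing.isZmodule.Build presented pres_addA pres_addC pres_add0 pres_addN.

Lemma pres_classD s t : pres_class s + pres_class t = pres_class (s + t)%nc.
Proof. exact: pres_addE. Qed.

Fact pres_mulA : associative pres_mul.
Proof.
elim/pres_ind=> s; elim/pres_ind=> t; elim/pres_ind=> u.
by rewrite !pres_mulE; apply/pres_classP/pe_mulA.
Qed.

Fact pres_mul1l : left_id (pres_class (Cst 1)) pres_mul.
Proof. by elim/pres_ind=> s; rewrite !pres_mulE; apply/pres_classP/pe_mul1. Qed.

Fact pres_mul1r : right_id (pres_class (Cst 1)) pres_mul.
Proof.
elim/pres_ind=> s; rewrite !pres_mulE; apply/pres_classP.
by apply: pe_trans (pe_mul1 _ _); apply: pe_sym; exact: pe_cstC.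
Qed.

Fact pres_mulDl : left_distributive pres_mul +%R.
Proof.
elim/pres_ind=> s; elim/pres_ind=> t; elim/pres_ind=> u.
by rewrite !(pres_classD, pres_mulE); apply/pres_classP/pe_mulDl.
Qed.

Fact pres_mulDr : right_distributive pres_mul +%R.
Proof.
elim/pres_ind=> s; elim/pres_ind=> t; elim/pres_ind=> u.
by rewrite !(pres_classD, pres_mulE); apply/pres_classP/pe_mulDr.
Qed.

HB.instance Definition _ := GRing.Zmodule_isPzRing.Build presented
  pres_mulA pres_mul1l pres_mul1r pres_mulDl pres_mulDr.

Fact pres_scaleA a b x : pres_scale a (pres_scale b x) = pres_scale (a * b) x.
Proof.
elim/pres_ind: x => s; rewrite !pres_scaleE; apply/pres_classP.
apply: pe_trans (pe_mulA _ _ _ _) _.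
by apply: pe_mul; [apply: pe_sym; exact: pe_cstM|exact: pe_refl].
Qed.

Fact pres_scale1 : left_id 1 pres_scale.
Proof. by elim/pres_ind=> s; rewrite pres_scaleE; apply/pres_classP/pe_mul1. Qed.

Fact pres_scaleDr : right_distributive pres_scale +%R.
Proof.
move=> a; elim/pres_ind=> s; elim/pres_ind=> t.
by rewrite !(pres_classD, pres_scaleE); apply/pres_classP/pe_mulDr.
Qed.

Fact pres_scaleDl x : {morph pres_scale^~ x : a b / a + b}.
Proof.
move=> a b; elim/pres_ind: x => s.
rewrite !(pres_classD, pres_scaleE); apply/pres_classP.
apply: pe_trans (pe_mulDl _ _ _ _).
by apply: pe_mul; [exact: pe_cstD|exact: pe_refl].
Qed.

HB.instance Definition _ := GRing.Zmodule_isLmodule.Build K presented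
  pres_scaleA pres_scale1 pres_scaleDr pres_scaleDl.

Lemma pres_classM s t : pres_class s * pres_class t = pres_class (s * t)%nc.
Proof. exact: pres_mulE. Qed.

Lemma pres_classZ a t : a *: pres_class t = pres_class (Cst a * t)%nc.
Proof. exact: pres_scaleE. Qed.

Fact pres_scaleAl a (x y : presented) : a *: (x * y) = a *: x * y.
Proof.
elim/pres_ind: x => s; elim/pres_ind: y => t.
rewrite !(pres_classM, pres_classZ).
by apply/pres_classP/pe_mulA.
Qed.

Fact pres_scaleAr a (x y : presented) : a *: (x * y) = x * (a *: y).
Proof.
elim/pres_ind: x => s; elim/pres_ind: y => t.
rewrite !(pres_classM, pres_classZ).
apply/pres_classP; apply: pe_trans (pe_mulA _ _ _ _) _.
apply: pe_trans (pe_sym (pe_mulA _ _ _ _)).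
by apply: pe_mul; [exact: pe_cstC|exact: pe_refl].
Qed.

(* A nonzero representation shows that a presented algebra is not the zero ring. *)
Section Representation.
Variables (V : lmodType K) (v : G -> V -> V).

Fixpoint rep (t : ncexpr K G) (w : V) : V :=
  match t with
  | Gen g => v g w
  | Cst a => a *: w
  | Add s u => rep s w + rep u w
  | Mul s u => rep s (rep u w)
  end.

Hypothesis v_lin : forall g, linear (v g).
Hypothesis v_rel : forall s t, E s t -> rep s =1 rep t.

Lemma rep_lin t : linear (rep t).
Proof.
elim: t => [g|a|s IHs u IHu|s IHs u IHu] k x y /=.
- exact: v_lin.
- by rewrite scalerDr !scalerA mulrC.
- by rewrite IHs IHu scalerDr addrACA.
- by rewrite IHu IHs.
Qed.

Lemma rep_eq s t : pres_eq E s t -> rep s =1 rep t.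
Proof.
elim=> {s t} //=.
- by move=> s t _ IH w; rewrite IH.
- by move=> s t u _ IH _ IH' w; rewrite IH IH'.
- by move=> s s' t t' _ IH _ IH' w; rewrite /= IH IH'.
- by move=> s s' t t' _ IH _ IH' w; rewrite /= IH' IH.
- by move=> s t u w /=; rewrite addrA.
- by move=> s t w /=; rewrite addrC.
- by move=> t w /=; rewrite scale0r add0r.
- by move=> s t u w /=; have := rep_lin s 1 (rep t w) (rep u w); rewrite !scale1r.
- by move=> t w /=; rewrite scale1r.
- by move=> t w /=; rewrite !scale0r.
- by move=> a b w /=; rewrite scalerDl.
- by move=> a b w /=; rewrite scalerA.
- move=> a t w /=; have r0 : rep t 0 = 0.
    by have := rep_lin t (-1) 0 0; rewrite scaler0 addr0 scaleN1r addNr.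
  by have := rep_lin t a w 0; rewrite r0 !addr0.
Qed.

Lemma presented_oner_neq0 (w : V) : w != 0 -> (1 : presented) != 0.
Proof.
apply: contraNN => /eqP /pres_classP /rep_eq /(_ w) /=.
by rewrite scale1r scale0r => ->.
Qed.

End Representation.
End Presented.

(** * The first Weyl algebra *)

Inductive weyl_gen := Wx | Wd.

Inductive weyl_rel (K : fieldType) :
  ncexpr K weyl_gen -> ncexpr K weyl_gen -> Prop :=
| weyl_comm : weyl_rel (Gen Wd * Gen Wx - Gen Wx * Gen Wd) (Cst 1%R).

Definition weyl (K : fieldType) : Type := presented (@weyl_rel K).

Section Weyl.
Variable K : fieldType.
HB.instance Definition _ := GRing.PzRing.on (weyl K).
HB.instance Definition _ := GRing.Lmodule.on (weyl K).

Fact weyl_oner_neq0 : (1 : weyl K) != 0.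
Proof.
pose v g (p : {poly K}) : {poly K} := if g is Wx then 'X * p else p^`().
apply: (@presented_oner_neq0 _ _ _ {poly K} v _ _ 1); last exact: oner_neq0.
  by case=> k p q /=; [rewrite mulrDr scalerAr|rewrite derivD derivZ].
by move=> _ _ [] w /=; rewrite derivM derivX mul1r scaleN1r scale1r addrK.
Qed.

HB.instance Definition _ :=
  GRing.PzSemiRing_isNonZero.Build (weyl K) weyl_oner_neq0.
HB.instance Definition _ :=
  GRing.Lmodule_isLalgebra.Build K (weyl K) (@pres_scaleAl _ _ (@weyl_rel K)).
HB.instance Definition _ :=
  GRing.Lalgebra_isAlgebra.Build K (weyl K) (@pres_scaleAr _ _ (@weyl_rel K)).
End Weyl.

(** * The algebras A(alpha) *)

Inductive kleinian_gen := GX | GY | GH.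

(* The value of a univariate polynomial at an expression, by Horner's rule. *)
Definition nc_horner (K : fieldType) (G : Type) (p : {poly K}) (t : ncexpr K G) :
  ncexpr K G := foldr (fun c u => Cst c + t * u)%nc (Cst 0) p.

Inductive kleinian_rel (K : fieldType) (alpha : {poly K}) :
  ncexpr K kleinian_gen -> ncexpr K kleinian_gen -> Prop :=
| kleinian_XH :
    kleinian_rel alpha (Gen GX * Gen GH) ((Gen GH - Cst 1%R) * Gen GX)
| kleinian_YH :
    kleinian_rel alpha (Gen GY * Gen GH) ((Gen GH + Cst 1%R) * Gen GY)
| kleinian_YX :
    kleinian_rel alpha (Gen GY * Gen GX) (nc_horner alpha (Gen GH))
| kleinian_XY :
    kleinian_rel alpha (Gen GX * Gen GY) (nc_horner alpha (Gen GH - Cst 1%R)).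

Definition kleinian (K : fieldType) (alpha : {poly K}) : Type :=
  presented (kleinian_rel alpha).

Section Kleinian.
Variables (K : fieldType) (alpha : {poly K}).
HB.instance Definition _ := GRing.PzRing.on (kleinian alpha).
HB.instance Definition _ := GRing.Lmodule.on (kleinian alpha).

Lemma rep_horner (v : kleinian_gen -> {poly K} -> {poly K}) p t (q : {poly K}) :
  rep v t =1 *%R q -> rep v (nc_horner p t) =1 *%R (p \Po q).
Proof.
move=> tq; rewrite -{2}(polyseqK p) /nc_horner.
elim: (polyseq p) => [|c s IH] w /=; first by rewrite scale0r comp_poly0 mul0r.
rewrite tq IH cons_poly_def comp_polyD comp_polyM comp_polyX comp_polyC.
by rewrite mulrDl mul_polyC addrC mulrA [q * _]mulrC.
Qed.

Fact kleinian_oner_neq0 : (1 : kleinian alpha) != 0.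
Proof.
pose v g (p : {poly K}) : {poly K} :=
  match g with
  | GX => p \Po ('X - 1)
  | GY => alpha * (p \Po ('X + 1))
  | GH => 'X * p
  end.
have compK (p : {poly K}) : (p \Po ('X - 1)) \Po ('X + 1) = p.
  by rewrite -comp_polyA comp_polyB comp_polyX comp_polyC addrK comp_polyXr.
have compK' (p : {poly K}) : (p \Po ('X + 1)) \Po ('X - 1) = p.
  by rewrite -comp_polyA comp_polyD comp_polyX comp_polyC subrK comp_polyXr.
apply: (@presented_oner_neq0 _ _ _ {poly K} v _ _ 1); last exact: oner_neq0.
  case=> k p q /=.
  - by rewrite comp_polyD comp_polyZ.
  - by rewrite comp_polyD comp_polyZ mulrDr scalerAr.
  - by rewrite mulrDr scalerAr.
move=> _ _ [] w.
- by rewrite /= comp_polyM comp_polyX !scale1r scaleN1r mulrBl mul1r.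
- by rewrite /= comp_polyM comp_polyX !scale1r mulrCA mulrDl mul1r.
- rewrite (@rep_horner v alpha (Gen GH) 'X)//= compK comp_polyXr.
  by [].
- rewrite (@rep_horner v alpha _ ('X - 1)) /=; last first.
    by move=> p /=; rewrite scale1r scaleN1r mulrBl mul1r.
  by rewrite comp_polyM compK'.
Qed.

HB.instance Definition _ :=
  GRing.PzSemiRing_isNonZero.Build (kleinian alpha) kleinian_oner_neq0.
HB.instance Definition _ :=
  GRing.Lmodule_isLalgebra.Build K (kleinian alpha)
    (@pres_scaleAl _ _ (kleinian_rel alpha)).
HB.instance Definition _ :=
  GRing.Lalgebra_isAlgebra.Build K (kleinian alpha)
    (@pres_scaleAr _ _ (kleinian_rel alpha)).
End Kleinian.

(** * Extension of scalars: the tensor product L (x)_K A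

    A formal sum [:: (l1, a1); ...; (ln, an)] stands for the tensor
    l1 (x) a1 + ... + ln (x) an, where L is a K-algebra through [j]. *)

Inductive tensor_eq (K L : fieldType) (j : {rmorphism K -> L}) (A : algType K) :
  seq (L * A) -> seq (L * A) -> Prop :=
| te_refl s : tensor_eq j s s
| te_sym s t : tensor_eq j s t -> tensor_eq j t s
| te_trans s t u : tensor_eq j s t -> tensor_eq j t u -> tensor_eq j s u
| te_cat s s' t t' : tensor_eq j s s' -> tensor_eq j t t' ->
    tensor_eq j (s ++ t) (s' ++ t')
| te_catC s t : tensor_eq j (s ++ t) (t ++ s)
| te_0 a : tensor_eq j [:: (0, a)] [::]
| te_Dl l m a : tensor_eq j [:: (l + m, a)] [:: (l, a); (m, a)]
| te_Dr l a b : tensor_eq j [:: (l, a + b)] [:: (l, a); (l, b)]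
| te_Z l k a : tensor_eq j [:: (l * j k, a)] [:: (l, k *: a)].

Section Tensor.
Variables (K L : fieldType) (j : {rmorphism K -> L}) (A : algType K).
Implicit Types s t u : seq (L * A).
Local Notation "s ~ t" := (tensor_eq j s t) (at level 70).

Definition tensor_rel : rel (seq (L * A)) := fun s t => `[< s ~ t >].

Fact tensor_rel_refl : reflexive tensor_rel.
Proof. by move=> t; apply/asboolP; exact: te_refl. Qed.

Fact tensor_rel_sym : symmetric tensor_rel.
Proof. by move=> s t; apply/asboolP/asboolP; exact: te_sym. Qed.

Fact tensor_rel_trans : transitive tensor_rel.
Proof. by move=> t s u /asboolP st /asboolP tu; apply/asboolP/(te_trans st). Qed.

Canonical tensor_equiv :=
  EquivRel tensor_rel tensor_rel_refl tensor_rel_sym tensor_rel_trans.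

Definition tensor := {eq_quot tensor_equiv}%qT.
HB.instance Definition _ := Choice.on tensor.

Definition tensor_class s : tensor := (\pi_({eq_quot tensor_equiv}) s)%qT.
Definition tensor_repr (x : tensor) : seq (L * A) := (repr x)%qT.

Lemma tensor_reprK x : tensor_class (tensor_repr x) = x.
Proof. exact: reprK. Qed.

Lemma tensor_classP s t : tensor_class s = tensor_class t <-> s ~ t.
Proof.
split=> [/eqmodP /= /asboolP //|st].
by apply/eqmodP/asboolP.
Qed.

Lemma tensor_classK s : tensor_repr (tensor_class s) ~ s.
Proof. by apply/tensor_classP; rewrite tensor_reprK. Qed.

Lemma tensor_ind (P : tensor -> Prop) :
  (forall s, P (tensor_class s)) -> forall x, P x.
Proof. by move=> Pc x; rewrite -(tensor_reprK x). Qed.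

(* (l (x) a) (m (x) b) = l m (x) a b *)
Definition fmul s t : seq (L * A) := [seq (p.1 * q.1, p.2 * q.2) | p <- s, q <- t].
Definition fscale (l : L) s : seq (L * A) := [seq (l * p.1, p.2) | p <- s].

Lemma fscale_eq l s t : s ~ t -> fscale l s ~ fscale l t.
Proof.
elim=> {s t} /=.
- by move=> s; exact: te_refl.
- by move=> s t _; exact: te_sym.
- by move=> s t u _ IH _; exact: te_trans.
- by move=> s s' t t' _ IH _ IH'; rewrite /fscale !map_cat; exact: te_cat.
- by move=> s t; rewrite /fscale !map_cat; exact: te_catC.
- by move=> a; rewrite mulr0; exact: te_0.
- by move=> m n a; rewrite mulrDr; exact: te_Dl.
- by move=> m a b; exact: te_Dr.
- by move=> m k a; rewrite mulrA; exact: te_Z.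
Qed.

Lemma fmul1_eq p s t : s ~ t -> fmul [:: p] s ~ fmul [:: p] t.
Proof.
rewrite /fmul /= !cats0; elim=> {s t} /=.
- by move=> s; exact: te_refl.
- by move=> s t _; exact: te_sym.
- by move=> s t u _ IH _; exact: te_trans.
- by move=> s s' t t' _ IH _ IH'; rewrite !map_cat; exact: te_cat.
- by move=> s t; rewrite !map_cat; exact: te_catC.
- by move=> a; rewrite mulr0; exact: te_0.
- by move=> m n a; rewrite mulrDr; exact: te_Dl.
- by move=> m a b; rewrite mulrDr; exact: te_Dr.
- by move=> m k a; rewrite mulrA -scalerAr; exact: te_Z.
Qed.

Lemma fmul_cons p s t : fmul (p :: s) t = fmul [:: p] t ++ fmul s t.
Proof. by rewrite /fmul /= cats0. Qed.

Lemma fmul_catl s t u : fmul (s ++ t) u = fmul s u ++ fmul t u.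
Proof. by rewrite /fmul map_cat flatten_cat. Qed.

Lemma fmul_eqr s t u : t ~ u -> fmul s t ~ fmul s u.
Proof.
move=> tu; elim: s => [|p s IH]; first exact: te_refl.
by rewrite !(fmul_cons p s); apply: te_cat => //; exact: fmul1_eq.
Qed.

Lemma te_catACA s t u v : (s ++ t) ++ (u ++ v) ~ (s ++ u) ++ (t ++ v).
Proof.
rewrite -!catA; apply: te_cat; first exact: te_refl.
by rewrite !catA; apply: te_cat; [exact: te_catC|exact: te_refl].
Qed.

Lemma fmul_catr s t u : fmul s (t ++ u) ~ fmul s t ++ fmul s u.
Proof.
elim: s => [|p s IH]; first exact: te_refl.
rewrite !(fmul_cons p s); apply: te_trans (te_catACA _ _ _ _).
by apply: te_cat => //; rewrite /fmul /= !cats0 map_cat; exact: te_refl.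
Qed.

Lemma fmul_eql s t u : s ~ t -> fmul s u ~ fmul t u.
Proof.
elim=> {s t}.
- by move=> s; exact: te_refl.
- by move=> s t _; exact: te_sym.
- by move=> s t v _ IH _; exact: te_trans.
- by move=> s s' t t' _ IH _ IH'; rewrite !fmul_catl; exact: te_cat.
- by move=> s t; rewrite !fmul_catl; exact: te_catC.
- move=> a; elim: u => [|q u IH]; first exact: te_refl.
  rewrite -(cat1s q u); apply: te_trans (fmul_catr _ _ _) _.
  rewrite -[X in _ ~ X]/([::] ++ fmul [::] u).
  by apply: te_cat IH; rewrite /fmul /= mul0r; exact: te_0.
- move=> l m a; elim: u => [|q u IH]; first exact: te_refl.
  rewrite -(cat1s q u); apply: te_trans (fmul_catr _ _ _) _.
  apply: te_trans (te_sym (fmul_catr _ _ _)); apply: te_cat IH.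
  by rewrite /fmul /= mulrDl; exact: te_Dl.
- move=> l a b; elim: u => [|q u IH]; first exact: te_refl.
  rewrite -(cat1s q u); apply: te_trans (fmul_catr _ _ _) _.
  apply: te_trans (te_sym (fmul_catr _ _ _)); apply: te_cat IH.
  by rewrite /fmul /= mulrDl; exact: te_Dr.
- move=> l k a; elim: u => [|q u IH]; first exact: te_refl.
  rewrite -(cat1s q u); apply: te_trans (fmul_catr _ _ _) _.
  apply: te_trans (te_sym (fmul_catr _ _ _)); apply: te_cat IH.
  by rewrite /fmul /= -scalerAl mulrAC; exact: te_Z.
Qed.

Definition tensor_add x y := tensor_class (tensor_repr x ++ tensor_repr y).
Definition tensor_mul x y := tensor_class (fmul (tensor_repr x) (tensor_repr y)).
Definition tensor_scale l x := tensor_class (fscale l (tensor_repr x)).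
Definition tensor_opp x := tensor_scale (-1) x.

Lemma tensor_addE s t :
  tensor_add (tensor_class s) (tensor_class t) = tensor_class (s ++ t).
Proof. by apply/tensor_classP/te_cat; exact: tensor_classK. Qed.

Lemma tensor_mulE s t :
  tensor_mul (tensor_class s) (tensor_class t) = tensor_class (fmul s t).
Proof.
apply/tensor_classP; apply: te_trans (fmul_eql _ (tensor_classK s)) _.
exact: fmul_eqr (tensor_classK t).
Qed.

Lemma tensor_scaleE l s : tensor_scale l (tensor_class s) = tensor_class (fscale l s).
Proof. exact/tensor_classP/fscale_eq/tensor_classK. Qed.

Fact tensor_addA : associative tensor_add.
Proof.
elim/tensor_ind=> s; elim/tensor_ind=> t; elim/tensor_ind=> u.
by rewrite !tensor_addE catA.
Qed.

Fact tensor_addC : commutative tensor_add.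
Proof.
elim/tensor_ind=> s; elim/tensor_ind=> t.
by rewrite !tensor_addE; apply/tensor_classP/te_catC.
Qed.

Fact tensor_add0 : left_id (tensor_class [::]) tensor_add.
Proof. by elim/tensor_ind=> s; rewrite tensor_addE. Qed.

Lemma fscaleDl l m s : fscale (l + m) s ~ fscale l s ++ fscale m s.
Proof.
elim: s => [|[n a] s IH] /=; first exact: te_refl.
have H := te_catACA [:: (l * n, a)] [:: (m * n, a)] (fscale l s) (fscale m s).
apply: te_trans H; rewrite mulrDl -cat1s.
by apply: te_cat IH; exact: te_Dl.
Qed.

Lemma fscale0 s : fscale 0 s ~ [::].
Proof.
elim: s => [|[n a] s IH] /=; first exact: te_refl.
rewrite mul0r -cat1s -[X in _ ~ X]cat0s.
by apply: te_cat IH; exact: te_0.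
Qed.

Lemma fscale1 s : fscale 1 s = s.
Proof. by elim: s => //= -[n a] s ->; rewrite mul1r. Qed.

Fact tensor_addN : left_inverse (tensor_class [::]) tensor_opp tensor_add.
Proof.
elim/tensor_ind=> s; rewrite /tensor_opp tensor_scaleE tensor_addE.
apply/tensor_classP; rewrite -[X in _ ++ X]fscale1.
by apply: te_trans (te_sym (fscaleDl _ _ _)) _; rewrite addNr; exact: fscale0.
Qed.

HB.instance Definition _ :=
  GRing.isZmodule.Build tensor tensor_addA tensor_addC tensor_add0 tensor_addN.

Lemma tensor_classD s t : tensor_class s + tensor_class t = tensor_class (s ++ t).
Proof. exact: tensor_addE. Qed.

Fact tensor_mulA : associative tensor_mul.
Proof.
elim/tensor_ind=> s; elim/tensor_ind=> t; elim/tensor_ind=> u.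
rewrite !tensor_mulE; congr tensor_class.
elim: s => //= p s IH; rewrite fmul_cons [fmul (p :: s) t]fmul_cons fmul_catl IH.
congr (_ ++ _) => {s IH}; elim: t => //= q t IH.
rewrite [fmul (q :: t) u]fmul_cons.
have fcat v w : fmul [:: p] (v ++ w) = fmul [:: p] v ++ fmul [:: p] w.
  by rewrite /fmul /= !cats0 map_cat.
rewrite -(cat1s q t) !fcat fmul_catl -IH; congr (_ ++ _).
rewrite /fmul /= !cats0 -map_comp; apply: eq_map => r /=.
by rewrite !mulrA.
Qed.

Fact tensor_mul1l : left_id (tensor_class [:: (1, 1)]) tensor_mul.
Proof.
elim/tensor_ind=> s; rewrite tensor_mulE /fmul /= cats0; congr tensor_class.
by elim: s => //= -[l a] s ->; rewrite !mul1r.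
Qed.

Fact tensor_mul1r : right_id (tensor_class [:: (1, 1)]) tensor_mul.
Proof.
elim/tensor_ind=> s; rewrite tensor_mulE; congr tensor_class.
by elim: s => //= -[l a] s IH; rewrite fmul_cons IH /fmul /= !mulr1.
Qed.

Fact tensor_mulDl : left_distributive tensor_mul +%R.
Proof.
elim/tensor_ind=> s; elim/tensor_ind=> t; elim/tensor_ind=> u.
by rewrite !(tensor_classD, tensor_mulE) fmul_catl.
Qed.

Fact tensor_mulDr : right_distributive tensor_mul +%R.
Proof.
elim/tensor_ind=> s; elim/tensor_ind=> t; elim/tensor_ind=> u.
by rewrite !(tensor_classD, tensor_mulE); apply/tensor_classP/fmul_catr.
Qed.

HB.instance Definition _ := GRing.Zmodule_isPzRing.Build tensor
  tensor_mulA tensor_mul1l tensor_mul1r tensor_mulDl tensor_mulDr.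

Fact tensor_scaleA l m x : tensor_scale l (tensor_scale m x) = tensor_scale (l * m) x.
Proof.
elim/tensor_ind: x => s; rewrite !tensor_scaleE; congr tensor_class.
by rewrite /fscale -map_comp; apply: eq_map => p /=; rewrite mulrA.
Qed.

Fact tensor_scale1 : left_id 1 tensor_scale.
Proof. by elim/tensor_ind=> s; rewrite tensor_scaleE fscale1. Qed.

Fact tensor_scaleDr : right_distributive tensor_scale +%R.
Proof.
move=> l; elim/tensor_ind=> s; elim/tensor_ind=> t.
by rewrite !(tensor_classD, tensor_scaleE) /fscale map_cat.
Qed.

Fact tensor_scaleDl x : {morph tensor_scale^~ x : l m / l + m}.
Proof.
move=> l m; elim/tensor_ind: x => s.
by rewrite !(tensor_classD, tensor_scaleE); apply/tensor_classP/fscaleDl.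
Qed.

HB.instance Definition _ := GRing.Zmodule_isLmodule.Build L tensor
  tensor_scaleA tensor_scale1 tensor_scaleDr tensor_scaleDl.

Definition tens (l : L) (a : A) : tensor := tensor_class [:: (l, a)].
End Tensor.

(** * Gelfand-Kirillov dimension *)

Section GelfandKirillov.
Variables (K : fieldType) (A : algType K).

Definition in_span (s : seq A) (b : A) : Prop :=
  exists c : 'I_(size s) -> K, b = \sum_(i < size s) c i *: s`_i.

Definition lin_indep (s : seq A) : Prop :=
  forall c : 'I_(size s) -> K,
    \sum_(i < size s) c i *: s`_i = 0 -> forall i, c i = 0.

(* The dimension of the span of [s]: the largest size of an independent
   subfamily. *)
Definition span_dim (s : seq A) : nat :=
  \max_(m : (size s).-tuple bool | `[< lin_indep (mask m s) >]) size (mask m s).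

(* All products of [n] factors taken in [s]: they span V ^ n if [s] spans V. *)
Fixpoint words (s : seq A) (n : nat) : seq A :=
  if n is n'.+1 then [seq x * y | x <- s, y <- words s n'] else [:: 1].

(* The supremum ranges over the finite-dimensional subspaces V = K + span s
   of A; that V contains 1 makes V ^ n the sum of the V ^ i, i <= n. *)
Definition GKdim (R : realType) : \bar R :=
  ereal_sup (range (fun s : seq A =>
    limn_esup (fun n => (ln (span_dim (words (1 :: s) n))%:R / ln n%:R)%:E))).
End GelfandKirillov.

(** * Dixmier's partition *)

Definition ad (A : pzRingType) (a b : A) : A := a * b - b * a.

Definition noncommutative (A : pzRingType) : Prop := exists a b : A, a * b <> b * a.

Definition center (A : pzRingType) : set A := [set a | forall b, a * b = b * a].

Definition centralizer (A : pzRingType) (a : A) : set A := [set b | ad a b = 0].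

Definition nilp (A : pzRingType) (a : A) : set A :=
  [set b | exists i : nat, iter i.+1 (ad a) b = 0].

Section Dixmier.
(* [L] plays the role of an algebraic closure of [K], embedded by [j]. *)
Variables (K L : fieldType) (j : {rmorphism K -> L}) (A : algType K).
Implicit Types a b : A.

Definition eigenspace_ad a (l : L) : set (tensor j A) :=
  [set v | ad (tens j 1 a) v = l *: v].

(* Elements of a direct sum of eigenspaces are the finite sums of vectors that
   belong to eigenspaces for pairwise distinct eigenvalues. *)
Definition diag a : set A :=
  [set b | exists (ls : seq L) (v : L -> tensor j A),
    [/\ uniq ls, forall l, l \in ls -> eigenspace_ad a l (v l)
      & tens j 1 b = \sum_(l <- ls) v l]].

(* K[ad a] b *)
Definition ad_orbit a b : set A :=
  range (fun p : {poly K} => \sum_(i < size p) p`_i *: iter i (ad a) b).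

Definition finite_dim (S : set A) : Prop := exists s : seq A, S `<=` in_span s.

Definition locally_finite a : set A := [set b | finite_dim (ad_orbit a b)].

Definition Delta1 : set A :=
  [set a | ~ center a /\ nilp a = setT /\ diag a = centralizer a].
Definition Delta2 : set A :=
  [set a | ~ center a /\
    [/\ centralizer a <> nilp a, nilp a <> setT & diag a = centralizer a]].
Definition Delta3 : set A :=
  [set a | ~ center a /\ nilp a = centralizer a /\ diag a = setT].
Definition Delta4 : set A :=
  [set a | ~ center a /\
    [/\ nilp a = centralizer a, centralizer a <> diag a,
        diag a = locally_finite a & locally_finite a <> setT]].
Definition Delta5 : set A :=
  [set a | ~ center a /\ nilp a = diag a /\ diag a = centralizer a].

Definition Dixmier_partition : Prop :=
  ~` @center A = Delta1 `|` Delta2 `|` Delta3 `|` Delta4 `|` Delta5.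

Definition commutative_centralizer_condition : Prop :=
  noncommutative A /\
  forall a, ~ center a ->
    forall b c, centralizer a b -> centralizer a c -> b * c = c * b.

(* K^* a' + Z(A) *)
Definition affine_line a' : set A :=
  [set b | exists (k : K) (z : A), [/\ k != 0, center z & b = k *: a' + z]].

Inductive centralizer_kind : Type :=
  AllStronglyNilpotent | AllWeaklyNilpotent
| GenericButStronglySemisimple | GenericButWeaklySemisimple | AllGeneric.

(* All elements of [S] are generic except for those of a subset K^* a' + Z(A),
   which lie in [Delta]. *)
Definition generic_except (Delta S : set A) : Prop :=
  exists a', [/\ Delta a', affine_line a' `<=` S, affine_line a' `<=` Delta
               & S `\` affine_line a' `<=` Delta5].

Definition of_kind a (k : centralizer_kind) : Prop :=
  let S := centralizer a `\` @center A in
  match k with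
  | AllStronglyNilpotent => S `<=` Delta1
  | AllWeaklyNilpotent => S `<=` Delta2
  | GenericButStronglySemisimple => generic_except Delta3 S
  | GenericButWeaklySemisimple => generic_except Delta4 S
  | AllGeneric => S `<=` Delta5
  end.

Definition homogeneous_centralizer_condition : Prop :=
  [/\ noncommutative A, Dixmier_partition
    & forall a, ~ center a -> exists! k, of_kind a k].
End Dixmier.

(** * Division rings of fractions *)

(* [Q] is a division ring that contains [A] through [phi] and whose elements are
   the fractions s^-1 a with a, s in A and s nonzero. *)
Definition division_ring_of_fractions (K : fieldType) (A : algType K)
    (Q : unitAlgType K) (phi : {lrmorphism A -> Q}) : Prop :=
  [/\ injective phi, forall q : Q, q != 0 -> q \is a GRing.unit
    & forall q : Q, exists a s : A, s != 0 /\ q = (phi s)^-1 * phi a].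

(* Main.v *)
Require Import Defs.
From HB Require Import structures.
From mathcomp Require Import all_boot all_order all_algebra.
From mathcomp Require Import separable.
From mathcomp Require Import boolp classical_sets reals ereal sequences exp.
From mathcomp Require Import fsbigop topology.
From mathcomp Require Import zify ring lra.
Set Implicit Arguments.
Unset Strict Implicit.
Unset Printing Implicit Defensive.
Import Order.TTheory GRing.Theory Num.Theory.
Local Open Scope ring_scope.

(** The Weyl division ring Q is embedded in the ring S = L(t)((X; sigma)) of skew
    Laurent series, in which X f(t) = f(t - 1) X and L is the algebraic closure of K: x
    goes to X and the derivation d to (t + 1) X^-1, so that x d becomes t. Two features
    make S useful. It is a division algebra over L, not only over K, so the eigenvalues
    of inner derivations of subalgebras of Q become available in it. And the centralizer
    of a non-scalar element of S is commutative ([laurent_centralizer_comm]): if y has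
    valuation n <> 0, the leading coefficients of the elements of given valuation that
    commute with y are proportional over the field L of fixed points of sigma^n, and
    this forces commutators to have arbitrarily large valuation. Hence noncommutative
    subalgebras of Q have commutative centralizers, and commuting non-central elements
    a, b have the same centralizer and the same N(a) = N(b) ([centralizer_eq],
    [nilp_eq]).

    Let B be a noncommutative subalgebra of Q of Gelfand-Kirillov dimension less than 3.
    If a non-central a in B and two elements q, r of the L-span of B in S are such that
    the q^i r^k are left linearly independent over the centralizer of a in S, then the
    a^i q^k r^l are linearly independent over L, because a is transcendental over L.
    This is cubic growth, which is excluded ([small_growth]). To get such independence,
    right multiplication by a is regarded as a linear operator on S over that
    centralizer, which is commutative: then generalized eigenvectors with pairwise
    distinct pairs (eigenvalue, exact nilpotency level) are independent
    ([left_independent]). This is used twice.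

    First, suppose that D(a) <> C(a). Then the L-span of B contains v <> 0 with [a, v] =
    l v and l <> 0. If moreover some element of F(a) were not in D(a), the L-span of B
    would also contain a Jordan vector w of ad a, that is [a, w] = m w + u and [a, u] =
    m u with u <> 0. As ad a is a derivation, v^i w^k is a generalized eigenvector for i
    l + k m of exact level k, and the v^i w^k are independent: a contradiction. So D(a)
    <> C(a) implies F(a) = D(a), whence also N(a) = C(a). The Dixmier partition is a
    formal consequence.

    Secondly, let a and b commute, with D(a) <> C(a) and D(b) <> C(b), and take
    eigenvectors [a, v] = l v and [b, w] = m w with l and m nonzero. The v^i w^k are
    eigenvectors for the conjugates of a by the v^i w^k, so two of these conjugates
    coincide. It follows that conjugation by some v^n with n > 0 moves b by a scalar. As
    it moves a by a nonzero scalar, it fixes a combination of a and b; this combination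
    is a scalar, since otherwise v^n would commute with a. So b is in K a + Z(B)
    ([semisimple_on_line]). Therefore the non-generic elements of a centralizer where N
    = C form one line K^* a' + Z(B), which gives the homogeneous centralizer condition.

    The algebras A_1 and A(alpha) are instances. Their normal forms, of at most
    quadratic growth, bound the Gelfand-Kirillov dimension ([GKdim_lt3_filtration]), and
    A(alpha) embeds in Q through H = x d, X = x, Y = alpha(H) x^-1. *)

(** * Linear independence and growth *)

Section LinearAlgebra.

Lemma indep_le_span (F : fieldType) (V : lmodType F) n m (x : 'I_n -> V) (y : 'I_m -> V) :
  (forall c : 'I_n -> F, \sum_i c i *: x i = 0 -> forall i, c i = 0) ->
  (forall i, exists d : 'I_m -> F, x i = \sum_k d k *: y k) -> (n <= m)%N.
Proof.
move=> x_indep /choice[d xE]; rewrite leqNgt; apply/negP => mn.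
(* With more vectors than coordinates, the matrix of coordinates has a nonzero row
   relation. *)
pose M := \matrix_(i < n, k < m) d i k.
have : kermx M != 0.
  rewrite -mxrank_eq0 mxrank_ker subn_eq0 -ltnNge.
  exact: leq_ltn_trans (rank_leq_col _) mn.
case/rowV0Pn => v /sub_kermxP vM; case/eqP; apply/rowP => i; rewrite mxE.
apply: (x_indep (v 0)); under eq_bigr => k _ do rewrite xE scaler_sumr.
rewrite exchange_big big1// => k _; have : (v *m M) 0 k = 0 by rewrite vM mxE.
rewrite mxE => E; apply: etrans (scale0r (y k)); rewrite -E scaler_suml.
by apply: eq_bigr => l _; rewrite scalerA mxE.
Qed.

Variables (K : fieldType) (A : algType K).
Implicit Types (s t : seq A) (b : A).

(** Linear independence is defined by positions in the list; as it excludes repetitions,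
    coefficients may as well be indexed by the vectors themselves. *)
Lemma lin_indepP s : lin_indep s <->
  uniq s /\ forall c : A -> K, \sum_(b <- s) c b *: b = 0 -> forall b, b \in s -> c b = 0.
Proof.
have sumE (c : A -> K) : \sum_(b <- s) c b *: b = \sum_(i < size s) c s`_i *: s`_i.
  by rewrite (big_nth 0) big_mkord.
split=> [sI|[su sI] c c0 i].
  split=> [|c c0 b bs].
    apply/(uniqPn 0) => -[i [k [ik ks sE]]].
    have isz : (i < size s)%N by exact: ltn_trans ik ks.
    have c0 := sI (fun l => (val l == i)%:R - (val l == k)%:R).
    suff {}/c0/(_ (Ordinal isz))/eqP : \sum_(l < size s)
        ((val l == i)%:R - (val l == k)%:R) *: s`_l = 0.
      by rewrite /= eqxx (ltn_eqF ik) subr0 oner_eq0.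
    under eq_bigr => l _ do rewrite scalerBl.
    rewrite sumrB (bigD1 (Ordinal isz))//= eqxx scale1r big1 ?addr0; last first.
      by move=> l li; rewrite (_ : (l == i :> nat) = false) ?scale0r//; apply/negbTE.
    rewrite (bigD1 (Ordinal ks))//= eqxx scale1r big1 ?addr0 ?sE ?subrr//.
    by move=> l li; rewrite (_ : (l == k :> nat) = false) ?scale0r//; apply/negbTE.
  rewrite sumE in c0; have bsz : (index b s < size s)%N by rewrite index_mem.
  by have := sI _ c0 (Ordinal bsz); rewrite /= nth_index.
pose c' b := if insub (index b s) is Some l then c l else 0.
have c'E (l : 'I_(size s)) : c' s`_l = c l.
  by rewrite /c' index_uniq// valK.
rewrite -c'E; apply: sI; last exact: mem_nth.
by rewrite sumE -[RHS]c0; apply: eq_bigr => l _; rewrite c'E.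
Qed.

Lemma lin_indep_perm s t : perm_eq s t -> lin_indep s -> lin_indep t.
Proof.
move=> st /lin_indepP[su sI]; apply/lin_indepP; split=> [|c].
  by rewrite -(perm_uniq st).
by rewrite -(perm_big _ st) => /sI cs b; rewrite -(perm_mem st) => /cs.
Qed.

Lemma lin_indep_le_span_dim s t : lin_indep t -> {subset t <= s} ->
  (size t <= span_dim s)%N.
Proof.
move=> tI ts; have [tu _] := (lin_indepP t).1 tI.
have [m sm mE] : exists2 m, size m = size s & perm_eq t (mask m s).
  have /subseqP[m sm mE] := subseq_trans (filter_subseq (mem t) (undup s)) (undup_subseq s).
  exists m => //; rewrite -mE; apply: uniq_perm; rewrite ?filter_uniq ?undup_uniq//.
  move=> b; rewrite mem_filter mem_undup.
  by apply/idP/andP => [bt|[]//]; split=> //; exact: ts.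
rewrite (perm_size mE); have /eqP sm' := sm.
apply: (@leq_bigmax_cond _ _ (fun m : (size s).-tuple bool => size (mask m s)) (Tuple sm')).
by apply/asboolP; exact: lin_indep_perm tI.
Qed.

(** A linearly independent sublist of maximal length spans, since any vector outside of
    its span could be added to it. *)
Lemma span_dim_basis s : exists t, [/\ size t = span_dim s, lin_indep t
  & forall b, b \in s -> in_span t b].
Proof.
have nilI : lin_indep ([::] : seq A) by move=> c _ [].
have [m mI sE] : exists2 m : (size s).-tuple bool, `[< lin_indep (mask m s) >] &
    span_dim s = size (mask m s).
  pose I := [pred m : (size s).-tuple bool | `[< lin_indep (mask m s) >]].
  have I0 : (0 < #|I|)%N.
    apply/card_gt0P; exists (nseq_tuple (size s) false).
    by apply/asboolP; rewrite /= mask_false.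
  have [m mI mE] := eq_bigmax_cond (fun m : (size s).-tuple bool => size (mask m s)) I0.
  by exists m.
move/asboolP: mI => tI; exists (mask m s); split=> // b bs.
move: tI sE; set t := mask m s => tI sE.
apply/not_notP => bt.
suff : (size (b :: t) <= span_dim s)%N by rewrite sE ltnn.
have [tu tc] := (lin_indepP t).1 tI.
have span_t (c : A -> K) : in_span t (\sum_(x <- t) c x *: x).
  by exists (fun i => c t`_i); rewrite (big_nth 0) big_mkord.
apply: lin_indep_le_span_dim; last first.
  by move=> x; rewrite inE => /predU1P[->//|/mem_mask].
apply/lin_indepP; split=> [|c].
  rewrite /= tu andbT; apply/negP => b_t; apply: bt.
  have := span_t (fun x => (x == b)%:R); rewrite (bigD1_seq b)//= eqxx scale1r big1 ?addr0//.
  by move=> x /negbTE ->; rewrite scale0r.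
rewrite big_cons => cE; have [cb|cb] := eqVneq (c b) 0.
  move: cE; rewrite cb scale0r add0r => /tc ct x.
  by rewrite inE => /predU1P[->//|/ct].
case: bt; have := span_t (fun x => - (c b)^-1 * c x).
suff -> : \sum_(x <- t) (- (c b)^-1 * c x) *: x = b by [].
under eq_bigr => x _ do rewrite -scalerA.
rewrite -scaler_sumr; move/eqP: cE; rewrite addrC addr_eq0 => /eqP ->.
by rewrite scaleNr scalerN opprK scalerA mulVf// scale1r.
Qed.

Lemma span_dim_le s t : (forall b, b \in s -> in_span t b) -> (span_dim s <= size t)%N.
Proof.
move=> st; apply/bigmax_leqP => m /asboolP sI.
apply: (indep_le_span (x := fun i : 'I_(size (mask m s)) => (mask m s)`_i)
  (y := fun i : 'I_(size t) => t`_i)); first exact: sI.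
by move=> i; apply/st/mem_mask/mem_nth.
Qed.
End LinearAlgebra.

Section GrowthBounds.
Variables (R : realType) (K : fieldType) (A : algType K).

Lemma ln_unbounded (M : R) : exists N : nat, forall n, (N <= n)%N -> M <= ln n%:R.
Proof.
exists (Num.bound (expR M)) => n Nn; rewrite -[M]expRK ler_ln ?posrE ?expR_gt0//.
  have := archi_boundP (ltW (expR_gt0 M)) => /ltW /le_trans; apply.
  by rewrite ler_nat.
have := archi_boundP (ltW (expR_gt0 M)) => /(lt_trans (expR_gt0 M)) /lt_le_trans; apply.
by rewrite ler_nat.
Qed.

(** The dimension in fact is at most 2; the bound 5/2 is what remains once the constant
    c has been absorbed for large n: the logarithm of the square of 2 (c + 1) n is at
    most (5/2) ln n as soon as ln n is at least 4 ln (2 (c + 1)). *)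
Lemma GKdim_lt3 :
  (forall s : seq A, exists c : nat, forall n,
    (span_dim (words (1%R :: s) n) <= (c * n.+1) ^ 2)%N) -> (GKdim A R < 3%:E)%E.
Proof.
move=> bound; apply: (@le_lt_trans _ _ (5%:R / 2)%:E); last by rewrite lte_fin; lra.
apply: ge_ereal_sup => _ [s _ <-]; have [c cP] := bound s.
have [N NP] := ln_unbounded (Num.max 1 (4 * ln (2 * c.+1%:R))).
rewrite /limn_esup /ereal_normedtype.limf_esup.
pose u (n : nat) : \bar R := (ln (span_dim (words (1 :: s) n))%:R / ln n%:R)%:E.
apply: (@le_trans _ _ (ereal_sup (u @` [set n | (N <= n)%N])%classic)).
  apply: ereal_inf_lbound; exists [set n | (N <= n)%N]%classic => //.
  exact: nbhs_infty_ge.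
apply: ge_ereal_sup => _ [n Nn <-]; rewrite lee_fin.
have := NP n Nn; rewrite ge_max => /andP[ln1 lnc].
rewrite ler_pdivrMr; last by lra.
have n0 : (0 < n)%N by case: n ln1 {Nn lnc} => //; rewrite ln0//; lra.
have d0 : (0 : R) < (2 * c.+1%:R * n%:R) by rewrite !mulr_gt0// ltr0n.
set d := span_dim _.
have dle : ln d%:R <= ln ((2 * c.+1%:R * n%:R) ^+ 2) :> R.
  have [->|dn0] := posnP d.
    rewrite ln0//; apply: ln_ge0; rewrite -!natrM -natrX ler1n expn_gt0.
    by rewrite !muln_gt0 n0.
  rewrite ler_ln ?posrE ?ltr0n ?exprn_gt0// -!natrM -natrX ler_nat.
  apply: leq_trans (cP n) _; rewrite leq_exp2r//; nia.
apply: (le_trans dle); rewrite lnXn// lnM ?posrE ?ltr0n ?mulr_gt0//.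
by rewrite mulr2n; lra.
Qed.

(** A product of three powers with exponents at most n / 3 has length at most n, whence
    this form of the bound. The quotient of logarithms is at least 3 - e as soon as e ln
    n is at least 3 ln 3. *)
Lemma GKdim_ge3 (s : seq A) :
  (forall n, ((n %/ 3).+1 ^ 3 <= span_dim (words (1%R :: s) n))%N) -> (3%:E <= GKdim A R)%E.
Proof.
move=> bound; pose u n := (ln (span_dim (words (1 :: s) n))%:R / ln n%:R : R)%:E.
apply: (@le_trans _ _ (limn_esup u)); last first.
  by apply: ereal_sup_ubound; exists s.
apply/lee_addgt0Pr => e e0.
rewrite -leeBlDr//; apply: le_ereal_inf_tmp => _ [V [M _ MV] <-].
have [N NP] := ln_unbounded (Num.max 1 (3 * ln 3 / e)).
pose n := maxn N M.
apply: (@le_trans _ _ (ln (span_dim (words (1 :: s) n))%:R / ln n%:R : R)%:E); last first.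
  apply: ereal_sup_ubound; exists n => //; apply: MV; exact: leq_maxr.
rewrite -EFinB lee_fin.
have := NP n (leq_maxl _ _); rewrite ge_max => /andP[ln1 lne].
have n0 : (0 < n)%N by case: n ln1 {lne} => //; rewrite ln0//; lra.
rewrite ler_pdivlMr; last by lra.
have nE : ln n%:R <= ln 3 + ln (n %/ 3).+1%:R :> R.
  rewrite -lnM ?posrE ?ltr0n// ler_ln ?posrE ?mulr_gt0 ?ltr0n//.
  by rewrite -natrM ler_nat; lia.
have : ln (((n %/ 3).+1%:R) ^+ 3) <= ln (span_dim (words (1 :: s) n))%:R :> R.
  rewrite ler_ln ?posrE ?exprn_gt0 ?ltr0n//; last by apply: leq_trans (bound n).
  by rewrite -natrX ler_nat.
rewrite lnXn ?ltr0n// => dle; apply: le_trans dle.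
move: lne; rewrite ler_pdivrMr// => lne.
rewrite mulrBl -mulr_natl; move: nE lne; nra.
Qed.
End GrowthBounds.

Section InSpan.
Variables (K : fieldType) (A : algType K) (s : seq A).

Lemma in_span0 : in_span s 0.
Proof. by exists (fun=> 0); rewrite big1// => i _; rewrite scale0r. Qed.

Lemma in_spanD a b : in_span s a -> in_span s b -> in_span s (a + b).
Proof.
move=> [c ->] [d ->]; exists (fun i => c i + d i); rewrite -big_split.
by apply: eq_bigr => i _; rewrite scalerDl.
Qed.

Lemma in_spanZ k a : in_span s a -> in_span s (k *: a).
Proof.
move=> [c ->]; exists (fun i => k * c i); rewrite scaler_sumr.
by apply: eq_bigr => i _; rewrite scalerA.
Qed.

Lemma mem_in_span a : a \in s -> in_span s a.
Proof.
move=> sa; have ilt : (index a s < size s)%N by rewrite index_mem.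
exists (fun i => (i == Ordinal ilt)%:R); rewrite (bigD1 (Ordinal ilt))//= eqxx scale1r.
rewrite nth_index// big1 ?addr0// => i /negbTE ->; exact: scale0r.
Qed.
End InSpan.

Lemma in_span_sub (K : fieldType) (A : algType K) (s t : seq A) a :
  {subset s <= t} -> in_span s a -> in_span t a.
Proof.
move=> st [c ->]; apply: (big_ind (in_span t)) => [||i _]; [exact: in_span0|exact: in_spanD|].
exact/in_spanZ/mem_in_span/st/mem_nth.
Qed.

(** * Polynomials in a linear operator *)

Definition pact (F : fieldType) (V : lmodType F) (delta : V -> V) (p : {poly F}) (v : V) : V :=
  \sum_(i < size p) p`_i *: iter i delta v.

Section PolynomialAction.
Variables (F : fieldType) (V : lmodType F) (delta : V -> V).
Hypothesis delta_linear : linear delta.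

HB.instance Definition _ := GRing.isLinear.Build F V V *:%R delta delta_linear.

Local Notation act := (pact delta).
Implicit Types (p q : {poly F}) (u v : V).

Lemma pact_wide n p v : (size p <= n)%N -> act p v = \sum_(i < n) p`_i *: iter i delta v.
Proof.
move=> pn; rewrite /pact (big_ord_widen n (fun i => p`_i *: iter i delta v))//.
rewrite [RHS](bigID (fun i : 'I_n => (i < size p)%N)) /=.
rewrite [X in _ + X]big1 ?addr0// => i; rewrite -leqNgt => ip.
by rewrite nth_default// scale0r.
Qed.

Lemma pactD p q v : act (p + q) v = act p v + act q v.
Proof.
pose n := maxn (size p) (size q).
rewrite (@pact_wide n); last exact: size_polyD.
rewrite (@pact_wide n p) ?leq_maxl// (@pact_wide n q) ?leq_maxr// -big_split.
by apply: eq_bigr => i _; rewrite coefD scalerDl.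
Qed.

Lemma pactZ k p v : act (k *: p) v = k *: act p v.
Proof.
rewrite (@pact_wide (size p)) ?size_scale_leq// /pact scaler_sumr.
by apply: eq_bigr => i _; rewrite coefZ scalerA.
Qed.

Lemma pactC k v : act k%:P v = k *: v.
Proof. by rewrite (@pact_wide 1) ?size_polyC_leq1// big_ord1 coefC. Qed.

Lemma pactMX p v : act (p * 'X) v = act p (delta v).
Proof.
rewrite (@pact_wide (size p).+1); last first.
  by have [->|p0] := eqVneq p 0; rewrite ?mul0r ?size_poly0// size_mulX.
rewrite big_ord_recl coefMX /= scale0r add0r; apply: eq_bigr => i _.
by rewrite coefMX /= -iterS iterSr.
Qed.

Lemma pact_delta p v : act p (delta v) = delta (act p v).
Proof.
rewrite /pact linear_sum; apply: eq_bigr => i _.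
by rewrite linearZ /= -iterS iterSr.
Qed.

Lemma pact_linear p : linear (act p).
Proof.
move=> k u v; rewrite /pact scaler_sumr -big_split; apply: eq_bigr => i _.
suff -> : iter i delta (k *: u + v) = k *: iter i delta u + iter i delta v.
  by rewrite scalerDr !scalerA mulrC.
by elim: (nat_of_ord i) => //= m ->; rewrite linearP.
Qed.

HB.instance Definition _ p := GRing.isLinear.Build F V V *:%R (act p) (pact_linear p).

Lemma pact0 p : act p 0 = 0. Proof. exact: linear0. Qed.

Lemma pact_sum p (I : Type) (r : seq I) (f : I -> V) :
  act p (\sum_(i <- r) f i) = \sum_(i <- r) act p (f i).
Proof. exact: linear_sum. Qed.

Lemma pactM p q v : act (p * q) v = act p (act q v).
Proof.
elim/poly_ind: p v => [|p c IH] v; first by rewrite mul0r -polyC0 !pactC !scale0r.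
rewrite mulrDl !pactD mul_polyC pactZ pactC -mulrA [_ * q]mulrC mulrA pactMX.
by rewrite pactMX IH pact_delta.
Qed.

Lemma pactXsubC r v : act ('X - r%:P) v = delta v - r *: v.
Proof. by rewrite -polyCN pactD pactC scaleNr -[X in act X]mul1r pactMX pactC scale1r. Qed.

Lemma pactXn n v : act 'X^n v = iter n delta v.
Proof.
elim: n => [|n IH]; first by rewrite expr0 pactC scale1r.
by rewrite exprS mulrC pactMX pact_delta IH.
Qed.

Lemma pact_eigen p r v : delta v = r *: v -> act p v = p.[r] *: v.
Proof.
move=> vr; rewrite horner_coef /pact scaler_suml; apply: eq_bigr => i _.
rewrite -scalerA; congr (_ *: _); elim: (nat_of_ord i) => [|m IH].
  by rewrite expr0 scale1r.
by rewrite iterS IH linearZ /= vr scalerA exprSr.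
Qed.

Lemma pact_dvd p q v : p %| q -> act p v = 0 -> act q v = 0.
Proof. by move=> /divpK <- pv; rewrite pactM pv linear0. Qed.

(** A vector z killed by a split polynomial in delta is a sum of eigenvectors, provided
    that the roots are distinct or that delta has no Jordan block of size 2 among the
    vectors considered. These form a subspace P stable under delta, so that the
    eigenvectors can be found in it; this matters because P will be the L-span of a
    subalgebra. By induction, (delta - r) z is a sum of eigenvectors v' s. Dividing
    those with s <> r by s - r and subtracting them from z leaves a vector y for which
    (delta - r) y is either 0 or the eigenvector v' r. The latter is excluded by either
    hypothesis: r would be a repeated root, and y a Jordan vector. *)
Lemma eigen_decomposition (P : V -> Prop) (rs : seq F) (z : V) :
  P 0 -> (forall u v, P u -> P v -> P (u + v)) -> (forall k v, P v -> P (k *: v)) ->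
  (forall v, P v -> P (delta v)) ->
  uniq rs \/ (forall m w, P w ->
    delta (delta w - m *: w) = m *: (delta w - m *: w) -> delta w = m *: w) ->
  P z -> act (\prod_(r <- rs) ('X - r%:P)) z = 0 ->
  exists v : F -> V, (forall r, P (v r) /\ delta (v r) = r *: v r) /\
    z = \sum_(r <- undup rs) v r.
Proof.
move=> P0 PD PZ Pd; elim: rs z => [|r rs IH] z.
  move=> _ _; rewrite big_nil pactC scale1r => ->; exists (fun=> 0).
  by split=> [r|]; rewrite ?linear0 ?scaler0 ?big_nil.
move=> ss Pz; rewrite big_cons mulrC pactM pactXsubC => zrs.
have Pz' : P (delta z - r *: z).
  by apply: PD; [exact: Pd|rewrite -scaleNr; exact: PZ].
have ss' : uniq rs \/ (forall m w, P w ->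
    delta (delta w - m *: w) = m *: (delta w - m *: w) -> delta w = m *: w).
  by case: ss => [/= /andP[_ urs]|ss]; [left|right].
have [v' [v'P zE]] := IH _ ss' Pz' zrs.
pose y := z - \sum_(s <- undup rs | s != r) (s - r)^-1 *: v' s.
have Py : P y.
  apply: (PD) => //; rewrite -scaleN1r; apply: (PZ).
  by apply: (big_ind P) => [||s _]; [exact: P0|exact: PD|apply: PZ; case: (v'P s)].
have yE : delta y - r *: y = if r \in rs then v' r else 0.
  pose W := \sum_(s <- undup rs | s != r) (s - r)^-1 *: v' s.
  have WE : delta W - r *: W = \sum_(s <- undup rs | s != r) v' s.
    rewrite linear_sum scaler_sumr -sumrB; apply: eq_bigr => s sr.
    rewrite linearZ /= (v'P s).2 !scalerA -scalerBl [r * _]mulrC -mulrBr mulVf ?scale1r//.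
    by rewrite subr_eq0.
  have -> : delta y - r *: y = (delta z - r *: z) - (delta W - r *: W).
    by rewrite /y -/W linearB scalerBr !(opprD, opprK) addrACA.
  rewrite WE zE; case: ifP => rrs.
    by rewrite (bigD1_seq r) ?undup_uniq ?mem_undup//= addrK.
  rewrite [X in X - _]big_seq [X in _ - X]big_seq_cond.
  rewrite (eq_bigl (fun s => (s \in undup rs) && (s != r))) ?subrr// => s.
  rewrite mem_undup; case: (boolP (s \in rs)) => //= srs; symmetry.
  by apply: contraTneq srs => ->; rewrite rrs.
have yr : delta y = r *: y.
  have yE' : delta (delta y - r *: y) = r *: (delta y - r *: y).
    rewrite yE; case: ifP => _; last by rewrite linear0 scaler0.
    by case: (v'P r).
  case: ss => [/= /andP[/negbTE rrs _]|ss]; last exact: ss.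
  by apply/eqP; rewrite -subr_eq0 yE rrs.
exists (fun s => if s == r then y else (s - r)^-1 *: v' s); split=> [s|].
  case: ifP => [/eqP->|/negbT sr]; first by split.
  have [Pv vs] := v'P s; split; first exact: PZ.
  by rewrite linearZ /= vs !scalerA mulrC.
have -> : z = y + \sum_(s <- undup rs | s != r) (s - r)^-1 *: v' s by rewrite subrK.
rewrite /=; case: ifP => rrs.
  rewrite [RHS](bigD1_seq r) ?undup_uniq ?mem_undup//= eqxx; congr (_ + _).
  by apply: eq_bigr => s /negbTE ->.
rewrite big_cons eqxx; congr (_ + _); rewrite big_seq_cond [RHS]big_seq.
apply: eq_big => [s|s /andP[_ /negbTE ->]//].
rewrite mem_undup; case: (boolP (s \in rs)) => //= srs.
by apply: contraTneq srs => ->; rewrite rrs.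
Qed.
End PolynomialAction.

Lemma ad_linear (K : fieldType) (A : algType K) (a : A) : linear (ad a).
Proof.
move=> k x y; rewrite /ad mulrDr mulrDl -scalerAr -scalerAl scalerBr opprD.
by rewrite addrACA.
Qed.

(** * Square-free part *)

Section Squarefree.
Variables (F : fieldType) (L : closedFieldType) (j : {rmorphism F -> L}).
Hypothesis charF : [pchar F] =i pred0.

Definition squarefree_part (p : {poly F}) := p %/ gcdp p p^`().

(** If r were not a root of p / gcd(p, p'), its full multiplicity in p would already
    occur in gcd(p, p'), hence in p', whereas derivation lowers multiplicities by one in
    characteristic zero. *)
Lemma squarefree_part_root p (r : L) : p != 0 ->
  root (map_poly j p) r -> root (map_poly j (squarefree_part p)) r.
Proof.
move=> p0 pr; apply/negP => /negP gr.
set g := squarefree_part p in gr; pose d := gcdp p p^`().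
have pE : map_poly j p = map_poly j g * map_poly j d.
  by rewrite -rmorphM /= divpK ?dvdp_gcdl.
have pj0 : map_poly j p != 0 by rewrite map_poly_eq0.
have [e [q qr qE]] := multiplicity_XsubC (map_poly j p) r.
rewrite pj0 /= in qr.
case: e qE => [|e] qE; first by move: pr; rewrite qE mulr1 (negbTE qr).
have dvd_p' : ('X - r%:P) ^+ e.+1 %| (map_poly j p)^`().
  rewrite deriv_map; apply: (@dvdp_trans _ (map_poly j d)).
    have : ('X - r%:P) ^+ e.+1 %| map_poly j g * map_poly j d.
      by rewrite -pE qE dvdp_mull.
    rewrite Gauss_dvdpr// coprimep_expl// coprimep_sym.
    by rewrite coprimep_XsubC.
  by rewrite dvdp_map dvdp_gcdr.
move: dvd_p'; rewrite qE derivM deriv_exp derivB derivX derivC subr0 mul1r /=.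
rewrite dvdp_addr; last exact: dvdp_mulIr.
rewrite mulrnAr -mulrnAl exprS dvdp_mul2r ?expf_neq0 ?polyXsubC_eq0//.
rewrite dvdp_XsubCl /root hornerMn -mulr_natr mulf_eq0 -/(root q r) (negbTE qr) /=.
by rewrite (pcharf0P L).1// => i; rewrite (fmorph_pchar j).
Qed.
End Squarefree.

(** * Extension of scalars, and characterization of D(a) and F(a) *)

Section Tensor.
Variables (K L : fieldType) (j : {rmorphism K -> L}) (A : algType K).
Implicit Types (l : L) (x y : tensor j A).

Lemma tensor_scalerAl l x y : l *: x * y = l *: (x * y).
Proof.
elim/tensor_ind: x => s; elim/tensor_ind: y => t.
have scaleE := @tensor_scaleE K L j A; have mulE := @tensor_mulE K L j A.
rewrite /GRing.scale /GRing.mul /= !(scaleE, mulE); congr tensor_class.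
elim: s => //= p s IH; rewrite fmul_cons IH [fmul (p :: s) t]fmul_cons.
rewrite /fscale map_cat; congr (_ ++ _).
by rewrite /fmul /= !cats0 -map_comp; apply: eq_map => q /=; rewrite mulrA.
Qed.

Lemma tensor_scalerAr l x y : x * (l *: y) = l *: (x * y).
Proof.
elim/tensor_ind: x => s; elim/tensor_ind: y => t.
have scaleE := @tensor_scaleE K L j A; have mulE := @tensor_mulE K L j A.
rewrite /GRing.scale /GRing.mul /= !(scaleE, mulE); congr tensor_class.
elim: s => //= p s IH; rewrite fmul_cons IH [fmul (p :: s) t]fmul_cons.
rewrite /fscale map_cat; congr (_ ++ _).
by rewrite /fmul /= !cats0 -!map_comp; apply: eq_map => q /=; rewrite mulrCA.
Qed.

Lemma tensor_ad_linear (z : tensor j A) : linear (ad z).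
Proof.
move=> l x y; rewrite /ad mulrDr mulrDl tensor_scalerAr tensor_scalerAl scalerBr.
by rewrite opprD addrACA.
Qed.

Local Notation tens1 := (@tens K L j A 1).

Lemma tens1D a b : tens1 (a + b) = tens1 a + tens1 b.
Proof. by rewrite [RHS]tensor_classD; apply/tensor_classP; exact: te_Dr. Qed.

Lemma tens1Z k a : tens1 (k *: a) = j k *: tens1 a.
Proof.
rewrite [RHS]tensor_scaleE /=; apply/tensor_classP/te_sym.
by rewrite mulr1 -[j k]mul1r; exact: te_Z.
Qed.

Lemma tens1M a b : tens1 (a * b) = tens1 a * tens1 b.
Proof. by rewrite [RHS]tensor_mulE /fmul /= mulr1. Qed.

Lemma tens1_ad a b : tens1 (ad a b) = ad (tens1 a) (tens1 b).
Proof.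
by rewrite /ad tens1D -scaleN1r tens1Z rmorphN1 scaleN1r !tens1M.
Qed.

Variables (V : lmodType L) (f : A -> V).
Hypothesis fD : forall a b, f (a + b) = f a + f b.
Hypothesis fZ : forall k a, f (k *: a) = j k *: f a.
Hypothesis f_inj : forall a, f a = 0 -> a = 0.

Let f0 : f 0 = 0. Proof. by rewrite -(scale0r 0) fZ rmorph0 scale0r. Qed.

(** A K-linear injection f of A into an L-space extends to L (x) A by sending l (x) b to
    l f(b), and the value of this extension at 1 (x) a is f(a). *)
Lemma tens1_eq0 a : tens1 a = 0 -> a = 0.
Proof.
pose ev (s : seq (L * A)) : V := \sum_(p <- s) p.1 *: f p.2.
have evE s t : tensor_eq j s t -> ev s = ev t.
  rewrite /ev; elim=> {s t}.
  - by [].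
  - by move=> s t _ ->.
  - by move=> s t u _ -> _ ->.
  - by move=> s s' t t' _ E _ E'; rewrite !big_cat E E'.
  - by move=> s t; rewrite !big_cat /= addrC.
  - by move=> b; rewrite big_seq1 scale0r big_nil.
  - by move=> l m b; rewrite !big_cons !big_nil !addr0 scalerDl.
  - by move=> l b c; rewrite !big_cons !big_nil !addr0 fD scalerDr.
  - by move=> l k b; rewrite !big_seq1 fZ scalerA.
by move=> /tensor_classP /evE; rewrite /ev big_seq1 big_nil scale1r => /f_inj.
Qed.
End Tensor.

Lemma pact_morph (K L : fieldType) (j : {rmorphism K -> L}) (V : lmodType K)
    (W : lmodType L) (d : V -> V) (e : W -> W) (f : V -> W) p v :
  (forall u v, f (u + v) = f u + f v) -> (forall k v, f (k *: v) = j k *: f v) ->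
  (forall v, f (d v) = e (f v)) ->
  f (pact d p v) = pact e (map_poly j p) (f v).
Proof.
move=> fD fZ fd; have f0 : f 0 = 0 by rewrite -(scale0r 0) fZ rmorph0 scale0r.
rewrite /pact (big_morph f fD f0) size_map_poly; apply: eq_bigr => i _.
rewrite fZ coef_map; congr (_ *: _).
by elim: (nat_of_ord i) => //= n IH; rewrite fd IH.
Qed.

Section Characterization.
Variables (K : fieldType) (L : closedFieldType) (j : {rmorphism K -> L}).
Hypothesis charK : [pchar K] =i pred0.
Hypothesis algL : forall z : L, algebraicOver j z.
Variables (A : algType K).
Hypothesis tens1_inj : forall a : A, tens j 1 a = 0 -> a = 0.

Lemma common_annihilator (ls : seq L) :
  exists p : {poly K}, p != 0 /\ forall l, l \in ls -> root (map_poly j p) l.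
Proof.
elim: ls => [|l ls [p [p0 pls]]]; first by exists 1; rewrite oner_neq0.
have [q q0 ql] := algL l; exists (q * p); split=> [|m]; first by rewrite mulf_neq0.
rewrite inE rmorphM rootM => /predU1P[->|/pls ->]; last by rewrite orbT.
by rewrite ql.
Qed.

(** Membership in D(a) is expressed without extending scalars. The polynomial over K
    comes from the minimal polynomials of the finitely many eigenvalues involved;
    conversely a separable polynomial has distinct roots in L, so that the eigenvectors
    can be separated. *)
Lemma diagP (a b : A) : diag j a b <->
  exists2 g : {poly K}, separable_poly g & pact (ad a) g b = 0.
Proof.
have tE g : tens j 1 (pact (ad a) g b) = pact (ad (tens j 1 a)) (map_poly j g) (tens j 1 b).
  by apply: pact_morph; [exact: tens1D|exact: tens1Z|exact: tens1_ad].
split=> [[ls [v [_ vE bE]]]|[g sg gb]].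
  have [p [p0 pls]] := common_annihilator ls.
  exists (squarefree_part p); first exact: make_separable.
  apply: tens1_inj; rewrite tE bE.
  rewrite (pact_sum (tensor_ad_linear _)) big_seq big1// => l lls.
  rewrite (pact_eigen (tensor_ad_linear _) _ (vE l lls)).
  by have /eqP -> := squarefree_part_root charK p0 (pls l lls); rewrite scale0r.
have [rs gE] := closed_field_poly_normal (map_poly j g).
have urs : uniq rs.
  rewrite -separable_prod_XsubC; apply: dvdp_separable (_ : separable_poly (map_poly j g)).
    by rewrite gE dvdpZr ?dvdpp// lead_coef_eq0 map_poly_eq0 separable_poly_neq0.
  by rewrite separable_map.
have zrs : pact (ad (tens j 1 a)) (\prod_(r <- rs) ('X - r%:P)) (tens j 1 b) = 0.
  have := tE g; rewrite gb gE pactZ => /esym/eqP.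
  have -> : tens j 1 (0 : A) = 0.
    by rewrite -(scale0r 0) tens1Z rmorph0 scale0r.
  rewrite scaler_eq0 lead_coef_eq0 map_poly_eq0 (negbTE (separable_poly_neq0 sg)) /=.
  by move/eqP.
have [] := @eigen_decomposition _ _ _ (tensor_ad_linear (tens j 1 a)) (fun=> True) rs
  (tens j 1 b) => //.
  by left.
move=> v [vE bE]; exists (undup rs), v; split=> //; first exact: undup_uniq.
by move=> l _; exact: (vE l).2.
Qed.

(** If no nonzero polynomial in ad a killed b, the iterates of ad a on b would be
    linearly independent, too many for a finite-dimensional space. *)
Lemma locally_finiteP (a b : A) : locally_finite a b <->
  exists2 f : {poly K}, f != 0 & pact (ad a) f b = 0.
Proof.
split=> [[s sE]|[f f0 fb]].
  apply/not_exists2P => nf.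
  suff : (size s < size s)%N by rewrite ltnn.
  apply: (@indep_le_span _ _ (size s).+1 (size s) (fun i => iter i (ad a) b) (fun i => s`_i)).
    move=> c c0 i; pose f := \poly_(k < (size s).+1) c (inord k).
    have [|] := nf f; last first.
      rewrite (@pact_wide _ _ _ (size s).+1) ?size_poly// -[RHS]c0 => H; case: H.
      by apply: eq_bigr => k _; rewrite coef_poly ltn_ord inord_val.
    move/negP; rewrite negbK => /eqP /(congr1 (fun p : {poly K} => p`_i)).
    by rewrite coef_poly ltn_ord inord_val coef0.
  move=> i; have [|d dE] := sE (iter i (ad a) b); last by exists d.
  by exists 'X^i => //; rewrite -/(pact (ad a) _ _) pactXn//; exact: ad_linear.
pose s := [seq iter i (ad a) b | i <- iota 0 (size f)].
have sf : size s = size f by rewrite size_map size_iota.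
exists s => _ [p _ <-].
rewrite -/(pact (ad a) p b) (divp_eq p f) pactD (pactM (ad_linear a)) fb.
rewrite (pact0 (ad_linear a)) add0r (@pact_wide _ _ _ (size s)); last first.
  by rewrite sf ltnW// ltn_modp.
exists (fun i => (p %% f)`_i); apply: eq_bigr => i _.
have ilt : (i < size f)%N by rewrite -sf.
by rewrite (nth_map 0%N) ?size_iota// nth_iota.
Qed.
End Characterization.

(** * Skew Laurent series *)

(** A field with an action of the integers by automorphisms that are trivial on a field
    of constants. All powers of the shift are carried, since the product of Laurent
    series needs the negative ones too. The last field says that each nonzero power
    fixes the constants only: this is what makes centralizers commutative. *)
Record shift_field (L : fieldType) := ShiftField {
  coef_field :> fieldType;
  const : {rmorphism L -> coef_field};
  shift : int -> {rmorphism coef_field -> coef_field};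
  shift0 : forall f, shift 0 f = f;
  shiftD : forall i k f, shift (i + k) f = shift i (shift k f);
  shift_const : forall i l, shift i (const l) = const l;
  shift_fixed : forall i f, i != 0 -> shift i f = f -> exists l, f = const l }.

Definition irange (N : nat) : seq int := [seq i%:Z - N%:Z | i <- iota 0 N.*2.+1].

Lemma mem_irange N i : (i \in irange N) = (`|i|%N <= N)%N.
Proof.
apply/mapP/idP => [[k]|iN].
  by rewrite mem_iota => kN ->; lia.
exists (absz (i + N%:Z)%R); last by lia.
by rewrite mem_iota; lia.
Qed.

Lemma irange_uniq N : uniq (irange N).
Proof. by rewrite map_inj_uniq ?iota_uniq// => a b; lia. Qed.

Section IntSum.
Variable V : zmodType.
Implicit Types h : int -> V.

(** Each coefficient of a product is a finite sum over an interval that depends on the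
    factors. A sum over all of the integers can be reindexed by translation before such
    an interval is chosen. *)
Definition isum h : V := (\sum_(i \in [set: int]%classic) h i)%R.

Lemma isumE N h : (forall i, (N < `|i|)%N -> h i = 0) ->
  isum h = \sum_(i <- irange N) h i.
Proof.
move=> h0; rewrite /isum (bigfs _ (r := irange N) (P := xpredT)) ?irange_uniq//.
  by apply: eq_fsbigl; apply/funext => x; apply/propext; split.
by move=> i _; rewrite mem_irange -ltnNge => /h0.
Qed.

Lemma isum_shift k h : isum h = isum (fun i => h (i + k)).
Proof.
rewrite /isum (reindex_fsbigT (fun i => i + k))//.
by exists (fun i => i - k) => i; rewrite ?addrK ?subrK.
Qed.

Lemma isum1 k h : (forall i, i != k -> h i = 0) -> isum h = h k.
Proof.
move=> h0; rewrite (@isumE `|k|%N); last by move=> i ik; apply: h0; apply/eqP; lia.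
rewrite (bigD1_seq k) ?mem_irange ?irange_uniq//= big1 ?addr0// => i /h0 //.
Qed.
End IntSum.

Section Laurent.
Variables (L : fieldType) (F : shift_field L).

(** The series of the coef i X^i, with the coefficients on the left. *)
Record laurent := Laurent {
  coef : int -> F;
  coef_bounded : exists N : nat, forall i, i < - N%:Z -> coef i = 0 }.

HB.instance Definition _ := gen_eqMixin laurent.
HB.instance Definition _ := gen_choiceMixin laurent.

Implicit Types f g h : laurent.

Lemma laurentP f g : (forall i, coef f i = coef g i) -> f = g.
Proof.
case: f g => [f bf] [g bg] /= fg; have {}fg : f = g by apply/funext.
by case: _ / fg in bg *; congr Laurent; exact: Prop_irrelevance.
Qed.

Fact zero_bounded : exists N : nat, forall i, i < - N%:Z -> (fun=> 0 : F) i = 0.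
Proof. by exists 0. Qed.
Definition lzero := Laurent zero_bounded.

Fact add_bounded f g :
  exists N : nat, forall i, i < - N%:Z -> (fun i => coef f i + coef g i) i = 0.
Proof.
case: f g => [f [N fN]] [g [M gM]]; exists (N + M)%N => i iN /=.
by rewrite fN ?gM ?addr0//; lia.
Qed.
Definition ladd f g := Laurent (add_bounded f g).

Fact opp_bounded f :
  exists N : nat, forall i, i < - N%:Z -> (fun i => - coef f i) i = 0.
Proof. by case: f => [f [N fN]]; exists N => i iN /=; rewrite fN ?oppr0. Qed.
Definition lopp f := Laurent (opp_bounded f).

Fact laddA : associative ladd.
Proof. by move=> f g h; apply: laurentP => i /=; rewrite addrA. Qed.
Fact laddC : commutative ladd.
Proof. by move=> f g; apply: laurentP => i /=; rewrite addrC. Qed.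
Fact ladd0 : left_id lzero ladd.
Proof. by move=> f; apply: laurentP => i /=; rewrite add0r. Qed.
Fact laddN : left_inverse lzero lopp ladd.
Proof. by move=> f; apply: laurentP => i /=; rewrite addNr. Qed.
HB.instance Definition _ := GRing.isZmodule.Build laurent laddA laddC ladd0 laddN.

Lemma lcoefD f g i : coef (f + g) i = coef f i + coef g i. Proof. by []. Qed.
Lemma lcoefB f g i : coef (f - g) i = coef f i - coef g i. Proof. by []. Qed.

(** The term f_i X^i g_(n - i) X^(n - i) of a product. *)
Definition cterm f g (n i : int) : F := coef f i * shift F i (coef g (n - i)).

Lemma cterm_eq0 f g Nf Ng M (n : int) i :
  (forall i, i < - Nf%:Z -> coef f i = 0) ->
  (forall i, i < - Ng%:Z -> coef g i = 0) ->
  (`|n| + Nf + Ng <= M)%N -> (M < `|i|)%N -> cterm f g n i = 0.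
Proof.
move=> fN gN nM Mi; rewrite /cterm; have [iN|iN] := ltP i (- Nf%:Z).
  by rewrite fN ?mul0r.
by rewrite gN ?rmorph0 ?mulr0//; lia.
Qed.

Fact mul_bounded f g :
  exists N : nat, forall i, i < - N%:Z -> (fun n => isum (cterm f g n)) i = 0.
Proof.
case: f g => [f [N fN]] [g [M gM]]; exists (N + M)%N => n nN.
rewrite /= (@isum1 _ 0) /cterm /=.
  have [iN|iN] := ltP (0 : int) (- N%:Z); first by lia.
  by rewrite gM ?rmorph0 ?mulr0//; lia.
move=> i _; have [iN|iN] := ltP i (- N%:Z); first by rewrite fN ?mul0r.
by rewrite gM ?rmorph0 ?mulr0//; lia.
Qed.
Definition lmul f g := Laurent (mul_bounded f g).

Lemma lmulE f g Nf Ng M (n : int) :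
  (forall i, i < - Nf%:Z -> coef f i = 0) ->
  (forall i, i < - Ng%:Z -> coef g i = 0) -> (`|n| + Nf + Ng <= M)%N ->
  coef (lmul f g) n = \sum_(i <- irange M) cterm f g n i.
Proof. by move=> fN gN nM; apply: isumE => i; exact: (cterm_eq0 fN gN). Qed.

Fact lmulA : associative lmul.
Proof.
move=> f g h; apply: laurentP => n.
have [[[Nf fN] [Ng gN]] [Nh hN]] :=
  (coef_bounded f, coef_bounded g, coef_bounded h).
have ghN i : i < - (Ng + Nh)%N%:Z -> coef (lmul g h) i = 0.
  move=> iN; rewrite (lmulE gN hN (leqnn _)) big1// => k _; rewrite /cterm.
  have [?|?] := ltP k (- Ng%:Z); first by rewrite gN ?mul0r.
  by rewrite hN ?rmorph0 ?mulr0//; lia.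
have fgN i : i < - (Nf + Ng)%N%:Z -> coef (lmul f g) i = 0.
  move=> iN; rewrite (lmulE fN gN (leqnn _)) big1// => k _; rewrite /cterm.
  have [?|?] := ltP k (- Nf%:Z); first by rewrite fN ?mul0r.
  by rewrite gN ?rmorph0 ?mulr0//; lia.
pose M := (`|n| + Nf + Ng + Nh)%N; pose M' := (M + Nf + Ng)%N.
rewrite (lmulE fN ghN (M := M')); last by rewrite /M' /M; lia.
rewrite (lmulE fgN hN (M := M)); last by rewrite /M; lia.
rewrite [RHS]big_seq_cond.
under [RHS]eq_bigr => i /andP[].
  rewrite mem_irange => iM _; rewrite /cterm (lmulE fN gN (M := M')); last first.
    by rewrite /M'; lia.
  rewrite mulr_suml; over.
rewrite -big_seq_cond exchange_big /=; apply: eq_bigr => k _.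
rewrite /cterm; have [kN|kN] := ltP k (- Nf%:Z).
  by rewrite fN// mul0r big1// => i _; rewrite !mul0r.
(* The inner sum is moved by k, so that both sides become sums over triples of
   exponents. *)
rewrite /= (isum_shift (- k)) (@isumE _ M); last first.
  move=> i Mi; rewrite /cterm; have [iN|iN] := ltP (i - k) (- Ng%:Z).
    by rewrite gN ?mul0r.
  by rewrite hN ?rmorph0 ?mulr0//; rewrite /M in Mi; lia.
rewrite rmorph_sum mulr_sumr; apply: eq_bigr => i _.
rewrite /cterm rmorphM -shiftD -mulrA; congr (_ * (_ * _)).
by rewrite [k + _]addrC subrK; congr (shift _ _ (coef _ _)); ring.
Qed.

Fact one_bounded : exists N : nat, forall i, i < - N%:Z ->
  (fun i => if i == 0 then 1 : F else 0) i = 0.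
Proof. by exists 0%N => i; case: eqP => // -> /=. Qed.
Definition lone := Laurent one_bounded.

Fact lmul1l : left_id lone lmul.
Proof.
move=> f; apply: laurentP => n; rewrite /= (@isum1 _ 0) /cterm /=.
  by rewrite mul1r subr0 shift0.
by move=> i /negbTE /= ->; rewrite mul0r.
Qed.

Fact lmul1r : right_id lone lmul.
Proof.
move=> f; apply: laurentP => n; rewrite /= (@isum1 _ n) /cterm /=.
  by rewrite subrr eqxx rmorph1 mulr1.
move=> i ni; rewrite ifF ?rmorph0 ?mulr0//.
by apply/eqP => /eqP; rewrite subr_eq0 eq_sym (negbTE ni).
Qed.

Fact lmulDl : left_distributive lmul +%R.
Proof.
move=> f g h; apply: laurentP => n; rewrite lcoefD.
have [[[Nf fN] [Ng gN]] [Nh hN]] :=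
  (coef_bounded f, coef_bounded g, coef_bounded h).
pose M := (`|n| + Nf + Ng + Nh)%N.
rewrite (lmulE fN hN (M := M)); last by rewrite /M; lia.
rewrite (lmulE gN hN (M := M)); last by rewrite /M; lia.
rewrite (@lmulE _ _ (Nf + Ng) Nh M _ _ hN); last 2 first.
- by move=> i iN; rewrite lcoefD fN ?gN ?addr0//; lia.
- by rewrite /M; lia.
by rewrite -big_split; apply: eq_bigr => i _; rewrite /cterm lcoefD mulrDl.
Qed.

Fact lmulDr : right_distributive lmul +%R.
Proof.
move=> f g h; apply: laurentP => n; rewrite lcoefD.
have [[[Nf fN] [Ng gN]] [Nh hN]] :=
  (coef_bounded f, coef_bounded g, coef_bounded h).
pose M := (`|n| + Nf + Ng + Nh)%N.
rewrite (lmulE fN hN (M := M)); last by rewrite /M; lia.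
rewrite (lmulE fN gN (M := M)); last by rewrite /M; lia.
rewrite (@lmulE _ _ Nf (Ng + Nh) M _ fN); last 2 first.
- by move=> i iN; rewrite lcoefD gN ?hN ?addr0//; lia.
- by rewrite /M; lia.
rewrite -big_split; apply: eq_bigr => i _.
by rewrite /cterm lcoefD rmorphD mulrDr.
Qed.

Fact lone_neq0 : lone != 0.
Proof.
by apply/eqP => /(congr1 (fun f => coef f 0)) /= /eqP; rewrite oner_eq0.
Qed.

HB.instance Definition _ := GRing.Zmodule_isNzRing.Build laurent
  lmulA lmul1l lmul1r lmulDl lmulDr lone_neq0.

Lemma lcoef1 i : coef 1 i = if i == 0 then 1 else 0. Proof. by []. Qed.
Lemma lcoefM f g n : coef (f * g) n = isum (cterm f g n). Proof. by []. Qed.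

Fact scale_bounded (l : L) f :
  exists N : nat, forall i, i < - N%:Z -> (fun i => const F l * coef f i) i = 0.
Proof. by case: f => [f [N fN]]; exists N => i iN /=; rewrite fN ?mulr0. Qed.
Definition lscale l f := Laurent (scale_bounded l f).

Fact lscaleA l m f : lscale l (lscale m f) = lscale (l * m) f.
Proof. by apply: laurentP => i /=; rewrite rmorphM mulrA. Qed.
Fact lscale1 : left_id 1 lscale.
Proof. by move=> f; apply: laurentP => i /=; rewrite rmorph1 mul1r. Qed.
Fact lscaleDr : right_distributive lscale +%R.
Proof. by move=> l f g; apply: laurentP => i /=; rewrite mulrDr. Qed.
Fact lscaleDl f : {morph lscale^~ f : l m / l + m}.
Proof. by move=> l m; apply: laurentP => i /=; rewrite rmorphD mulrDl. Qed.
HB.instance Definition _ := GRing.Zmodule_isLmodule.Build L laurent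
  lscaleA lscale1 lscaleDr lscaleDl.

Lemma lcoefZ l f i : coef (l *: f) i = const F l * coef f i. Proof. by []. Qed.

Fact lscaleAl l f g : l *: (f * g) = (l *: f) * g.
Proof.
apply: laurentP => n; rewrite lcoefZ.
have [[Nf fN] [Ng gN]] := (coef_bounded f, coef_bounded g).
pose M := (`|n| + Nf + Ng)%N.
rewrite (lmulE fN gN (M := M)) ?leqnn//.
rewrite (@lmulE _ _ Nf Ng M _ _ gN) ?leqnn//; last first.
  by move=> i iN; rewrite lcoefZ fN ?mulr0.
by rewrite mulr_sumr; apply: eq_bigr => i _; rewrite /cterm lcoefZ mulrA.
Qed.

Fact lscaleAr l f g : l *: (f * g) = f * (l *: g).
Proof.
apply: laurentP => n; rewrite lcoefZ.
have [[Nf fN] [Ng gN]] := (coef_bounded f, coef_bounded g).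
pose M := (`|n| + Nf + Ng)%N.
rewrite (lmulE fN gN (M := M)) ?leqnn//.
rewrite (@lmulE _ _ Nf Ng M _ fN) ?leqnn//; last first.
  by move=> i iN; rewrite lcoefZ gN ?mulr0.
rewrite mulr_sumr; apply: eq_bigr => i _.
by rewrite /cterm lcoefZ rmorphM shift_const mulrCA.
Qed.

HB.instance Definition _ := GRing.Lmodule_isLalgebra.Build L laurent lscaleAl.
HB.instance Definition _ := GRing.Lalgebra_isAlgebra.Build L laurent lscaleAr.

End Laurent.

(** * Valuation, inverses and centralizers of Laurent series *)

(** Course-of-values recursion: iterating Phi on whole sequences, the value at k is
    final after k + 1 rounds. *)
Lemma strong_recursion (T : Type) (x0 : T) (Phi : nat -> (nat -> T) -> T) :
  (forall k u v, (forall i, (i < k)%N -> u i = v i) -> Phi k u = Phi k v) ->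
  exists h, forall k, h k = Phi k h.
Proof.
move=> PhiE; pose A n := iter n (fun u k => Phi k u) (fun=> x0).
have AE k n : (k < n)%N -> A n k = A k.+1 k.
  elim/ltn_ind: k n => k IH [|n]// kn; apply: PhiE => i ik.
  by rewrite [LHS]IH ?[RHS]IH//; lia.
by exists (fun k => A k.+1 k) => k; apply: PhiE => i ik; exact: AE.
Qed.

Section LaurentField.
Variables (L : fieldType) (F : shift_field L).
Implicit Types f g h : laurent F.

Definition val_ge f (n : int) : Prop := forall i, i < n -> coef f i = 0.
Definition has_val f (n : int) : Prop := val_ge f n /\ coef f n != 0.

Lemma has_val_exists f : f != 0 -> exists n, has_val f n.
Proof.
move=> f0; have [N fN] := coef_bounded f.
have ex : exists k : nat, coef f (k%:Z - N%:Z) != 0.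
  apply/not_existsP => fk; move/eqP: f0; apply; apply: laurentP => i.
  have [/fN//|iN] := ltP i (- N%:Z).
  have /negP := fk (absz (i + N%:Z)); rewrite negbK => /eqP.
  by rewrite gez0_abs ?addrK//; lia.
case: (ex_minnP ex) => k fk kmin; exists (k%:Z - N%:Z); split=> // i ik.
have [/fN//|iN] := ltP i (- N%:Z); apply/eqP/negP => /negP fi.
have := kmin (absz (i + N%:Z)); rewrite gez0_abs ?addrK; last by lia.
by move/(_ fi); lia.
Qed.

Lemma has_val_neq0 f n : has_val f n -> f != 0.
Proof. by move=> [_]; apply: contraNneq => ->. Qed.

Lemma val_geD f g n : val_ge f n -> val_ge g n -> val_ge (f + g) n.
Proof. by move=> fn gn i ni; rewrite lcoefD fn ?gn ?addr0. Qed.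

Lemma val_geZ l f n : val_ge f n -> val_ge (l *: f) n.
Proof. by move=> fn i ni; rewrite lcoefZ fn ?mulr0. Qed.

Lemma lcoefM_lead f g m n : val_ge f m -> val_ge g n ->
  coef (f * g) (m + n) = coef f m * shift F m (coef g n).
Proof.
move=> fm gn; rewrite lcoefM (@isum1 _ m) /cterm.
  by congr (_ * shift _ _ (coef _ _)); ring.
move=> i im; have [ltim|leim] := ltP i m; first by rewrite fm ?mul0r.
by rewrite gn ?rmorph0 ?mulr0//; lia.
Qed.

Lemma val_geM f g m n : val_ge f m -> val_ge g n -> val_ge (f * g) (m + n).
Proof.
move=> fm gn i ni; rewrite lcoefM (@isum1 _ m) /cterm.
  by rewrite gn ?rmorph0 ?mulr0//; lia.
move=> k _; have [ltim|leim] := ltP k m; first by rewrite fm ?mul0r.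
by rewrite gn ?rmorph0 ?mulr0//; lia.
Qed.

Lemma has_valM f g m n : has_val f m -> has_val g n -> has_val (f * g) (m + n).
Proof.
move=> [fm fm0] [gn gn0]; split; first exact: val_geM.
by rewrite lcoefM_lead// mulf_neq0// fmorph_eq0.
Qed.

Lemma has_val1 : has_val 1 0.
Proof.
split=> [i i0|]; last by rewrite lcoef1 eqxx oner_neq0.
by rewrite lcoef1 ifF//; apply/eqP; lia.
Qed.

Lemma has_val_inj f m n : has_val f m -> has_val f n -> m = n.
Proof.
move=> [fm fm0] [fn fn0]; have [mn|nm|//] := ltgtP m n.
  by rewrite fn ?eqxx in fm0.
by rewrite fm ?eqxx in fn0.
Qed.

(** If f has valuation N, the coefficients of an inverse start at -N. The coefficient of
    index n of the equation f g = 1 contains the unknown g_(n - N) only in f_N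
    sigma^N(g_(n - N)), and previous coefficients elsewhere; so it determines that
    unknown. Below, h k stands for g_(k - N). *)
Lemma laurent_rinv f : f != 0 -> exists g, f * g = 1.
Proof.
case/has_val_exists => N [fN fN0].
pose Phi k (h : nat -> F) := shift F (- N) ((coef f N)^-1 * ((k == 0%N)%:R -
  \sum_(i < k) coef f (N + i.+1%:Z) * shift F (N + i.+1%:Z) (h (k - i.+1)%N))).
have [|h hE] := @strong_recursion _ 0 Phi.
  move=> k u v uv; rewrite /Phi; congr (shift _ _ (_ * (_ - _))).
  by apply: eq_bigr => i _; rewrite uv//; have := ltn_ord i; lia.
pose g0 (i : int) := if i + N is Posz k then h k else 0.
have gb : exists M : nat, forall i, i < - M%:Z -> g0 i = 0.
  exists (absz N) => i iN; rewrite /g0.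
  by case E : (i + N) => [k|//]; lia.
exists (Laurent gb); apply: laurentP => n; rewrite lcoefM lcoef1.
have gneg i : i < - N -> g0 i = 0.
  by move=> iN; rewrite /g0; case E : (i + N) => [k|//]; lia.
have [n0|n0] := ltP n 0.
  rewrite ifF; last by apply/eqP; lia.
  by apply: (val_geM (f := f) (g := Laurent gb) fN gneg); lia.
case: n n0 => // n _.
pose H i := coef f (N + i%:Z) * shift F (N + i%:Z) (h (n - i)%N).
have HE : isum (cterm f (Laurent gb) n) = \sum_(0 <= i < n.+1) H i.
  rewrite (isum_shift N) (@isumE _ n.+1); last first.
    move=> i ni; rewrite /cterm; have [i0|i0] := ltP i 0.
      by rewrite fN ?mul0r//; lia.
    by rewrite [coef (Laurent gb) _]gneg ?rmorph0 ?mulr0//; lia.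
  rewrite (bigID (fun i : int => (0 <= i) && (i <= n%:Z))) /=.
  rewrite [X in _ + X]big1 ?addr0; last first.
    move=> i /negP ni; rewrite /cterm; have [i0|i0] := ltP i 0.
      by rewrite fN ?mul0r//; lia.
    by rewrite [coef (Laurent gb) _]gneg ?rmorph0 ?mulr0//; lia.
  rewrite -big_filter.
  rewrite (perm_big [seq i%:Z | i <- iota 0 n.+1]); last first.
    apply: uniq_perm; rewrite ?filter_uniq ?irange_uniq//.
      by rewrite map_inj_uniq ?iota_uniq// => a b [].
    move=> i; rewrite mem_filter mem_irange.
    apply/idP/mapP => [/andP[/andP[i0 ni] _]|[k]].
      by exists (absz i); rewrite ?mem_iota; lia.
    by rewrite mem_iota => kn ->; lia.
  rewrite big_map /index_iota subn0 big_seq_cond [RHS]big_seq_cond.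
  apply: eq_bigr => i; rewrite andbT mem_iota => ni.
  rewrite /cterm /H [i%:Z + N]addrC; congr (_ * shift _ _ _).
  rewrite /= /g0; have -> : n%:Z - (N + i%:Z) + N = (n - i)%N by lia.
  by [].
rewrite HE big_nat_recl// /H addr0 subn0 [h n]hE /Phi -shiftD subrr shift0.
rewrite mulVKf// big_mkord subrK.
by case: n {H HE}.
Qed.

(** A right inverse of a right inverse of f must be f, so right inverses are two-sided. *)
Lemma laurent_inv_exists f :
  exists g, if f == 0 then g = 0 else g * f = 1 /\ f * g = 1.
Proof.
case: eqVneq => [|f0]; first by exists 0.
have [g fg] := laurent_rinv f0; exists g.
have g0 : g != 0 by apply: contra_eqN fg => /eqP ->; rewrite mulr0 eq_sym oner_neq0.
have [h gh] := laurent_rinv g0; split=> //.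
suff -> : f = h by [].
by rewrite -[f]mulr1 -gh mulrA fg mul1r.
Qed.

Definition linv f := sval (cid (laurent_inv_exists f)).
Definition lunit : {pred laurent F} := fun f => f != 0.

Fact lmulVr : {in lunit, left_inverse 1 linv *%R}.
Proof.
by rewrite /linv => f; rewrite unfold_in; case: cid => g /=; case: eqP => // _ [].
Qed.
Fact lmulrV : {in lunit, right_inverse 1 linv *%R}.
Proof.
by rewrite /linv => f; rewrite unfold_in; case: cid => g /=; case: eqP => // _ [].
Qed.
Fact lunitP f g : g * f = 1 /\ f * g = 1 -> lunit f.
Proof.
move=> [gf _]; apply: contra_eqN gf => /eqP ->; rewrite mulr0 eq_sym.
exact: oner_neq0.
Qed.
Fact linv_out : {in [predC lunit], linv =1 id}.
Proof.
rewrite /linv => f; rewrite inE negbK => /eqP f0; case: cid => g /=.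
by rewrite f0 eqxx.
Qed.

HB.instance Definition _ := GRing.NzRing_hasMulInverse.Build (laurent F)
  lmulVr lmulrV lunitP linv_out.

Lemma laurent_unitE f : (f \is a GRing.unit) = (f != 0).
Proof. by []. Qed.

Lemma has_valV f n : has_val f n -> has_val f^-1 (- n).
Proof.
move=> fn; have f0 := has_val_neq0 fn.
have [m gm] : exists m, has_val f^-1 m.
  by apply: has_val_exists; rewrite -laurent_unitE unitrV.
suff <- : m = - n by [].
have := has_valM fn gm; rewrite divrr// => /has_val_inj /(_ has_val1).
by lia.
Qed.

Lemma has_valX f n (r : int) : has_val f n -> has_val (f ^ r) (r * n).
Proof.
move=> fn; have valXn k : has_val (f ^+ k) (k%:Z * n).
  elim: k => [|k IH]; first by rewrite mul0r; exact: has_val1.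
  by rewrite exprS intS mulrDl mul1r; exact: has_valM.
case: r => k; first exact: valXn.
by rewrite NegzE mulNr; exact: has_valV.
Qed.

Lemma lcoef_algE l i : coef (l%:A : laurent F) i = if i == 0 then const F l else 0.
Proof. by rewrite lcoefZ lcoef1; case: ifP; rewrite (mulr1, mulr0). Qed.

Section Centralizer.
Variable y : laurent F.

Lemma lead_comm f m n : GRing.comm f y -> val_ge f m -> val_ge y n ->
  coef f m * shift F m (coef y n) = coef y n * shift F n (coef f m).
Proof.
by move=> fy fm yn; rewrite -lcoefM_lead// fy addrC lcoefM_lead.
Qed.

(** Let f_m be the leading coefficient of an element that commutes with y. Then f_m
    sigma^m(y_n) = y_n sigma^n(f_m). The quotient of two solutions is fixed by sigma^n,
    so it is a constant. *)
Lemma cent_lead n f g m : n != 0 -> has_val y n -> GRing.comm f y ->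
  GRing.comm g y -> val_ge f m -> has_val g m ->
  exists l, val_ge (f - l *: g) (m + 1).
Proof.
move=> n0 [yn yn0] fy gy fm [gm gm0].
have [|l lE] := @shift_fixed _ F n (coef f m / coef g m) n0.
  have sm0 : shift F m (coef y n) != 0 by rewrite fmorph_eq0.
  rewrite fmorph_div.
  have -> : shift F n (coef f m) = coef f m * shift F m (coef y n) / coef y n.
    by rewrite (lead_comm fy fm yn) mulrC mulKf.
  have -> : shift F n (coef g m) = coef g m * shift F m (coef y n) / coef y n.
    by rewrite (lead_comm gy gm yn) mulrC mulKf.
  by field; rewrite gm0 sm0 yn0.
exists l => i im; rewrite lcoefB lcoefZ.
have [ltim|leim] := ltP i m; first by rewrite fm ?gm ?mulr0 ?subr0.
have -> : i = m by lia.
by rewrite -lE divfK// subrr.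
Qed.

(** All valuations in the centralizer of y are multiples of the least positive one, that
    of u. So any element of the centralizer has the same leading term as some l u^r with
    l constant, by [cent_lead]. Subtracting such terms from f and g, and because powers
    of u commute with each other, [f, g] = [f', g] + l [u^r, g'] where f' and g' have
    larger valuation. By induction on k, the commutator [f, g] has valuation at least al
    + be + k for all k. *)
Lemma centralizer_comm_val n : n != 0 -> has_val y n ->
  forall f g, GRing.comm f y -> GRing.comm g y -> GRing.comm f g.
Proof.
move=> n0 yn.
pose P (d : nat) := `[< (0 < d)%N /\ exists u, GRing.comm u y /\ has_val u d%:Z >].
have exP : exists d, P d.
  exists (absz n); apply/asboolP; split; first by lia.
  have [ltn0|gtn0] := ltP n 0.
    exists y^-1; split; first exact/commr_sym/commrV.
    by rewrite (_ : (absz n)%:Z = - n); [exact: has_valV|lia].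
  by exists y; split=> //; have -> : (absz n)%:Z = n by lia.
case: (ex_minnP exP) => d /asboolP[d0 [u [uy ud]]] dmin.
have dvd f m : GRing.comm f y -> has_val f m -> exists r : int, m = r * d%:Z.
  move=> fy fm; exists (m %/ d)%Z.
  apply/eqP; rewrite -subr_eq0; apply/eqP.
  have E : m - (m %/ d)%Z * d = (m %% d)%Z by rewrite {1}(divz_eq m d); ring.
  have ge0 : 0 <= (m %% d)%Z by apply: modz_ge0; apply/eqP; lia.
  have ltd : (m %% d)%Z < d by apply: ltz_pmod; lia.
  rewrite E; case Er : (m %% d)%Z ge0 ltd => [[|r]|r] // _ rd.
  suff /dmin : P r.+1 by move: rd; lia.
  apply/asboolP; split=> //; exists (f * u ^ (- (m %/ d)%Z)).
  split; last by rewrite -Er -E -mulNr; apply: has_valM => //; exact: has_valX.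
  by apply/commr_sym/commrM; [exact/commr_sym|exact/commrXz/commr_sym].
have key k : forall f g al be, GRing.comm f y -> GRing.comm g y ->
    val_ge f al -> val_ge g be -> val_ge (f * g - g * f) (al + be + k%:Z).
  elim: k => [|k IH] f g al be fy gy fal gbe.
    rewrite addr0 -scaleN1r; apply: val_geD; first exact: val_geM.
    by apply: val_geZ; rewrite addrC; exact: val_geM.
  have IHl f1 g1 : GRing.comm f1 y -> GRing.comm g1 y ->
      val_ge f1 (al + 1) -> val_ge g1 be ->
      val_ge (f1 * g1 - g1 * f1) (al + be + k.+1%:Z).
    move=> f1y g1y f1a g1b; have -> : al + be + k.+1%:Z = (al + 1) + be + k by lia.
    by apply: IH.
  have IHr f1 g1 : GRing.comm f1 y -> GRing.comm g1 y ->
      val_ge f1 al -> val_ge g1 (be + 1) ->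
      val_ge (f1 * g1 - g1 * f1) (al + be + k.+1%:Z).
    move=> f1y g1y f1a g1b; have -> : al + be + k.+1%:Z = al + (be + 1) + k by lia.
    by apply: IH.
  have split_lead h m : GRing.comm h y -> val_ge h m ->
      val_ge h (m + 1) \/ exists l (r : int), [/\ has_val (u ^ r) m,
        GRing.comm (u ^ r) y & val_ge (h - l *: u ^ r) (m + 1)].
    move=> hy hm; have [hm0|hm0] := eqVneq (coef h m) 0.
      left=> i im; have [ltim|leim] := ltP i m; first exact: hm.
      by have -> : i = m by lia.
    right; have [r mE] := dvd h m hy (conj hm hm0).
    have um : has_val (u ^ r) m by rewrite mE; exact: has_valX.
    have uy' : GRing.comm (u ^ r) y by apply/commr_sym/commrXz/commr_sym.
    by have [l hl] := cent_lead n0 yn hy uy' hm um; exists l, r.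
  have [f1|[l [r [ur ury f1]]]] := split_lead f al fy fal; first exact: IHl.
  have [g1|[l' [r' [ur' ury' g1]]]] := split_lead g be gy gbe; first exact: IHr.
  set f' := f - l *: u ^ r in f1; set g' := g - l' *: u ^ r' in g1.
  have f'y : GRing.comm f' y.
    apply/commr_sym/commrB; first exact/commr_sym.
    by rewrite /GRing.comm -scalerAr -scalerAl ury.
  have g'y : GRing.comm g' y.
    apply/commr_sym/commrB; first exact/commr_sym.
    by rewrite /GRing.comm -scalerAr -scalerAl ury'.
  have -> : f * g - g * f = (f' * g - g * f') + l *: (u ^ r * g' - g' * u ^ r).
    have E1 : f * g = f' * g + l *: (u ^ r * g' + u ^ r * (l' *: u ^ r')).
      by rewrite -mulrDr subrK scalerAl -mulrDl subrK.
    have uC : u ^ r * (l' *: u ^ r') = (l' *: u ^ r') * u ^ r.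
      by rewrite -scalerAr -scalerAl; congr (_ *: _); apply/commrXz/commr_sym/commrXz.
    have E2 : g * f = g * f' + l *: (g' * u ^ r + u ^ r * (l' *: u ^ r')).
      by rewrite uC -mulrDl subrK scalerAr -mulrDr subrK.
    rewrite E1 E2 opprD addrACA; congr (_ + _).
    by rewrite -scalerBr opprD addrACA subrr addr0.
  apply: val_geD; first exact: IHl.
  by apply: val_geZ; apply: IHr => //; case: ur.
move=> f g fy gy; apply/eqP; rewrite -subr_eq0; apply/negP => /negP.
move=> fg0; have [m [_]] := has_val_exists fg0.
have [Nf fN] := coef_bounded f; have [Ng gN] := coef_bounded g.
have := key (absz (m + Nf%:Z + Ng%:Z)).+1 f g _ _ fy gy fN gN.
by move=> ->; rewrite ?eqxx//; lia.
Qed.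
End Centralizer.

(** If y has valuation 0 and a constant leading coefficient, y minus that constant has
    nonzero valuation. If the leading coefficient is not constant, an element of
    valuation m <> 0 cannot commute with y, since sigma^m would fix that coefficient; so
    a nonzero commutator in the centralizer has valuation 0, while its coefficient of
    index 0 is a commutator in a field. *)
Theorem laurent_centralizer_comm y f g : (forall l, y != l%:A) ->
  GRing.comm f y -> GRing.comm g y -> GRing.comm f g.
Proof.
move=> y_nonscalar.
have y0 : y != 0 by have := y_nonscalar 0; rewrite scale0r.
have [n yn] := has_val_exists y0.
have [n0|n0] := eqVneq n 0; last exact: (centralizer_comm_val n0 yn).
subst n.
have [[l lE]|nl] := pselect (exists l, coef y 0 = const F l).
  have z0 : y - l%:A != 0 by rewrite subr_eq0.
  have [m zm] := has_val_exists z0.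
  have m0 : m != 0.
    apply/eqP => m0; case: zm => _; rewrite m0 lcoefB lcoef_algE eqxx lE subrr.
    by rewrite eqxx.
  have zC h : GRing.comm h y -> GRing.comm h (y - l%:A).
    by move=> hy; apply: commrB => //; exact/commr_sym/comm_alg.
  by move=> /zC fz /zC gz; exact: (centralizer_comm_val m0 zm).
move=> fy gy.
have val0 h m : GRing.comm h y -> has_val h m -> m = 0.
  move=> hy [hm hm0]; have := lead_comm hy hm yn.1.
  rewrite shift0 mulrC => /(mulIf hm0) E.
  have [//|m0] := eqVneq m 0; case: nl.
  by case: (shift_fixed m0 E) => l lE; exists l.
have ge0 h : GRing.comm h y -> val_ge h 0.
  move=> hy; have [->|h0] := eqVneq h 0; first by move=> i _.
  have [m hm] := has_val_exists h0.
  by rewrite -(val0 h m hy hm); case: hm.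
apply/eqP; rewrite -subr_eq0; apply/negP => /negP fg0.
have [m hm] := has_val_exists fg0.
have fgy : GRing.comm (f * g - g * f) y.
  by apply/commr_sym/commrB; apply: commrM; exact/commr_sym.
have hm0 := val0 _ _ fgy hm; move: hm => [_]; rewrite hm0 lcoefB.
have := lcoefM_lead (ge0 f fy) (ge0 g gy); have := lcoefM_lead (ge0 g gy) (ge0 f fy).
by rewrite !addr0 => -> ->; rewrite !shift0 mulrC subrr eqxx.
Qed.

End LaurentField.

(** * Extension of morphisms to rings of fractions *)

Section FractionLift.
Variables (A : nzRingType) (Q S : unitRingType).
Variables (phi : {rmorphism A -> Q}) (psi : {rmorphism A -> S}).
Hypothesis Qdiv : forall q : Q, q != 0 -> q \is a GRing.unit.
Hypothesis phi_inj : injective phi.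
Hypothesis psi_unit : forall a, a != 0 -> psi a \is a GRing.unit.
Hypothesis frac : forall q, exists a s, s != 0 /\ q = (phi s)^-1 * phi a.

Let frac_pair q : exists p : A * A, p.2 != 0 /\ q = (phi p.2)^-1 * phi p.1.
Proof. by have [a [s as_q]] := frac q; exists (a, s). Qed.
Let num q := (sval (cid (frac_pair q))).1.
Let den q := (sval (cid (frac_pair q))).2.
Let den_neq0 q : den q != 0.
Proof. by rewrite /den; case: cid => p []. Qed.
Let fracE q : q = (phi (den q))^-1 * phi (num q).
Proof. by rewrite /den /num; case: cid => p []. Qed.
Let phi_unit s : s != 0 -> phi s \is a GRing.unit.
Proof.
by move=> s0; apply/Qdiv/(contra_neq _ s0) => ps; apply: phi_inj; rewrite ps rmorph0.
Qed.

Definition frac_ext q : S := (psi (den q))^-1 * psi (num q).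

(** Right fractions in Q are left fractions: a t^-1 = u^-1 c. *)
Lemma left_ore (a t : A) : t != 0 -> exists c u, u != 0 /\ u * a = c * t.
Proof.
move=> t0; have [c [u [u0 uE]]] := frac (phi a * (phi t)^-1).
exists c, u; split=> //; apply: phi_inj; rewrite !rmorphM.
have := congr1 (fun x : Q => phi u * x * phi t) uE.
by rewrite !mulrA divrr ?phi_unit// mul1r divrK ?phi_unit// => ->.
Qed.

Lemma fractions_domain (a b : A) : a != 0 -> b != 0 -> a * b != 0.
Proof.
move=> a0; apply: contra_neq => ab0; apply: phi_inj.
by apply: (mulrI (phi_unit a0)); rewrite -rmorphM ab0 !rmorph0 mulr0.
Qed.

(** Two representations of a fraction become equal after expansion to a common
    denominator u s = c t, which exists by [left_ore]; so the extension does not depend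
    on the representation. *)
Lemma frac_extE (a s : A) : s != 0 ->
  frac_ext ((phi s)^-1 * phi a) = (psi s)^-1 * psi a.
Proof.
move=> s0; rewrite /frac_ext; set q := _ * phi a.
have := fracE q; move: (num q) (den q) (den_neq0 q) => b t t0; rewrite /q => qE.
have [c [u [u0 us]]] := left_ore s t0.
have c0 : c != 0.
  by apply/eqP => c0; have := fractions_domain u0 s0; rewrite us c0 mul0r eqxx.
have ua : u * a = c * b.
  apply: phi_inj; rewrite !rmorphM.
  rewrite -[phi a](mulVKr (phi_unit s0)) qE mulrA -rmorphM us rmorphM -mulrA.
  by rewrite mulVKr ?phi_unit.
have E1 : (psi s)^-1 * psi a = (psi (u * s))^-1 * psi (u * a).
  by rewrite !rmorphM invrM ?psi_unit// mulrA -[_ / _ * _]mulrA mulVr ?psi_unit// mulr1.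
rewrite E1 us ua.
by rewrite !rmorphM invrM ?psi_unit// mulrA -[_ / _ * _]mulrA mulVr ?psi_unit// mulr1.
Qed.

Lemma frac_ext_phi a : frac_ext (phi a) = psi a.
Proof.
have := @frac_extE a 1 (oner_neq0 _).
by rewrite !rmorph1 !invr1 !mul1r.
Qed.

Fact frac_ext_monoid : monoid_morphism frac_ext.
Proof.
split=> [|p q]; first by rewrite -(rmorph1 phi) frac_ext_phi rmorph1.
rewrite [p]fracE [q]fracE; move: (den_neq0 p) (den_neq0 q).
move: (num p) (den p) (num q) (den q) => a s b t s0 t0.
have [c [u [u0 ua]]] := left_ore a t0.
rewrite !frac_extE//.
have -> : (phi s)^-1 * phi a * ((phi t)^-1 * phi b) = (phi (u * s))^-1 * phi (c * b).
  have -> : phi a = (phi u)^-1 * phi c * phi t.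
    by rewrite -mulrA -rmorphM -ua rmorphM mulKr ?phi_unit.
  by rewrite !rmorphM invrM ?phi_unit// !mulrA mulrK ?phi_unit.
rewrite frac_extE ?fractions_domain//.
have -> : psi a = (psi u)^-1 * psi c * psi t.
  by rewrite -mulrA -rmorphM -ua rmorphM mulKr ?psi_unit.
by rewrite !rmorphM invrM ?psi_unit// !mulrA mulrK ?psi_unit.
Qed.

Fact frac_ext_zmod : zmod_morphism frac_ext.
Proof.
move=> p q; rewrite [p]fracE [q]fracE; move: (den_neq0 p) (den_neq0 q).
move: (num p) (den p) (num q) (den q) => a s b t s0 t0.
have [c [u [u0 us]]] := left_ore s t0.
have c0 : c != 0.
  by apply/eqP => c0; have := fractions_domain u0 s0; rewrite us c0 mul0r eqxx.
have E (T : unitRingType) (f : {rmorphism A -> T}) x y z :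
    f x \is a GRing.unit -> f y \is a GRing.unit ->
    (f y)^-1 * f z = (f (x * y))^-1 * f (x * z).
  by move=> fx fy; rewrite !rmorphM invrM// mulrA -[_ / _ * _]mulrA mulVr// mulr1.
rewrite !frac_extE//.
rewrite (E _ phi u s a) ?phi_unit// (E _ phi c t b) ?phi_unit// us.
rewrite -mulrBr -rmorphB frac_extE ?fractions_domain// rmorphB mulrBr.
by rewrite -us -(E _ psi u s a) ?psi_unit// us -(E _ psi c t b) ?psi_unit.
Qed.

HB.instance Definition _ := GRing.isZmodMorphism.Build Q S frac_ext frac_ext_zmod.
HB.instance Definition _ :=
  GRing.isMonoidMorphism.Build Q S frac_ext frac_ext_monoid.

Lemma frac_lift : exists Psi : {rmorphism Q -> S}, forall a, Psi (phi a) = psi a.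
Proof. by exists frac_ext; exact: frac_ext_phi. Qed.
End FractionLift.

(** * Rational functions with the shift of the variable *)

Lemma fraction_repr (R : idomainType) (x : {fraction R}) :
  exists a s : R, s != 0 /\ x = (tofrac s)^-1 * tofrac a.
Proof.
elim/quotW: x => x; exists (frac x).1, (frac x).2; rewrite denom_ratioP; split=> //.
apply: (mulIf (_ : tofrac (frac x).2 != 0)); first by rewrite tofrac_eq0 denom_ratioP.
rewrite mulrC [RHS]mulrC mulVKf ?tofrac_eq0 ?denom_ratioP// mulrC.
unlock FracField.tofrac; rewrite -[LHS]FracField.pi_mul; apply/eqmodP => /=.
rewrite FracField.equivfE /FracField.mulf !numden_Ratio ?mulr1 ?denom_ratioP ?oner_neq0//.
by rewrite mulrC.
Qed.

Lemma eventually_not_root (L : fieldType) (p : {poly L}) (x : nat -> L) :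
  injective x -> p != 0 -> exists N, forall k, (N <= k)%N -> ~~ root p (x k).
Proof.
move=> x_inj p0; apply/not_existsP => noN.
have many m : exists ks : seq nat, [/\ size ks = m, uniq ks & all (root p) (map x ks)].
  elim: m => [|m [ks [sks uks rks]]]; first by exists [::].
  have /existsNP[k /not_implyP[Nk /negP]] := noN (\sum_(i <- ks) i).+1.
  rewrite negbK => rk; exists (k :: ks); rewrite /= sks uks rks rk andbT; split=> //.
  apply/negP => kks; have := Nk; rewrite (bigD1_seq k)//=; lia.
have [ks [sks uks rks]] := many (size p).
have := max_poly_roots p0 rks; rewrite map_inj_uniq// => /(_ uks).
by rewrite size_map sks ltnn.
Qed.

Section RationalShift.
Variables (L : fieldType) (charL : [pchar L] =i pred0).

Definition poly_shift (i : int) : {poly L} -> {poly L} :=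
  fun p => p \Po ('X - (i%:~R)%:P).

Lemma poly_shift_inj i : injective (poly_shift i).
Proof.
apply: can_inj (poly_shift (- i)) _ => p; rewrite /poly_shift -comp_polyA.
by rewrite comp_polyB comp_polyX comp_polyC mulrNz polyCN opprK addrK comp_polyXr.
Qed.

HB.instance Definition _ i := GRing.RMorphism.copy (poly_shift i)
  (fun p => p \Po ('X - (i%:~R)%:P)).

Lemma tofrac_unit (p : {poly L}) : p != 0 -> (tofrac p) \is a GRing.unit.
Proof. by rewrite unitfE tofrac_eq0. Qed.

Lemma tofrac_inj : injective (@tofrac {poly L}).
Proof. by move=> p q /eqP; rewrite tofrac_eq => /eqP. Qed.

Fact frac_shift_exists i : exists s : {rmorphism {fraction {poly L}} -> {fraction {poly L}}},
  forall p, s (tofrac p) = tofrac (poly_shift i p).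
Proof.
apply: (@frac_lift _ _ _ (@tofrac {poly L}) (@tofrac {poly L} \o poly_shift i)).
- by move=> q; rewrite unitfE.
- exact: tofrac_inj.
- move=> p p0; apply: tofrac_unit; apply: contra_neq p0 => p0.
  by apply: (@poly_shift_inj i); rewrite p0 rmorph0.
- exact: fraction_repr.
Qed.

Definition frac_shift i := sval (cid (frac_shift_exists i)).

Lemma frac_shiftE i p : frac_shift i (tofrac p) = tofrac (poly_shift i p).
Proof. by rewrite /frac_shift; case: cid. Qed.

Lemma frac_morph_ext (s t : {rmorphism {fraction {poly L}} -> {fraction {poly L}}}) :
  (forall p, s (tofrac p) = t (tofrac p)) -> s =1 t.
Proof.
move=> st x; have [a [d [d0 ->]]] := fraction_repr x.
by rewrite !rmorphM !fmorphV !st.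
Qed.

Fact frac_shift0 x : frac_shift 0 x = x.
Proof.
apply: (@frac_morph_ext (frac_shift 0) idfun) => p; rewrite frac_shiftE.
by rewrite /poly_shift subr0 comp_polyXr.
Qed.

Fact frac_shiftD i k x : frac_shift (i + k) x = frac_shift i (frac_shift k x).
Proof.
apply: (@frac_morph_ext _ (frac_shift i \o frac_shift k)) => p.
rewrite /= !frac_shiftE /poly_shift -comp_polyA comp_polyB comp_polyX comp_polyC.
by rewrite rmorphD polyCD opprD addrA.
Qed.

Fact frac_shift_const i (l : L) :
  frac_shift i ((@tofrac {poly L} \o polyC) l) = (@tofrac {poly L} \o polyC) l.
Proof. by rewrite /= frac_shiftE /poly_shift comp_polyC. Qed.

Lemma natr_charL n : (n%:R == 0 :> L) = (n == 0%N).
Proof. exact: (pcharf0P L).1 charL n. Qed.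

Lemma natr_inj : injective (fun n => n%:R : L).
Proof.
move=> a b /= ab; wlog le_ab : a b ab / (a <= b)%N => [H|].
  by have [le_ab|/ltnW le_ba] := leqP a b; [exact: H|exact/esym/H].
apply/eqP; rewrite eqn_leq le_ab -subn_eq0 -natr_charL natrB// ab subrr.
exact: eqxx.
Qed.

Lemma intr_charL (i : int) : (i%:~R == 0 :> L) = (i == 0).
Proof. by case: i => n; rewrite ?NegzE ?mulrNz ?oppr_eq0 -pmulrn natr_charL. Qed.

(** Let the fraction n / d be invariant under the shift by i. At the points x_k = - i k,
    this says that n / d takes the same value at x_k and x_(k + 1), if d does not vanish
    there. So n / d is eventually equal to some constant c along this sequence, and n -
    c d has infinitely many roots. *)
Fact frac_shift_fixed i x : i != 0 -> frac_shift i x = x ->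
  exists l : L, x = (@tofrac {poly L} \o polyC) l.
Proof.
move=> i0; have [n [d [d0 ->]]] := fraction_repr x; clear x.
rewrite rmorphM fmorphV !frac_shiftE => E.
have {E} nd : poly_shift i n * d = n * poly_shift i d.
  have sd0 : poly_shift i d != 0.
    by apply: contra_neq d0 => sd0; apply: (@poly_shift_inj i); rewrite sd0 rmorph0.
  apply: tofrac_inj; rewrite !rmorphM /=.
  have := congr1 (fun z => z * tofrac (poly_shift i d) * tofrac d) E.
  rewrite ![(tofrac _)^-1 * _]mulrC divfK ?tofrac_eq0// => ->.
  by rewrite mulrAC divfK ?tofrac_eq0.
pose x k : L := - (i%:~R * k%:R).
have x_inj : injective x.
  by move=> a b /oppr_inj /mulfI; rewrite intr_charL => /(_ i0) /natr_inj.
have sE p k : (poly_shift i p).[x k] = p.[x k.+1].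
  by rewrite horner_comp !hornerE /x mulrSr mulrDr mulr1 opprD.
have [N dN] := eventually_not_root x_inj d0.
exists (n.[x N] / d.[x N]); rewrite /= mulrC.
apply: (mulIf (_ : tofrac d != 0)); first by rewrite tofrac_eq0.
rewrite divfK ?tofrac_eq0// -rmorphM; congr (tofrac _); apply/eqP.
rewrite -subr_eq0; apply/negP => /negP nd0.
have [M ndM] := eventually_not_root x_inj nd0.
have := ndM (N + M)%N (leq_addl _ _); rewrite /root !hornerE.
suff -> : n.[x (N + M)%N] = n.[x N] / d.[x N] * d.[x (N + M)%N].
  by rewrite subrr eqxx.
elim: (M) => [|m IH]; first by rewrite addn0 divfK//; exact: (dN N).
have := congr1 (fun p => p.[x (N + m)%N]) nd; rewrite !hornerM !sE -addnS IH => E.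
have dm : d.[x (N + m)%N] != 0 by apply: dN; exact: leq_addr.
by apply: (mulIf dm); rewrite E mulrAC.
Qed.

Definition rational_shift : shift_field L :=
  ShiftField frac_shift0 frac_shiftD frac_shift_const frac_shift_fixed.

Lemma shift_tofrac i p : shift rational_shift i (tofrac p) = tofrac (poly_shift i p).
Proof. exact: frac_shiftE. Qed.
End RationalShift.

(** * Normal forms and morphisms from presented algebras *)

Section PairNormalForm.
Variables (K : fieldType) (A : algType K) (u v : A).
Implicit Types (p : {poly K}) (P Q : {poly {poly K}}).

(** The sum of the p_k(u) v^k. Taking the p_k as the coefficients of a polynomial over
    K[u] lets the arithmetic of bivariate polynomials act on ordered expressions in two
    elements that need not commute. *)
Definition pair_form (P : {poly {poly K}}) : A := (map_poly (horner_alg u) P).[v].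

Lemma horner_alg_comm p : horner_alg u p * u = u * horner_alg u p.
Proof. by have := congr1 (horner_alg u) (mulrC p 'X); rewrite !rmorphM /= horner_algX. Qed.

Fact pair_form_zmod : zmod_morphism pair_form.
Proof. by move=> P Q; rewrite /pair_form rmorphB hornerD hornerN. Qed.
HB.instance Definition _ :=
  GRing.isZmodMorphism.Build {poly {poly K}} A pair_form pair_form_zmod.

Lemma pair_formMX P : pair_form (P * 'X) = pair_form P * v.
Proof. by rewrite /pair_form rmorphM /= map_polyX hornerMX. Qed.

Lemma pair_formC p : pair_form p%:P = horner_alg u p.
Proof. by rewrite /pair_form map_polyC hornerC. Qed.

Lemma pair_formCM p P : pair_form (p%:P * P) = horner_alg u p * pair_form P.
Proof. by rewrite /pair_form rmorphM /= map_polyC hornerCM. Qed.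

Lemma pair_formE n P : (size P <= n)%N ->
  pair_form P = \sum_(k < n) horner_alg u P`_k * v ^+ k.
Proof.
move=> sP; rewrite /pair_form (@horner_coef_wide _ n); last first.
  exact: leq_trans (size_poly _ _) sP.
by apply: eq_bigr => k _; rewrite coef_map.
Qed.

Lemma horner_algE n p : (size p <= n)%N -> horner_alg u p = \sum_(i < n) p`_i *: u ^+ i.
Proof.
move=> sp; rewrite /horner_alg /horner_morph (@horner_coef_wide _ n); last first.
  exact: leq_trans (size_poly _ _) sp.
by apply: eq_bigr => k _; rewrite coef_map /= mulr_algl.
Qed.

End PairNormalForm.

Section PresentedMorphism.
Variables (K : fieldType) (G : Type) (E : ncexpr K G -> ncexpr K G -> Prop).
Variables (S : pzRingType) (c : {rmorphism K -> S}) (g : G -> S).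
Hypothesis c_central : forall k x, c k * x = x * c k.

(** Constants are sent to S by a ring morphism c rather than by a K-algebra structure,
    because S can be an algebra over an extension of K. *)
Fixpoint nc_eval (t : ncexpr K G) : S :=
  match t with
  | Gen h => g h
  | Cst k => c k
  | Add s u => nc_eval s + nc_eval u
  | Mul s u => nc_eval s * nc_eval u
  end.

Hypothesis g_rel : forall s t, E s t -> nc_eval s = nc_eval t.

Lemma nc_eval_eq s t : pres_eq E s t -> nc_eval s = nc_eval t.
Proof.
elim=> {s t} //=.
- by move=> s t u _ -> _ ->.
- by move=> s s' t t' _ -> _ ->.
- by move=> s s' t t' _ -> _ ->.
- by move=> *; rewrite addrA.
- by move=> *; rewrite addrC.
- by move=> t; rewrite rmorph0 add0r.
- by move=> *; rewrite mulrA.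
- by move=> *; rewrite mulrDl.
- by move=> *; rewrite mulrDr.
- by move=> t; rewrite rmorph1 mul1r.
- by move=> t; rewrite rmorph0 mul0r.
- by move=> a b; rewrite rmorphD.
- by move=> a b; rewrite rmorphM.
Qed.

Definition pres_eval (x : presented E) : S := nc_eval (pres_repr x).

Lemma pres_evalE t : pres_eval (pres_class E t) = nc_eval t.
Proof. by apply: nc_eval_eq; exact: pres_classK. Qed.

Fact pres_eval_zmod : zmod_morphism pres_eval.
Proof.
elim/pres_ind=> s; elim/pres_ind=> t.
rewrite -scaleN1r pres_classZ pres_classD !pres_evalE /= rmorphN1 mulN1r.
by [].
Qed.

Fact pres_eval_monoid : monoid_morphism pres_eval.
Proof.
split; first by rewrite [pres_eval 1]pres_evalE /= rmorph1.
by elim/pres_ind=> s; elim/pres_ind=> t; rewrite pres_classM !pres_evalE.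
Qed.
End PresentedMorphism.

Section Monomials.
Variables (L : fieldType) (F : shift_field L).

Fact monomial_bounded (m : int) (f : F) :
  exists N : nat, forall i, i < - N%:Z -> (fun i => if i == m then f else 0) i = 0.
Proof. by exists (absz m) => i im; rewrite ifF//; apply/eqP; lia. Qed.
Definition monomial m f : laurent F := Laurent (monomial_bounded m f).

Lemma coef_monomial m f i : coef (monomial m f) i = if i == m then f else 0.
Proof. by []. Qed.

Lemma monomialM m n f g :
  monomial m f * monomial n g = monomial (m + n) (f * shift F m g).
Proof.
apply: laurentP => i; rewrite lcoefM (@isum1 _ m); first rewrite /cterm !coef_monomial.
  rewrite eqxx subr_eq addrC; case: eqP => // _.
  by rewrite rmorph0 mulr0.
by move=> k /negbTE km; rewrite /cterm /= km mul0r.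
Qed.

Lemma monomial1 : monomial 0 1 = 1. Proof. by apply: laurentP. Qed.

Lemma monomialB m f g : monomial m f - monomial m g = monomial m (f - g).
Proof.
apply: laurentP => i; rewrite lcoefB !coef_monomial.
by case: eqP => // _; rewrite subr0.
Qed.

End Monomials.

Lemma pres_class_alg (K : fieldType) (G : Type) (E : ncexpr K G -> ncexpr K G -> Prop) k :
  pres_class E (Cst k) = k *: (1 : presented E).
Proof.
rewrite [RHS]pres_classZ; apply/pres_classP.
exact: pe_trans (pe_sym (pe_mul1 _ _)) (pe_cstC _ _ _).
Qed.

(** * Normal forms in the first Weyl algebra *)

Section WeylNormalForm.
Variable K : fieldType.
Notation W := (weyl K).
Definition wx : W := pres_class _ (Gen Wx).
Definition wd : W := pres_class _ (Gen Wd).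

Lemma weyl_dx : wd * wx = wx * wd + 1.
Proof.
have := (pres_classP _ _ _).2 (pe_rel (weyl_comm K)).
rewrite -pres_classD -pres_classZ -!pres_classM scaleN1r => E.
by apply/eqP; rewrite addrC -subr_eq; apply/eqP.
Qed.

Local Notation wpoly := (horner_alg wx).
Local Notation normal_form := (pair_form wx wd).

Lemma weyl_d_poly p : wd * wpoly p = wpoly p * wd + wpoly p^`().
Proof.
elim/poly_ind: p => [|p k IH]; first by rewrite deriv0 !rmorph0 mulr0 mul0r addr0.
rewrite derivD derivM derivX derivC addr0 mulr1 !rmorphD /= !rmorphM /=.
have -> : wpoly 'X = wx by exact: horner_algX.
have -> : wpoly k%:P = k%:A by exact: horner_algC.
rewrite mulrDr mulrA IH !mulrDl -!mulrA weyl_dx mulrDr mulr1 mulrA.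
by rewrite -!(scalerAl, scalerAr) mulr1 mul1r -!addrA; congr (_ + _); rewrite addrC -addrA addrCA.
Qed.

(** Moving d to the right past the polynomials in x differentiates them, so left
    multiplication by d acts on the normal form as multiplication by the outer variable
    plus derivation of the coefficients. *)
Lemma weyl_d_normal_form P :
  wd * normal_form P = normal_form (P * 'X + map_poly (@deriv K) P).
Proof.
elim/poly_ind: P => [|P c IH].
  by rewrite mul0r map_poly0 addr0 !raddf0 mulr0.
have -> : map_poly (@deriv K) (P * 'X + c%:P) =
    map_poly (@deriv K) P * 'X + (c^`())%:P.
  apply/polyP => i; rewrite !(coefD, coefMX, coefC, coef_map) /=.
  by case: i => [|i] /=; rewrite ?add0r ?addr0.
have -> : (P * 'X + c%:P) * 'X + (map_poly (@deriv K) P * 'X + (c^`())%:P) =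
    (P * 'X + map_poly (@deriv K) P) * 'X + c%:P * 'X + (c^`())%:P.
  by ring.
rewrite ![in RHS]raddfD /= [in LHS]raddfD /= !pair_formMX !pair_formC.
by rewrite mulrDr mulrA IH weyl_d_poly addrA raddfD /= pair_formMX.
Qed.

Lemma normal_form_left_ideal (a : W) P : exists P', a * normal_form P = normal_form P'.
Proof.
elim/pres_ind: a P; elim=> [[]|k|s IHs t IHt|s IHs t IHt] P.
- by exists ('X%:P * P); rewrite pair_formCM; congr (_ * _); rewrite horner_algX.
- by exists (P * 'X + map_poly (@deriv K) P); rewrite -weyl_d_normal_form.
- exists (k%:P%:P * P); rewrite pair_formCM; congr (_ * _).
  rewrite horner_algC [RHS]pres_classZ; apply/pres_classP.
  by apply: pe_trans (pe_sym (pe_mul1 _ _)) (pe_cstC _ _ _).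
- have [[P1 E1] [P2 E2]] := (IHs P, IHt P); exists (P1 + P2).
  by rewrite -pres_classD mulrDl E1 E2 raddfD.
- have [P1 E1] := IHt P; have [P2 E2] := IHs P1; exists P2.
  by rewrite -pres_classM -mulrA E1 E2.
Qed.

(** The normal forms contain 1 and are stable under left multiplication by the
    generators. *)
Lemma normal_form_surj (a : W) : exists P, a = normal_form P.
Proof.
have [P E] := normal_form_left_ideal a 1; exists P; rewrite -E.
by rewrite -[1]/(1%:P) pair_formC rmorph1 mulr1.
Qed.

(** The inner derivation by x is the formal derivation with respect to d. It lowers the
    degree in d, whence its role in the proof that normal forms are unique. *)
Lemma normal_form_comm P :
  normal_form P * wx - wx * normal_form P = normal_form P^`().
Proof.
elim/poly_ind: P => [|P c IH]; first by rewrite deriv0 !raddf0 mul0r mulr0 subrr.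
have xc : wpoly c * wx = wx * wpoly c.
  exact: horner_alg_comm.
rewrite derivD derivM derivX derivC addr0 mulr1 !raddfD /= !pair_formMX.
rewrite pair_formC -IH mulrDl mulrDr xc opprD addrACA subrr addr0.
by rewrite -mulrA weyl_dx mulrDr mulr1 mulrBl !mulrA addrAC.
Qed.
End WeylNormalForm.

(** * The Weyl division ring inside the Laurent series *)

Section WeylToLaurent.
Variables (K L : fieldType) (charK : [pchar K] =i pred0).
Variable (j : {rmorphism K -> L}).

Lemma pchar_extension : [pchar L] =i pred0.
Proof. by move=> p; rewrite (fmorph_pchar j). Qed.

Notation F := (rational_shift pchar_extension).
Notation S := (laurent F).

Local Notation wpoly := (horner_alg (wx K)).
Local Notation normal_form := (pair_form (wx K) (wd K)).

Definition coord : F := tofrac ('X : {poly L}).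

Definition laurent_cst : {rmorphism K -> S} := (in_alg S) \o j.

(** With X t = (t - 1) X, this is d = X^-1 t, so that x d = t and d x = t + 1. *)
Definition laurent_gen (g : weyl_gen) : S :=
  match g with Wx => monomial 1 1 | Wd => monomial (-1) (coord + 1) end.

Fact laurent_cst_central k x : laurent_cst k * x = x * laurent_cst k.
Proof. by rewrite /laurent_cst /= mulr_algl mulr_algr. Qed.

Fact laurent_weyl_rel s t : weyl_rel s t ->
  nc_eval laurent_cst laurent_gen s = nc_eval laurent_cst laurent_gen t.
Proof.
case; rewrite -[LHS]/(laurent_gen Wd * laurent_gen Wx +
  laurent_cst (-1) * (laurent_gen Wx * laurent_gen Wd)) -[RHS]/(laurent_cst 1).
rewrite rmorphN1 mulN1r rmorph1 /laurent_gen !monomialM addNr subrr monomialB.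
rewrite !rmorph1 mulr1 mul1r rmorphD rmorph1 shift_tofrac /poly_shift comp_polyX.
rewrite rmorphB /= rmorph1 subrK [coord + 1]addrC addrK.
exact: monomial1.
Qed.

Definition weyl_laurent : weyl K -> S := pres_eval laurent_cst laurent_gen.
HB.instance Definition _ := GRing.isZmodMorphism.Build (weyl K) S weyl_laurent
  (pres_eval_zmod laurent_cst_central laurent_weyl_rel).
HB.instance Definition _ := GRing.isMonoidMorphism.Build (weyl K) S weyl_laurent
  (pres_eval_monoid laurent_cst_central laurent_weyl_rel).

Lemma weyl_laurentE t : weyl_laurent (pres_class _ t) = nc_eval laurent_cst laurent_gen t.
Proof. exact: (pres_evalE laurent_cst_central laurent_weyl_rel). Qed.

Lemma weyl_laurentZ k a : weyl_laurent (k *: a) = j k *: weyl_laurent a.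
Proof.
elim/pres_ind: a => t; rewrite [k *: _]pres_classZ !weyl_laurentE /=.
by rewrite mulr_algl.
Qed.

Lemma weyl_laurent_x : weyl_laurent (wx K) = monomial 1 1.
Proof. exact: weyl_laurentE. Qed.

Lemma monomialX n : monomial 1 1 ^+ n = monomial n%:Z 1 :> S.
Proof.
elim: n => [|n IH]; first by rewrite expr0 monomial1.
by rewrite exprS IH monomialM rmorph1 mulr1 -intS.
Qed.

Lemma weyl_laurent_xn n : weyl_laurent (wx K ^+ n) = monomial n%:Z 1.
Proof. by rewrite rmorphXn /= weyl_laurent_x monomialX. Qed.

Lemma coef_sum (I : Type) (r : seq I) (f : I -> S) n :
  coef (\sum_(i <- r) f i) n = \sum_(i <- r) coef (f i) n.
Proof. by elim/big_rec2: _ => // i x y _ <-. Qed.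

Lemma weyl_laurent_poly (p : {poly K}) (i : int) :
  coef (weyl_laurent (wpoly p)) i = if i is Posz k then const F (j p`_k) else 0.
Proof.
rewrite -{1}[p]coefK poly_def linear_sum rmorph_sum coef_sum.
under eq_bigr => k _.
  rewrite linearZ /= rmorphXn /= horner_algX mulr_algl weyl_laurentZ lcoefZ.
  rewrite weyl_laurent_xn coef_monomial.
  over.
case: i => i; last by rewrite big1// => k _; rewrite mulr0.
have [ip|pi] := ltnP i (size p); last first.
  rewrite nth_default// rmorph0 big1 ?rmorph0// => k _; rewrite ifF ?mulr0//.
  by apply/eqP => -[ik]; have := ltn_ord k; rewrite -ik ltnNge pi.
rewrite (bigD1 (Ordinal ip))//= eqxx mulr1 big1 ?addr0// => k ki.
by rewrite ifF ?mulr0//; apply/eqP => -[ik]; case/eqP: ki; apply: val_inj.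
Qed.

(** Both sides are bracketed N times with x, which isolates the coefficient of d^N, a
    polynomial in x whose coefficients can be read off the series; then the terms of
    degree N are removed. The case l = 0 is injectivity. The general case shows that a
    scalar of L which is a quotient of images of elements of the Weyl algebra is in K. *)
Lemma weyl_laurent_prop (l : L) P R :
  weyl_laurent (normal_form P) = l *: weyl_laurent (normal_form R) ->
  forall n i, j (P`_n)`_i = l * j (R`_n)`_i.
Proof.
move: {2}(maxn (size P) (size R)) (leqnn (maxn (size P) (size R))) => N.
rewrite geq_max => /andP[].
elim: N P R => [|N IH] P R.
  by rewrite !leqn0 !size_poly_eq0 => /eqP -> /eqP -> _ n i; rewrite !(coef0, rmorph0) mulr0.
move=> sP sR E.
have derE n : weyl_laurent (normal_form P^`(n)) = l *: weyl_laurent (normal_form R^`(n)).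
  elim: n => [//|n IHn]; rewrite !derivnS -!normal_form_comm !rmorphB !rmorphM /= IHn.
  by rewrite scalerBr scalerAl scalerAr.
(* The N-th derivative of a polynomial of degree at most N is its top coefficient times
   N!. *)
have top (U : {poly {poly K}}) : (size U <= N.+1)%N -> U^`(N) = (U`_N *+ N`!)%:P.
  move=> sU; apply/polyP => i; rewrite coef_derivn coefC.
  case: i => [|i]; first by rewrite addn0 ffactnn.
  by rewrite nth_default ?mul0rn// (leq_trans sU)// addnS ltnS leq_addr.
have lead i : j (P`_N)`_i = l * j (R`_N)`_i.
  have := derE N; rewrite !top// !pair_formC => /(congr1 (fun f => coef f i%:Z)).
  rewrite lcoefZ !weyl_laurent_poly -rmorphM => /fmorph_inj.
  rewrite !coefMn !rmorphMn /= mulrnAr => fE.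
  have N0 : N`!%:R != 0 :> L by rewrite (natr_charL pchar_extension) -lt0n fact_gt0.
  by apply: (mulIf N0); rewrite !mulr_natr.
have trunc (U : {poly {poly K}}) : (size U <= N.+1)%N -> (size (U - U`_N *: 'X^N)%R <= N)%N.
  move=> sU; apply/leq_sizeP => k Nk; rewrite coefB coefZ coefXn.
  case: eqVneq => [->|kN]; first by rewrite mulr1 subrr.
  by rewrite mulr0 subr0 nth_default// (leq_trans sU)// ltn_neqAle eq_sym kN.
have EN : weyl_laurent (normal_form (P`_N *: 'X^N)) =
    l *: weyl_laurent (normal_form (R`_N *: 'X^N)).
  rewrite -!mul_polyC !pair_formCM !rmorphM scalerAl; congr (_ * _).
  apply: laurentP => i; rewrite lcoefZ !weyl_laurent_poly.
  by case: i => i; rewrite ?mulr0// lead rmorphM.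
have nfB U V : weyl_laurent (normal_form (U - V)) =
    weyl_laurent (normal_form U) - weyl_laurent (normal_form V).
  by rewrite raddfB rmorphB.
have := IH _ _ (trunc _ sP) (trunc _ sR); rewrite !nfB E EN scalerBr.
move=> /(_ erefl) IHn n i.
have := IHn n i; rewrite !coefB !coefZ !coefXn.
case: eqVneq => [->|nN]; first by move=> _; exact: lead.
by rewrite !mulr0 !coef0 !subr0.
Qed.

Lemma weyl_laurent_eq0 (a : weyl K) : weyl_laurent a = 0 -> a = 0.
Proof.
have [P ->] := normal_form_surj a => P0.
suff -> : P = 0 by rewrite raddf0.
apply/polyP => n; apply/polyP => i; apply: (fmorph_inj j).
have := @weyl_laurent_prop 0 P 0; rewrite scale0r => /(_ P0) ->.
by rewrite mul0r !(coef0, rmorph0).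
Qed.

Lemma weyl_laurent_ratio (l : L) a s : s != 0 ->
  weyl_laurent a = l *: weyl_laurent s -> exists k, l = j k.
Proof.
have [P ->] := normal_form_surj a; have [R ->] := normal_form_surj s.
move=> R0 /weyl_laurent_prop E.
have [n [i]] : exists n i, (R`_n)`_i != 0.
  apply/not_existsP => H; case/eqP: R0; suff -> : R = 0 by rewrite raddf0.
  apply/polyP => n; apply/polyP => i; rewrite !coef0; apply/eqP/negP => /negP Rni.
  by case: (H n); exists i.
move=> Rni; exists ((P`_n)`_i / (R`_n)`_i).
by rewrite fmorph_div E mulfK// fmorph_eq0.
Qed.

(** What the Laurent series provide: a division algebra over L with commutative
    centralizers, containing Q in such a way that Q meets L in K. *)
Lemma weyl_fractions_embedding (Q : unitAlgType K) (phi : {lrmorphism weyl K -> Q}) :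
  division_ring_of_fractions phi ->
  exists (D : unitAlgType L) (Psi : {rmorphism Q -> D}),
  [/\ forall d : D, d != 0 -> d \is a GRing.unit,
      forall y f g : D, (forall l : L, y != l%:A) ->
        GRing.comm f y -> GRing.comm g y -> GRing.comm f g,
      forall k, Psi k%:A = (j k)%:A
    & forall (l : L) q, Psi q = l%:A -> exists k, l = j k].
Proof.
move=> [phi_inj Qdiv frac].
have unit_weyl a : a != 0 -> weyl_laurent a \is a GRing.unit.
  by apply: contra_neqT => /negbNE/eqP/weyl_laurent_eq0.
have [Psi PsiE] : exists Psi : {rmorphism Q -> S}, forall a, Psi (phi a) = weyl_laurent a.
  exact: (@frac_lift (weyl K) Q S phi weyl_laurent).
exists S, Psi; split=> //.
- exact: laurent_centralizer_comm.
- move=> k; rewrite -[k%:A]/(k *: 1) -(rmorph1 phi) -linearZ PsiE weyl_laurentZ.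
  by rewrite rmorph1.
- move=> l q; have [a [s [s0 ->]]] := frac q.
  rewrite rmorphM rmorphV; last first.
    by apply: Qdiv; apply: contra_neq s0 => s0; apply: phi_inj; rewrite s0 rmorph0.
  rewrite !PsiE => E; apply: (weyl_laurent_ratio (a := a) s0).
  by rewrite -mulr_algr -E mulVKr ?unit_weyl.
Qed.
End WeylToLaurent.

(** * Independence of generalized eigenvectors over a centralizer *)

Section LeftIndependence.
Variables (D : unitRingType) (a : D).
Hypothesis D_div : forall d : D, d != 0 -> d \is a GRing.unit.
Hypothesis centC : forall x y : D, GRing.comm x a -> GRing.comm y a -> GRing.comm x y.
Implicit Types (l m x y z : D) (ms : seq D).

Local Notation E := (fun x => GRing.comm x a).

(** Right multiplication by a, minus left multiplication by l. For l in the centralizer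
    E of a, which is commutative, these operators commute with each other and are left
    E-linear: they play the role of the X - l for one E-linear operator X. *)
Definition twist l x := x * a - l * x.

Lemma twistD l x y : twist l (x + y) = twist l x + twist l y.
Proof. by rewrite /twist mulrDl mulrDr opprD addrACA. Qed.

Lemma twist0 l : twist l 0 = 0.
Proof. by rewrite /twist mul0r mulr0 subrr. Qed.

Lemma twistM e l x : E e -> E l -> twist l (e * x) = e * twist l x.
Proof.
by move=> ea la; rewrite /twist mulrBr !mulrA (centC la ea).
Qed.

Lemma twistC l m x : E l -> E m -> twist l (twist m x) = twist m (twist l x).
Proof.
move=> la ma; rewrite /twist !mulrBl !mulrBr !mulrA (centC la ma) !opprB.
by rewrite addrACA [RHS]addrACA; congr (_ + _); exact: addrC.
Qed.

Definition twists ms x := foldr twist x ms.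

Lemma twistsD ms x y : twists ms (x + y) = twists ms x + twists ms y.
Proof. by elim: ms => //= m ms ->; rewrite twistD. Qed.

Lemma twists0 ms : twists ms 0 = 0.
Proof. by elim: ms => //= m ms ->; rewrite twist0. Qed.

Lemma twistsM e ms x : E e -> {in ms, forall m, E m} -> twists ms (e * x) = e * twists ms x.
Proof.
move=> ea; elim: ms => //= m ms IH mE; rewrite IH; last first.
  by move=> k kms; apply: mE; rewrite inE kms orbT.
by rewrite twistM//; apply: mE; rewrite inE eqxx.
Qed.

Lemma twists_twist m ms x : E m -> {in ms, forall m, E m} ->
  twists ms (twist m x) = twist m (twists ms x).
Proof.
move=> ma; elim: ms => //= k ms IH mE; rewrite IH; last first.
  by move=> l lms; apply: mE; rewrite inE lms orbT.
by rewrite twistC//; apply: mE; rewrite inE eqxx.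
Qed.

Lemma iter_twistC k l m x : E l -> E m ->
  iter k (twist l) (twist m x) = twist m (iter k (twist l) x).
Proof. by move=> la ma; elim: k => //= k ->; rewrite twistC. Qed.

Lemma twists_kill l ms k x : {in ms, forall m, E m} -> E l ->
  iter k (twist l) x = 0 -> (k <= count_mem l ms)%N -> twists ms x = 0.
Proof.
move=> mE la; elim: ms k x mE => [|m ms IH] k x mE.
  by rewrite leqn0 => /= + /eqP k0; rewrite k0.
have msE : {in ms, forall m, E m} by move=> i ims; apply: mE; rewrite inE ims orbT.
have ma : E m by apply: mE; rewrite inE eqxx.
rewrite /= -twists_twist//; case: eqVneq => [->|ml] x0 kms.
  case: k x0 kms => [/= -> _|k x0 kms]; first by rewrite twist0 twists0.
  by apply: (IH k) => //; rewrite -iterSr.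
by apply: (IH k) => //; rewrite iter_twistC// x0 twist0.
Qed.

Lemma twists_eigen l ms z : {in ms, forall m, E m /\ m != l} -> E l ->
  twist l z = 0 -> exists c, [/\ c != 0, E c & twists ms z = c * z].
Proof.
move=> mE la zl; elim: ms mE => [|m ms IH] mE.
  by exists 1; split; [exact: oner_neq0|exact/commr_sym/commr1|rewrite mul1r].
have [|c [c0 ca cE]] := IH; first by move=> i ims; apply: mE; rewrite inE ims orbT.
have [ma ml] : E m /\ m != l by apply: mE; rewrite inE eqxx.
exists (c * (l - m)); split.
- rewrite mulrI_eq0 ?subr_eq0 1?eq_sym//; exact/mulrI/D_div.
- apply/commr_sym/commrM; first exact/commr_sym.
  by apply: commrB; exact/commr_sym.
rewrite /= cE twistM// -mulrA; congr (_ * _); rewrite /twist mulrBl.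
by congr (_ - _); move/eqP: zl; rewrite subr_eq0 => /eqP.
Qed.

Lemma count_flatten_nseq (I : eqType) (s : seq I) (f : I -> D) N i : i \in s ->
  (N <= count_mem (f i) (flatten [seq nseq N (f k) | k <- s]))%N.
Proof.
elim: s => //= k s IH; rewrite inE count_cat => /predU1P[->|/IH is_]; last by lia.
by rewrite count_nseq /= eqxx mul1n leq_addr.
Qed.

(** Among the terms with nonzero coefficient, let i0 have maximal level n i0. Apply to
    the relation the product of (X - l)^(n i0 + 1) over the other eigenvalues l and of
    (X - lam i0)^(n i0). It kills the terms with another eigenvalue, and those with the
    same eigenvalue since they have a smaller level; the term i0 is sent to a nonzero
    multiple of itself at level n i0. *)
Lemma left_independent (I : finType) (x lam : I -> D) (n : I -> nat) (e : I -> D) :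
  (forall i, E (lam i)) -> injective (fun i => (lam i, n i)) ->
  (forall i, iter (n i) (twist (lam i)) (x i) != 0) ->
  (forall i, iter (n i).+1 (twist (lam i)) (x i) = 0) ->
  (forall i, E (e i)) -> \sum_i e i * x i = 0 -> forall i, e i = 0.
Proof.
move=> lamE inj x_neq0 x_eq0 eE sum0 i1; apply/eqP/negP => /negP e1.
case: (@arg_maxnP _ i1 (fun i => e i != 0) n e1) => i0 e0 i0max.
have {}i0max i : e i != 0 -> (n i <= n i0)%N := i0max i.
pose rest := flatten [seq nseq (n i0).+1 (lam i) | i <- enum I & lam i != lam i0].
pose ms := rest ++ nseq (n i0) (lam i0).
have restE : {in rest, forall m, E m /\ m != lam i0}.
  move=> m /flatten_mapP[i]; rewrite mem_filter => /andP[li _].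
  by rewrite mem_nseq => /andP[_ /eqP ->].
have msE : {in ms, forall m, E m}.
  move=> m; rewrite mem_cat mem_nseq => /orP[/restE[]//|/andP[_ /eqP ->]].
  exact: lamE.
have := congr1 (twists ms) sum0.
rewrite twists0 (big_morph _ (twistsD ms) (twists0 ms)) (bigD1 i0)//=.
rewrite [X in _ + X]big1 ?addr0 => [|i ii0]; last first.
  rewrite twistsM//; have [->|ei] := eqVneq (e i) 0; first by rewrite mul0r.
  rewrite (@twists_kill (lam i) ms (n i).+1) ?mulr0//.
  rewrite count_cat; have [ll|ll] := eqVneq (lam i) (lam i0).
    have nn : (n i < n i0)%N.
      rewrite ltn_neqAle (i0max i ei) andbT; apply: contra_neq ii0 => nn.
      by apply: inj; rewrite ll nn.
    by rewrite count_nseq ll /= eqxx mul1n; lia.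
  apply: (@leq_trans (n i0).+1); first by rewrite ltnS; exact: i0max.
  apply: leq_trans (leq_addr _ _); apply: count_flatten_nseq.
  by rewrite mem_filter ll mem_enum.
rewrite twistsM// /ms /twists foldr_cat.
have -> : foldr twist (x i0) (nseq (n i0) (lam i0)) = iter (n i0) (twist (lam i0)) (x i0).
  by elim: (n i0) => //= k ->.
have [|c [c0 _ cE]] := @twists_eigen (lam i0) rest (iter (n i0) (twist (lam i0)) (x i0))
    restE (lamE i0).
  by rewrite -iterS.
rewrite -/(twists _ _) cE => /eqP.
rewrite mulrI_eq0; last exact/mulrI/D_div.
by rewrite mulrI_eq0; [rewrite (negbTE (x_neq0 i0))|exact/mulrI/D_div].
Qed.
End LeftIndependence.

(** * Monomials and growth *)

Lemma indep_le_span_fin (F : fieldType) (V : lmodType F) (I : finType) m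
    (x : I -> V) (y : 'I_m -> V) :
  (forall c : I -> F, \sum_i c i *: x i = 0 -> forall i, c i = 0) ->
  (forall i, exists d : 'I_m -> F, x i = \sum_k d k *: y k) -> (#|I| <= m)%N.
Proof.
move=> xI xE.
apply: (indep_le_span (x := fun i : 'I_#|I| => x (enum_val i)) (y := y)) => // c c0 i.
have := xI (fun l => c (enum_rank l)).
rewrite (reindex (@enum_val I predT)) /=; last exact/onW_bij/enum_val_bij.
rewrite -[RHS]c0; move=> H; rewrite -[i]enum_valK; apply: H.
by apply: eq_bigr => k _; rewrite enum_valK.
Qed.

Section Growth.
Variables (K L : fieldType) (j : {rmorphism K -> L}) (B : algType K) (D : algType L).
Variable iota : {rmorphism B -> D}.
Hypothesis iotaZ : forall k b, iota (k *: b) = j k *: iota b.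

Definition combination (t : seq (L * B)) : D := \sum_(p <- t) p.1 *: iota p.2.

Definition lspan (x : D) : Prop := exists t, x = combination t.

Lemma combination_cat s t : combination (s ++ t) = combination s + combination t.
Proof. exact: big_cat. Qed.

Lemma combination_scale l t :
  combination [seq (l * p.1, p.2) | p <- t] = l *: combination t.
Proof.
by rewrite /combination big_map scaler_sumr; apply: eq_bigr => p _; rewrite scalerA.
Qed.

Lemma lspan0 : lspan 0. Proof. by exists [::]; rewrite /combination big_nil. Qed.

Lemma lspanD x y : lspan x -> lspan y -> lspan (x + y).
Proof. by move=> [s ->] [t ->]; exists (s ++ t); rewrite combination_cat. Qed.

Lemma lspanZ l x : lspan x -> lspan (l *: x).
Proof. by move=> [s ->]; exists [seq (l * p.1, p.2) | p <- s]; rewrite combination_scale. Qed.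

Lemma lspan_iota b : lspan (iota b).
Proof. by exists [:: (1, b)]; rewrite /combination big_seq1 scale1r. Qed.

Lemma lspanM x y : lspan x -> lspan y -> lspan (x * y).
Proof.
move=> [s ->] [t ->]; rewrite /combination big_distrl /=.
apply: (big_ind lspan) => [||p _]; [exact: lspan0|exact: lspanD|].
rewrite big_distrr /=; apply: (big_ind lspan) => [||q _]; [exact: lspan0|exact: lspanD|].
rewrite -scalerAl -scalerAr scalerA; apply: lspanZ; rewrite -rmorphM; exact: lspan_iota.
Qed.

Definition wspan (s : seq B) n (x : D) : Prop :=
  exists t, x = combination t /\ {subset map snd t <= words s n}.

Lemma wspan0 s n : wspan s n 0.
Proof. by exists [::]; rewrite /combination big_nil. Qed.

Lemma wspanD s n x y : wspan s n x -> wspan s n y -> wspan s n (x + y).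
Proof.
move=> [t [-> ts]] [u [-> us]]; exists (t ++ u); rewrite combination_cat; split=> //.
by move=> b; rewrite map_cat mem_cat => /orP[/ts|/us].
Qed.

Lemma wspanZ s n l x : wspan s n x -> wspan s n (l *: x).
Proof.
move=> [t [-> ts]]; exists [seq (l * p.1, p.2) | p <- t]; split.
  by rewrite combination_scale.
by rewrite -map_comp.
Qed.

Lemma wspan_mul s n b x : b \in s -> wspan s n x -> wspan s n.+1 (iota b * x).
Proof.
move=> bs [t [-> ts]]; exists [seq (p.1, b * p.2) | p <- t]; split.
  rewrite /combination big_distrr big_map; apply: eq_bigr => p _ /=.
  by rewrite -scalerAr rmorphM.
move=> c; rewrite -map_comp => /mapP[p pt ->] /=.
by apply/allpairsP; exists (b, p.2); split=> //; apply/ts/map_f.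
Qed.

Lemma wspan_comb s n t x : {subset map snd t <= s} -> wspan s n x ->
  wspan s n.+1 (combination t * x).
Proof.
move=> ts xs; rewrite /combination big_distrl big_seq.
apply: (big_ind (wspan s n.+1)) => [||p pt]; [exact: wspan0|exact: wspanD|].
by rewrite /= -scalerAl; apply/wspanZ/wspan_mul => //; apply/ts/map_f.
Qed.

Lemma wspan_widen s m n x : 1 \in s -> (m <= n)%N -> wspan s m x -> wspan s n x.
Proof.
move=> s1 /subnK <-; elim: (n - m)%N => //= k IH /IH xs.
by rewrite -[x]mul1r -(rmorph1 iota); exact: wspan_mul.
Qed.

Lemma wspan_exp s n t x k : {subset map snd t <= s} -> wspan s n x ->
  wspan s (k + n) (combination t ^+ k * x).
Proof.
move=> ts xs; elim: k => [|k IH]; first by rewrite mul1r.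
by rewrite exprS -mulrA; exact: wspan_comb.
Qed.

(** Dimensions do not increase under extension of scalars: a K-basis of the span of the
    words also spans over L. *)
Lemma wspan_basis s n : exists b : seq B, size b = span_dim (words s n) /\
  forall x, wspan s n x -> exists d : 'I_(size b) -> L, x = \sum_i d i *: iota b`_i.
Proof.
have [b [sb _ bE]] := span_dim_basis (words s n); exists b; split=> // _ [t [-> ts]].
rewrite /combination big_seq.
apply: (big_ind (fun x => exists d : 'I_(size b) -> L, x = \sum_i d i *: iota b`_i)).
- by exists (fun=> 0); rewrite big1// => i _; rewrite scale0r.
- move=> _ _ [d ->] [e ->]; exists (fun i => d i + e i); rewrite -big_split.
  by apply: eq_bigr => i _; rewrite scalerDl.
move=> p pt; have [|c ->] := bE p.2; first exact/ts/map_f.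
exists (fun i => p.1 * j (c i)); rewrite rmorph_sum scaler_sumr.
by apply: eq_bigr => i _; rewrite iotaZ scalerA.
Qed.

Variables (R : realType).

(** The elements p, q, r involve finitely many elements s of B. A monomial with
    exponents at most n / 3 is an L-combination of words of length n in s and 1, and
    there are cubically many such monomials. *)
Lemma GKdim_ge3_monomials (p q r : D) : lspan p -> lspan q -> lspan r ->
  (forall m (c : 'I_m * 'I_m * 'I_m -> L),
    \sum_i c i *: (p ^+ i.1.1 * (q ^+ i.1.2 * r ^+ i.2)) = 0 -> forall i, c i = 0) ->
  (3%:E <= GKdim B R)%E.
Proof.
move=> [t ->] [u ->] [v ->] indep.
pose s := map snd t ++ map snd u ++ map snd v.
apply: (@GKdim_ge3 R K B s) => n; set m := (n %/ 3).+1.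
have [b [<- bE]] := wspan_basis (1 :: s) n.
have -> : (m ^ 3)%N = #|{: 'I_m * 'I_m * 'I_m}| by rewrite !card_prod card_ord; ring.
apply: (indep_le_span_fin (indep m)) => -[[i k] l] /=; apply: bE.
have sub w : {subset w <= s} -> {subset w <= 1 :: s}.
  by move=> ws x /ws; rewrite inE orbC => ->.
rewrite -[combination v ^+ l]mulr1.
apply: (@wspan_widen _ (i + (k + (l + 0)))); first exact: mem_head.
  have := (ltn_ord i, ltn_ord k, ltn_ord l) => -[[]]; rewrite /m; lia.
apply: wspan_exp; first by apply: sub => x; rewrite !mem_cat => ->.
apply: wspan_exp; first by apply: sub => x; rewrite !mem_cat => ->; rewrite orbT.
apply: wspan_exp; first by apply: sub => x; rewrite !mem_cat => ->; rewrite !orbT.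
exists [:: (1, 1)]; rewrite /combination big_seq1 scale1r rmorph1; split=> //.
Qed.
End Growth.

(** * Products of eigenvectors and Jordan vectors *)

Lemma ad_mul (A : pzRingType) (a x y : A) : ad a (x * y) = ad a x * y + x * ad a y.
Proof. by rewrite /ad mulrBl mulrBr !mulrA addrA subrK. Qed.

Section EigenPowers.
Variables (L : fieldType) (D : unitAlgType L) (a : D).
Implicit Types (m n : L) (x y z : D).

Definition eigen_defect m x : D := ad a x - m *: x.
Local Notation N := eigen_defect.

Fact eigen_defect_linear m : linear (N m).
Proof.
move=> k x y; rewrite /N (ad_linear a k x y) [m *: _]scalerDr [k *: (_ - m *: x)]scalerBr.
by rewrite !scalerA [m * k]mulrC opprD addrACA.
Qed.
HB.instance Definition _ m :=
  GRing.isLinear.Build L D D *:%R (N m) (eigen_defect_linear m).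

(** Eigenvalues of a derivation add up under products: this is the Leibniz rule for ad a
    - (m + n). *)
Lemma eigen_defectM m n x y : N (m + n) (x * y) = N m x * y + x * N n y.
Proof.
rewrite /N ad_mul [(_ - m *: x) * y]mulrBl [x * (_ - n *: y)]mulrBr scalerDl.
by rewrite -scalerAl -scalerAr opprD addrACA.
Qed.

Lemma eigen_defect_iter_exp (l n : L) v z i k : N l v = 0 ->
  iter k (N (l *+ i + n)) (v ^+ i * z) = v ^+ i * iter k (N n) z.
Proof.
move=> vl; have step z' i' : N (l *+ i' + n) (v ^+ i' * z') = v ^+ i' * N n z'.
  elim: i' z' => [|i' IH] z'; first by rewrite mulr0n add0r !mul1r.
  by rewrite mulrS -addrA exprS -!mulrA eigen_defectM vl mul0r add0r IH.
by elim: k => //= k ->; rewrite step.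
Qed.

Section Jordan.
Variables (m : L) (w : D).
Hypothesis w_jordan : N m (N m w) = 0.

(** In the binomial expansion of the k-th power of the operator on w x, only the terms
    in which w is hit at most once survive. *)
Lemma eigen_defect_iter_jordan (n : L) x k :
  iter k (N (m + n)) (w * x) =
  w * iter k (N n) x + (N m w * iter k.-1 (N n) x) *+ k.
Proof.
elim: k => [|k IH] /=; first by rewrite mulr0n addr0.
rewrite IH linearD raddfMn /= !eigen_defectM w_jordan mul0r add0r [_ + w * _]addrC -addrA.
congr (_ + _); rewrite mulrS; congr (_ + _).
by case: k {IH} => //=; rewrite !mulr0n.
Qed.

(** So w^k has exact level k, like X^k under derivation: k iterations of the operator
    give k! times the k-th power of the eigenvector. *)
Lemma eigen_defect_jordan_exp k :
  iter k (N (m *+ k)) (w ^+ k) = (N m w ^+ k) *+ k`! /\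
  iter k.+1 (N (m *+ k)) (w ^+ k) = 0.
Proof.
elim: k => [|k [IH1 IH2]].
  by rewrite /= expr0 mulr0n /N /ad mulr1 mul1r subrr scale0r subrr.
rewrite mulrS exprS; split.
  rewrite eigen_defect_iter_jordan IH2 mulr0 add0r [_.-1]/= IH1.
  by rewrite mulrnAr -exprS -mulrnA factS mulnC.
rewrite eigen_defect_iter_jordan -[k.+2.-1]/(k.+1) IH2 iterS IH2 linear0 !mulr0.
by rewrite mul0rn addr0.
Qed.
End Jordan.

(** Right multiplication by a, minus left multiplication by a - m, is - (ad a - m). Thus
    generalized eigenvectors of ad a in the usual sense are generalized eigenvectors of
    right multiplication by a, with eigenvalues a - m in the centralizer of a. *)
Lemma iter_twist_eigen m k x :
  iter k (twist a (a - m%:A)) x = (-1) ^+ k *: iter k (N m) x.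
Proof.
elim: k => [|k IH]; first by rewrite scale1r.
rewrite !iterS IH /twist exprSr -scalerA scaleN1r scalerN -scalerN.
rewrite -scalerAl -scalerAr -scalerBr /N /ad opprB mulrBl mulr_algl.
by rewrite !opprB; congr (_ *: _); rewrite addrCA.
Qed.
End EigenPowers.

Section DivisionAlgebra.
Variables (L : closedFieldType) (D : unitAlgType L).
Hypothesis charL : [pchar L] =i pred0.
Hypothesis D_div : forall d : D, d != 0 -> d \is a GRing.unit.
Hypothesis D_cent : forall y f g : D, (forall l : L, y != l%:A) ->
  GRing.comm f y -> GRing.comm g y -> GRing.comm f g.

Lemma div_mul_neq0 (x y : D) : x != 0 -> y != 0 -> x * y != 0.
Proof. by move=> x0 y0; rewrite mulrI_eq0//; exact/mulrI/D_div. Qed.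

Lemma div_exp_neq0 (x : D) n : x != 0 -> x ^+ n != 0.
Proof.
by move=> x0; elim: n => [|n IH]; rewrite ?expr0 ?oner_neq0// exprS div_mul_neq0.
Qed.

Lemma algD_inj (k l : L) : k%:A = l%:A :> D -> k = l.
Proof.
move/eqP; rewrite -subr_eq0 -scalerBl scaler_eq0 oner_eq0 orbF subr_eq0.
by move/eqP.
Qed.

(** L is algebraically closed and D has no zero divisors, so a root of a polynomial over
    L is a scalar. *)
Lemma nonscalar_transcendental (a : D) n (c : 'I_n -> L) : (forall l, a != l%:A) ->
  \sum_i c i *: a ^+ i = 0 -> forall i, c i = 0.
Proof.
move=> a_ns c0 i; pose p := \poly_(k < n) (if insub k is Some l then c l else 0).
have cE (l : 'I_n) : p`_l = c l by rewrite coef_poly ltn_ord valK.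
rewrite -cE; suff -> : p = 0 by rewrite coef0.
apply/eqP/negP => /negP p0.
have [rs pE] := closed_field_poly_normal p.
have : horner_alg a p = 0.
  rewrite /p poly_def linear_sum -[RHS]c0; apply: eq_bigr => l _.
  rewrite linearZ /= rmorphXn /= horner_algX mulr_algl.
  by rewrite valK.
apply/eqP; rewrite pE linearZ /= mulr_algl scaler_eq0 lead_coef_eq0 (negbTE p0) /=.
rewrite rmorph_prod /=; elim: rs {pE} => [|r rs IH]; first by rewrite big_nil oner_neq0.
rewrite big_cons div_mul_neq0// rmorphB /= horner_algX horner_algC subr_eq0.
exact: a_ns.
Qed.
End DivisionAlgebra.

(** * Subalgebras of growth less than cubic *)

Section Subalgebra.
Variables (R : realType) (K : fieldType) (L : closedFieldType) (j : {rmorphism K -> L}).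
Hypothesis charK : [pchar K] =i pred0.
Hypothesis algL : forall z : L, algebraicOver j z.
Variable D : unitAlgType L.
Hypothesis D_div : forall d : D, d != 0 -> d \is a GRing.unit.
Hypothesis D_cent : forall y f g : D, (forall l : L, y != l%:A) ->
  GRing.comm f y -> GRing.comm g y -> GRing.comm f g.
Variables (B : algType K) (iota : {rmorphism B -> D}).
Hypothesis iotaZ : forall k b, iota (k *: b) = j k *: iota b.
Hypothesis iota_eq0 : forall b, iota b = 0 -> b = 0.
Hypothesis iota_ratio : forall (l : L) b b', b' != 0 -> iota b = l *: iota b' ->
  exists k, l = j k.
Hypothesis B_nc : noncommutative B.

Let charL : [pchar L] =i pred0.
Proof. by move=> p; rewrite (fmorph_pchar j). Qed.

Let natL_eq0 n : (n%:R == 0 :> L) = (n == 0%N).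
Proof. exact: (pcharf0P L).1. Qed.

Local Notation LB := (lspan iota).
Implicit Types (a b c : B).

Lemma iota_inj : injective iota.
Proof.
move=> x y xy; apply/eqP; rewrite -subr_eq0; apply/eqP/iota_eq0.
by rewrite rmorphB xy subrr.
Qed.

Lemma iota_ad a b : iota (ad a b) = ad (iota a) (iota b).
Proof. by rewrite /ad rmorphB !rmorphM. Qed.

Lemma centralizerE a b : centralizer a b <-> GRing.comm b a.
Proof.
rewrite /centralizer /ad /=; split=> [/eqP|ba]; last by rewrite ba subrr.
by rewrite subr_eq0 => /eqP.
Qed.

Lemma iota_nonscalar a : ~ center a -> forall l, iota a != l%:A.
Proof.
move=> aZ l; apply/eqP => al; apply: aZ => b; apply: iota_inj.
by rewrite !rmorphM /= al mulr_algl mulr_algr.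
Qed.

Lemma centralizer_commutative a b c : ~ center a ->
  centralizer a b -> centralizer a c -> b * c = c * b.
Proof.
move=> /iota_nonscalar ans /centralizerE ba /centralizerE ca; apply: iota_inj.
rewrite !rmorphM; apply: (D_cent ans); rewrite /GRing.comm -!rmorphM.
  by rewrite ba.
by rewrite ca.
Qed.

Lemma centralizer_eq a b : ~ center a -> ~ center b -> centralizer a b ->
  centralizer b = centralizer a.
Proof.
move=> aZ bZ ab; apply/seteqP; split=> c /= cc; apply/centralizerE.
  apply: (centralizer_commutative bZ) => //; apply/centralizerE.
  by move/centralizerE: ab.
exact: (centralizer_commutative aZ).
Qed.

(** If (ad a)^(i + 1) kills x, then (ad a)^i sends x into C(a) = C(b), and so (ad a)^i
    kills [b, x], because ad a and ad b commute. Thus ad b lowers the degree of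
    nilpotency with respect to a. *)
Lemma nilp_sub a b : ~ center a -> ~ center b -> centralizer a b ->
  (Defs.nilp a `<=` Defs.nilp b)%classic.
Proof.
move=> aZ bZ ab x [i]; have cE := centralizer_eq aZ bZ ab.
have adC y : ad a (ad b y) = ad b (ad a y).
  move/centralizerE: ab => ab; rewrite /ad !mulrBr !mulrBl !mulrA ab -[y * a * b]mulrA.
  rewrite -ab mulrA !opprB addrACA [RHS]addrACA; congr (_ + _); exact: addrC.
have iterC n y : iter n (ad a) (ad b y) = ad b (iter n (ad a) y).
  by elim: n => //= n ->; rewrite adC.
have ad0 (c : B) : ad c 0 = 0 by rewrite /ad mulr0 mul0r subrr.
elim: i x => [|i IH] x xi.
  by exists 0%N; have : centralizer b x by rewrite cE.
have [|k xk] := IH (ad b x); last by exists k.+1; rewrite iterSr.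
rewrite /= -/(iter i.+1 _ _) iterC.
have : centralizer b (iter i.+1 (ad a) x) by rewrite cE.
by [].
Qed.

Lemma nilp_eq a b : ~ center a -> ~ center b -> centralizer a b -> Defs.nilp b = Defs.nilp a.
Proof.
move=> aZ bZ ab; apply/seteqP; split; apply: nilp_sub => //.
by apply/centralizerE; move/centralizerE: ab.
Qed.

Lemma tens1_inj (a : B) : tens j 1 a = 0 -> a = 0.
Proof. by apply: (tens1_eq0 (f := iota)) => [x y||]; rewrite ?rmorphD. Qed.

Lemma iota_pact a p b : iota (pact (ad a) p b) = pact (ad (iota a)) (map_poly j p) (iota b).
Proof. by apply: pact_morph => [x y||]; [exact: rmorphD|exact: iotaZ|exact: iota_ad]. Qed.

Lemma lspan_ad a x : LB x -> LB (ad (iota a) x).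
Proof.
move=> xB; rewrite /ad; apply: lspanD.
  by apply: lspanM => //; exact: lspan_iota.
rewrite -scaleN1r; apply: lspanZ; apply: lspanM => //; exact: lspan_iota.
Qed.

(** The image of b is a sum of eigenvectors; not all of them have eigenvalue 0 unless b
    commutes with a. *)
Lemma semisimple_vector a b : diag j a b -> ~ centralizer a b ->
  exists (l : L) v, [/\ l != 0, v != 0, LB v & ad (iota a) v = l *: v].
Proof.
move=> /(diagP charK algL tens1_inj)[g sg gb] ab.
have [rs gE] := closed_field_poly_normal (map_poly j g).
have urs : uniq rs.
  rewrite -separable_prod_XsubC; apply: dvdp_separable (_ : separable_poly (map_poly j g)).
    by rewrite gE dvdpZr ?dvdpp// lead_coef_eq0 map_poly_eq0 separable_poly_neq0.
  by rewrite separable_map.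
have zrs : pact (ad (iota a)) (\prod_(r <- rs) ('X - r%:P)) (iota b) = 0.
  have := iota_pact a g b; rewrite gb rmorph0 gE pactZ => /esym/eqP.
  rewrite scaler_eq0 lead_coef_eq0 map_poly_eq0 (negbTE (separable_poly_neq0 sg)) /=.
  by move/eqP.
have [|||||v [vE bE]] := @eigen_decomposition _ _ _ (ad_linear (iota a)) LB rs (iota b)
  (lspan0 _) _ _ _ _ _ zrs.
- exact: lspanD.
- exact: lspanZ.
- exact: lspan_ad.
- by left.
- exact: lspan_iota.
apply/not_existsP => nv; apply: ab; apply: iota_inj; rewrite iota_ad rmorph0 bE.
rewrite -[ad _ _](pactXn (ad_linear (iota a)) 1) (pact_sum (ad_linear _)).
rewrite big1_seq// => r _; rewrite (pactXn (ad_linear _)) /= (vE r).2.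
have [->|r0] := eqVneq r 0; first by rewrite scale0r.
have [->|v0] := eqVneq (v r) 0; first by rewrite scaler0.
by case: (nv r); exists (v r); split=> //; case: (vE r).
Qed.

(** If there were no Jordan vector, the image of c would be a sum of eigenvectors, and
    the square-free part of a polynomial that kills c would kill it as well. *)
Lemma jordan_vector a c : locally_finite a c -> ~ diag j a c ->
  exists (m : L) w, [/\ LB w, eigen_defect (iota a) m w != 0 &
    eigen_defect (iota a) m (eigen_defect (iota a) m w) = 0].
Proof.
move=> /locally_finiteP[f f0 fc] /(diagP charK algL tens1_inj) nd.
have [rs fE] := closed_field_poly_normal (map_poly j f).
apply: contrapT => nw; apply: nd; exists (squarefree_part f); first exact: make_separable.
have zrs : pact (ad (iota a)) (\prod_(r <- rs) ('X - r%:P)) (iota c) = 0.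
  have := iota_pact a f c; rewrite fc rmorph0 fE pactZ => /esym/eqP.
  by rewrite scaler_eq0 lead_coef_eq0 map_poly_eq0 (negbTE f0) /= => /eqP.
have [|||||v [vE cE]] := @eigen_decomposition _ _ _ (ad_linear (iota a)) LB rs (iota c)
  (lspan0 _) _ _ _ _ _ zrs.
- exact: lspanD.
- exact: lspanZ.
- exact: lspan_ad.
- right=> m w wB E; apply/eqP; rewrite -subr_eq0; apply/negP => /negP w0.
  by apply: nw; exists m, w; split=> //; rewrite /eigen_defect E subrr.
- exact: lspan_iota.
apply: iota_inj; rewrite iota_pact rmorph0 cE (pact_sum (ad_linear _)).
rewrite big1_seq// => r; rewrite mem_undup => /andP[_ rrs].
rewrite (pact_eigen (ad_linear _) _ (vE r).2).
have /eqP -> : root (map_poly j (squarefree_part f)) r; last by rewrite scale0r.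
apply: squarefree_part_root => //; rewrite fE rootZ ?root_prod_XsubC//.
by rewrite lead_coef_eq0 map_poly_eq0.
Qed.

Hypothesis GK_lt3 : (GKdim B R < 3%:E)%E.

(** A relation over L between the a^i q^k r^l is a relation between the q^k r^l whose
    coefficients are polynomials in a; these commute with a, and are nonzero as a is
    transcendental. *)
Lemma small_growth (a q r : D) : (forall l, a != l%:A) -> LB a -> LB q -> LB r ->
  ~ (forall m (e : 'I_m * 'I_m -> D), (forall i, GRing.comm (e i) a) ->
      \sum_i e i * (q ^+ i.1 * r ^+ i.2) = 0 -> forall i, e i = 0).
Proof.
move=> a_ns aB qB rB indep.
suff : (3%:E <= GKdim B R)%E by rewrite leNgt GK_lt3.
apply: (@GKdim_ge3_monomials _ _ j B D iota iotaZ R a q r aB qB rB) => m c c0.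
pose e (i : 'I_m * 'I_m) := \sum_k c ((k, i.1), i.2) *: a ^+ k.
have e0 : forall i, e i = 0.
  apply: (indep m) => [i|].
    apply/commr_sym/commr_sum => k _; rewrite /GRing.comm -scalerAr -scalerAl.
    by congr (_ *: _); exact: commrX.
  rewrite -[RHS]c0.
  under eq_bigr => i _ do rewrite mulr_suml.
  rewrite pair_bigA /=.
  rewrite [RHS](reindex (fun p : 'I_m * 'I_m * 'I_m => ((p.2, p.1.1), p.1.2))) /=.
    by apply: eq_bigr => p _; rewrite -scalerAl.
  exists (fun p => ((p.1.2, p.2), p.1.1)) => [[[x y] z]|[[x y] z]] _ //.
move=> [[x y] z]; exact: (nonscalar_transcendental D_div a_ns (e0 (y, z)) x).
Qed.

Lemma centralizer_sub_diag a : (centralizer a `<=` diag j a)%classic.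
Proof.
move=> b ab; apply/(diagP charK algL tens1_inj); exists 'X.
  by have := separable_prod_XsubC [:: 0 : K]; rewrite big_seq1 subr0.
by rewrite -['X]expr1 (pactXn (ad_linear a)).
Qed.

Lemma diag_not_centralizer a : diag j a <> centralizer a ->
  exists2 b, diag j a b & ~ centralizer a b.
Proof.
move=> DC; apply/not_exists2P => nb; apply: DC; apply/seteqP; split.
  by move=> b ab; apply: contrapT => nab; case: (nb b).
exact: centralizer_sub_diag.
Qed.

Lemma diag_sub_locally_finite a : (diag j a `<=` locally_finite a)%classic.
Proof.
move=> b /(diagP charK algL tens1_inj)[g /separable_poly_neq0 g0 gb].
by apply/locally_finiteP; exists g.
Qed.

(** Otherwise there are an eigenvector v and a Jordan vector w of ad a. Then v^i w^k is
    a generalized eigenvector for i l + k mu of exact level k. The pairs (i l + k mu, k)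
    are distinct because l is nonzero, and small growth is contradicted. *)
Lemma semisimple_locally_finite a : ~ center a ->
  diag j a <> centralizer a -> diag j a = locally_finite a.
Proof.
move=> aZ /diag_not_centralizer[b bD bC]; apply/seteqP; split.
  exact: diag_sub_locally_finite.
move=> c cF; apply: contrapT => cD.
have [l [v [l0 v0 vB vl]]] := semisimple_vector bD bC.
have [mu [w [wB u0 wj]]] := jordan_vector cF cD.
have ans := iota_nonscalar aZ.
apply: (small_growth ans (lspan_iota iota a) vB wB) => m e eE.
pose lam (i : 'I_m * 'I_m) : D := iota a - (l *+ i.1 + mu *+ i.2)%:A.
have vl' : eigen_defect (iota a) l v = 0 by rewrite /eigen_defect vl subrr.
have centC f g : GRing.comm f (iota a) -> GRing.comm g (iota a) -> GRing.comm f g.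
  exact: D_cent ans.
apply: (@left_independent D (iota a) D_div centC _ _ lam (fun i => i.2 : nat) e) => //.
- move=> i; apply/commr_sym/commrB => //; exact/commr_sym/comm_alg.
- move=> [i k] [i' k'] [] /addrI/oppr_inj/algD_inj /= + kk.
  rewrite kk => /addIr ii; congr (_, _); last exact: val_inj.
  apply: val_inj => /=; apply: (natr_inj charL).
  by apply: (mulfI l0); rewrite !mulr_natr.
- move=> [i k] /=; rewrite iter_twist_eigen scaler_eq0 signr_eq0 /=.
  rewrite eigen_defect_iter_exp// (eigen_defect_jordan_exp wj k).1.
  rewrite (div_mul_neq0 D_div) ?(div_exp_neq0 D_div)//.
  rewrite -scaler_nat scaler_eq0 natL_eq0 -leqn0 leqNgt fact_gt0 /=.
  exact: div_exp_neq0.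
- move=> [i k]; rewrite iter_twist_eigen eigen_defect_iter_exp//.
  by rewrite (eigen_defect_jordan_exp wj k).2 mulr0 scaler0.
Qed.

(** A vector killed by a power of ad a is in F(a) = D(a), so it is also killed by a
    separable polynomial in ad a, hence by their greatest common divisor, which divides
    X. *)
Lemma nilp_eq_of_semisimple a : ~ center a -> diag j a <> centralizer a ->
  Defs.nilp a = centralizer a.
Proof.
move=> aZ DC; have DF := semisimple_locally_finite aZ DC.
apply/seteqP; split => b; last by exists 0%N.
move=> [i bi].
have : diag j a b.
  rewrite DF; apply/locally_finiteP; exists 'X^(i.+1); first by rewrite monic_neq0 ?monicXn.
  by rewrite (pactXn (ad_linear a)).
move=> /(diagP charK algL tens1_inj)[g sg gb].
have hX : gcdp g 'X^(i.+1) %| 'X.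
  have : gcdp g 'X^(i.+1) %| ('X - 0%:P) ^+ i.+1 by rewrite subr0 dvdp_gcdr.
  move=> /dvdp_exp_XsubCP[k _ hE]; rewrite (eqp_dvdl _ hE) subr0.
  case: k hE => [|[|k]] hE; rewrite ?expr0 ?dvd1p ?expr1 ?dvdpp//.
  have := separable_nosquare (u := 'X - 0%:P) (k := k.+2) sg isT.
  by rewrite size_XsubC -(eqp_dvdl _ hE) dvdp_gcdl => /(_ isT).
rewrite /centralizer /= -[ad a b](pactXn (ad_linear a) 1 b) expr1.
apply: (pact_dvd (ad_linear a) hX).
have [[u1 u2] /= uE] := Bezoutp g 'X^(i.+1).
have /eqpf_eq[k k0 kE] := uE.
have := pactZ (ad a) k (gcdp g 'X^(i.+1)) b; rewrite -kE pactD !(pactM (ad_linear a)).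
rewrite gb (pactXn (ad_linear a)) bi !(pact0 (ad_linear a)) addr0 => /esym/eqP.
by rewrite scaler_eq0 (negbTE k0) => /eqP.
Qed.

Section CommutingSemisimple.
Variables (a b : B).
Hypotheses (aZ : ~ center a) (bZ : ~ center b) (ab : centralizer a b).
Variables (l mu : L) (v w : D).
Hypotheses (l0 : l != 0) (v0 : v != 0) (vl : ad (iota a) v = l *: v).
Hypotheses (m0 : mu != 0) (w0 : w != 0) (wm : ad (iota b) w = mu *: w).

Let conj (g x : D) := g * x / g.

Let conjD g x y : conj g (x + y) = conj g x + conj g y.
Proof. by rewrite /conj mulrDr mulrDl. Qed.

Let conjZ g k x : conj g (k *: x) = k *: conj g x.
Proof. by rewrite /conj -scalerAr -scalerAl. Qed.

Let conj_scalar g (k : L) : g != 0 -> conj g k%:A = k%:A.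
Proof. by move=> g0; rewrite /conj mulr_algr -scalerAl divrr// D_div. Qed.

Let conjDs g x (k : L) : g != 0 -> conj g (x + k%:A) = conj g x + k%:A.
Proof. by move=> g0; rewrite conjD conj_scalar. Qed.

Let conjBs g x (k : L) : g != 0 -> conj g (x - k%:A) = conj g x - k%:A.
Proof. by move=> g0; rewrite -scaleNr conjDs. Qed.

Let conj_inj g x y : g != 0 -> conj g x = conj g y -> x = y.
Proof.
move=> g0 /mulIr xy; apply: (mulrI (D_div g0)); apply: xy.
by rewrite unitrV D_div.
Qed.

Let conjM g h x : g != 0 -> h != 0 -> conj (g * h) x = conj g (conj h x).
Proof.
by move=> g0 h0; rewrite /conj invrM ?D_div// !mulrA.
Qed.

Let conj_comm g x y : g != 0 -> GRing.comm x y -> GRing.comm (conj g x) (conj g y).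
Proof.
move=> g0 xy; have gU := D_div g0; rewrite /GRing.comm /conj !mulrA !divrK//.
by rewrite -[g * x * y]mulrA xy mulrA.
Qed.

Let conj_fix g x : g != 0 -> conj g x = x -> GRing.comm x g.
Proof.
by move=> g0 gx; rewrite /GRing.comm -{1}gx /conj divrK// D_div.
Qed.

Lemma conj_shift (x g : D) (k : L) : g != 0 -> ad x g = k *: g -> conj g x = x - k%:A.
Proof.
move=> g0 E; have gU := D_div g0; apply: (mulIr gU); rewrite /conj divrK//.
by rewrite mulrBl mulr_algl -E /ad opprB addrC subrK.
Qed.

Let conj_exp_shift (x g : D) (k : L) n : g != 0 -> ad x g = k *: g ->
  conj (g ^+ n) x = x - (k *+ n)%:A.
Proof.
move=> g0 E; elim: n => [|n IH].
  by rewrite expr0 mulr0n scale0r subr0 /conj mul1r divr1.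
rewrite exprS conjM ?div_exp_neq0// IH -scaleN1r conjD conjZ conj_scalar//.
by rewrite (conj_shift g0 E) scaleN1r mulrS scalerDl opprD addrA.
Qed.

Let scalar_comm (k : L) (x : D) : GRing.comm k%:A x.
Proof. exact: comm_alg. Qed.

Let shift_comm (x y : D) (k : L) : GRing.comm x (y - k%:A) -> GRing.comm x y.
Proof.
move=> xy; rewrite -[y](subrK k%:A); apply: commrD => //.
exact/commr_sym/scalar_comm.
Qed.

Let ans := iota_nonscalar aZ.
Let bns := iota_nonscalar bZ.
Let comm_ba : GRing.comm (iota b) (iota a).
Proof. by move/centralizerE: ab => E; rewrite /GRing.comm -!rmorphM E. Qed.

(** Conjugation by g preserves the centralizer of a. It holds for v since v moves a by a
    scalar, and for w since w moves b by a scalar and b has the same centralizer as a. *)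
Let stable g := forall e, GRing.comm e (iota a) -> GRing.comm (conj g e) (iota a).

Let stable_v : stable v.
Proof.
move=> e ea; apply: (shift_comm (k := l)); rewrite -(conj_shift v0 vl).
exact: conj_comm.
Qed.

Let stable_w : stable w.
Proof.
move=> e ea; apply: (D_cent bns) => //.
apply: (shift_comm (k := mu)); rewrite -(conj_shift w0 wm); apply: conj_comm => //.
exact: D_cent ans ea comm_ba.
Qed.

Let stable_exp g n : g != 0 -> stable g -> stable (g ^+ n).
Proof.
move=> g0 gs; elim: n => [|n IH] e ea; first by rewrite expr0 /conj mul1r divr1.
by rewrite exprS conjM ?div_exp_neq0//; apply/gs/IH.
Qed.

Let affine := exists k s : L, iota b = k *: iota a + s%:A.

(** Conjugation by v^n moves b by k and a by - n l; so y = n l b + k a is fixed. If y is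
    not a scalar, everything that commutes with y commutes together, in particular a and
    v^n: this is false as n l is nonzero. Hence y is a scalar. *)
Let affine_of_shift n (k : L) : (0 < n)%N -> conj (v ^+ n) (iota b) = iota b + k%:A -> affine.
Proof.
move=> n0 bE; have vn0 := div_exp_neq0 D_div n v0.
have ln0 : l *+ n != 0 by rewrite -mulr_natr mulf_neq0// natL_eq0 -lt0n.
pose y := (l *+ n) *: iota b + k *: iota a.
have yv : GRing.comm y (v ^+ n).
  apply: conj_fix => //; rewrite /y conjD !conjZ bE (conj_exp_shift _ v0 vl).
  rewrite scalerDr scalerBr !scalerA [k * _]mulrC addrACA -[RHS]addr0.
  by rewrite subrr.
have [[s ys]|yns] := pselect (exists s : L, y = s%:A).
  exists (- (l *+ n)^-1 * k), ((l *+ n)^-1 * s).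
  apply: (scalerI ln0); rewrite scalerDr !scalerA !mulrA mulrN divff// mulN1r mul1r.
  by rewrite -ys /y scaleNr addrCA addNr addr0.
have a_v : GRing.comm (iota a) (v ^+ n).
  apply: (D_cent (y := y)); last exact: commr_sym.
    by move=> s; apply/eqP => ys; apply: yns; exists s.
  apply: commrD; last by rewrite /GRing.comm -scalerAl -scalerAr.
  by rewrite /GRing.comm -scalerAl -scalerAr comm_ba.
have := conj_exp_shift n v0 vl; rewrite {1}/conj -a_v mulrK ?D_div//.
move/eqP; rewrite -subr_eq0 opprB addrC subrK scaler_eq0 (negbTE ln0) oner_eq0.
by [].
Qed.

Hypotheses (vB : LB v) (wB : LB w).

(** The v^i w^k are eigenvectors of right multiplication by a, with eigenvalues the
    conjugates of a, so by small growth two of these conjugates are equal. Then the same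
    monomials have the same effect on b, which commutes with a. As w moves b by a
    scalar, it remains that v^p and v^q move b in the same way up to a scalar; if p <>
    q, then [affine_of_shift] applies, and if p = q, the exponents of w agree too
    because mu is nonzero. *)
Lemma commuting_semisimple_affine : exists k s : L, iota b = k *: iota a + s%:A.
Proof.
apply: contrapT => naff.
apply: (small_growth ans (lspan_iota iota a) vB wB) => m e eE.
pose x (i : 'I_m * 'I_m) := v ^+ i.1 * w ^+ i.2.
have x0 i : x i != 0 by rewrite div_mul_neq0 ?div_exp_neq0.
have centC f g : GRing.comm f (iota a) -> GRing.comm g (iota a) -> GRing.comm f g.
  exact: D_cent ans.
apply: (@left_independent D (iota a) D_div centC _ x (fun i => conj (x i) (iota a))
  (fun=> 0%N) e) => //.
- move=> i; rewrite conjM ?div_exp_neq0//; apply: stable_exp => //.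
  exact: stable_exp.
- move=> [i k] [i' k'] [E].
  have {}E : conj (x (i, k)) (iota b) = conj (x (i', k')) (iota b).
    have [g0 h0] := (x0 (i, k), x0 (i', k')).
    move: (x (i, k)) (x (i', k')) g0 h0 E => g h g0 h0 E.
    have : g = h * (h^-1 * g) by rewrite mulVKr ?D_div.
    move: (h^-1 * g) => y gE; subst g.
    have y0 : y != 0 by apply: contra_neq g0 => ->; rewrite mulr0.
    rewrite (conjM _ h0 y0); suff -> : conj y (iota b) = iota b by [].
    (* With g = h y, the element y fixes a; so it commutes with a, hence with b. *)
    have ya : GRing.comm (iota a) y.
      by apply: conj_fix => //; apply: (conj_inj h0); rewrite -conjM.
    have by_ : GRing.comm (iota b) y by apply: centC => //; exact: commr_sym.
    by rewrite /conj -by_ mulrK ?D_div.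
  move: E; rewrite /x /= !conjM ?div_exp_neq0// (conj_exp_shift k w0 wm).
  rewrite (conj_exp_shift k' w0 wm) !conjBs ?div_exp_neq0//.
  have main (p q : nat) (s t : L) : (p < q)%N ->
      conj (v ^+ p) (iota b) - s%:A = conj (v ^+ q) (iota b) - t%:A -> False.
    move=> pq; rewrite -(subnK (ltnW pq)) addnC exprD conjM ?div_exp_neq0// => pqE.
    apply: naff; apply: (@affine_of_shift (q - p) (t - s)); first by rewrite subn_gt0.
    apply: (@conj_inj (v ^+ p)); first exact: div_exp_neq0.
    rewrite conjDs ?div_exp_neq0// scalerBl addrCA pqE addrC subrK.
    by [].
  have [/main/[apply]//|/main H/esym/H//|ii] := ltngtP i i'.
  rewrite ii => /addrI/oppr_inj/algD_inj kk; congr (_, _); first exact: val_inj.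
  apply: val_inj => /=; apply: (natr_inj charL).
  by apply: (mulfI m0); rewrite !mulr_natr.
- by move=> i; rewrite /= /twist /conj divrK ?D_div// subrr.
Qed.
End CommutingSemisimple.

(** The affine relation holds over L. It gives ad b = k ad a on B with k in L, and k is
    in K because B meets L in K. *)
Lemma semisimple_on_line a b : ~ center a -> ~ center b -> centralizer a b ->
  diag j a <> centralizer a -> diag j b <> centralizer b -> affine_line a b.
Proof.
move=> aZ bZ ab /diag_not_centralizer[x xD xC] /diag_not_centralizer[y yD yC].
have [l [v [l0 v0 vB vl]]] := semisimple_vector xD xC.
have [mu [w [m0 w0 wB wm]]] := semisimple_vector yD yC.
have [k [s bE]] := commuting_semisimple_affine aZ bZ ab l0 v0 vl m0 w0 wm vB wB.
have adE z : iota (ad b z) = k *: iota (ad a z).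
  rewrite !iota_ad bE /ad mulrDl mulrDr mulr_algl mulr_algr opprD addrACA subrr addr0.
  by rewrite -scalerAl -scalerAr -scalerBr.
have [k' kE] : exists k', k = j k'.
  by apply: (iota_ratio (b' := ad a x) _ (adE x)); apply/eqP.
have k0 : k' != 0.
  apply/eqP => k0; apply: yC; apply: iota_inj.
  by rewrite adE kE k0 !rmorph0 scale0r.
exists k', (b - k' *: a); split=> //; last by rewrite addrC subrK.
move=> z; apply/eqP; rewrite -subr_eq0; apply/eqP; apply: iota_inj.
have -> : (b - k' *: a) * z - z * (b - k' *: a) = ad b z - k' *: ad a z.
  rewrite /ad mulrBl mulrBr -scalerAl -scalerAr scalerBr !opprB addrACA [RHS]addrACA.
  by congr (_ + _); exact: addrC.
by rewrite rmorphB adE iotaZ kE subrr rmorph0.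
Qed.

Lemma affine_line_id a : affine_line a a.
Proof.
exists 1, 0; split; rewrite ?oner_neq0 ?scale1r ?addr0//.
by move=> x; rewrite mul0r mulr0.
Qed.

Lemma affine_line_noncentral a b : ~ center a -> affine_line a b -> ~ center b.
Proof.
move=> aZ [k [z [k0 zZ ->]]] bZ; apply: aZ => x; apply: (scalerI k0).
have := bZ x; rewrite mulrDl mulrDr -scalerAl -scalerAr zZ.
by move/addIr.
Qed.

Lemma affine_line_centralizer a b : affine_line a b -> centralizer a b.
Proof.
move=> [k [z [_ zZ ->]]]; apply/centralizerE.
by rewrite /GRing.comm mulrDl mulrDr -scalerAl -scalerAr zZ.
Qed.

Lemma affine_line_sym a b : affine_line a b -> affine_line b a.
Proof.
move=> [k [z [k0 zZ ->]]]; exists k^-1, (- k^-1 *: z); split.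
- by rewrite invr_eq0.
- by move=> x; rewrite -scalerAl -scalerAr zZ.
- by rewrite scalerDr scalerA mulVf// scale1r scaleNr addrK.
Qed.

Lemma tens1_central (z : B) (x : tensor j B) : center z -> tens j 1 z * x = x * tens j 1 z.
Proof.
move=> zZ; elim/tensor_ind: x => s; rewrite /tens.
have mulE := @tensor_mulE K L j B; rewrite /GRing.mul /= !mulE; congr tensor_class.
rewrite /fmul /= cats0; elim: s => //= -[l c] s ->.
by rewrite mulrC zZ.
Qed.

Lemma affine_line_diag_sub a b : affine_line a b -> (diag j a `<=` diag j b)%classic.
Proof.
move=> [k [z [k0 zZ ->]]] c [ls [v [uls vE cE]]].
have jk0 : j k != 0 by rewrite fmorph_eq0.
exists [seq j k * l | l <- ls], (fun l => v (l / j k)); split.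
- by rewrite map_inj_uniq//; exact: mulfI.
- move=> _ /mapP[l lls ->]; rewrite [_ / j k]mulrC mulKf// /eigenspace_ad /=.
  have /= vl := vE l lls; rewrite -scalerA -vl /ad tens1D tens1Z mulrDl mulrDr.
  rewrite (tens1_central _ zZ) opprD addrACA subrr addr0.
  by rewrite tensor_scalerAl tensor_scalerAr scalerBr.
by rewrite big_map cE; apply: eq_bigr => l _; rewrite [_ / j k]mulrC mulKf.
Qed.

Lemma affine_line_diag a b : affine_line a b -> diag j b = diag j a.
Proof.
move=> ab; apply/seteqP; split; apply: affine_line_diag_sub => //.
exact: affine_line_sym.
Qed.

Local Notation Class1 := (@Delta1 K L j B).
Local Notation Class2 := (@Delta2 K L j B).
Local Notation Class3 := (@Delta3 K L j B).
Local Notation Class4 := (@Delta4 K L j B).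
Local Notation Class5 := (@Delta5 K L j B).

Lemma Dixmier_class a : ~ center a ->
  (Class1 `|` Class2 `|` Class3 `|` Class4 `|` Class5)%classic a.
Proof.
move=> aZ; have [DC|DC] := pselect (diag j a = centralizer a).
  have [NC|NC] := pselect (Defs.nilp a = centralizer a).
    by right; split=> //; rewrite NC DC.
  have [NT|NT] := pselect (Defs.nilp a = setT).
    by do 4 left.
  by do 3 left; right; split=> //; split=> // CN; apply: NC.
have NC := nilp_eq_of_semisimple aZ DC.
have [DT|DT] := pselect (diag j a = setT).
  by do 2 left; right.
left; right; split=> //; split=> //; first by move=> CD; apply: DC.
  exact: semisimple_locally_finite.
by rewrite -semisimple_locally_finite.
Qed.

Lemma Dixmier_partition_of_growth : Dixmier_partition j B.
Proof.
apply/seteqP; split=> a; first exact: Dixmier_class.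
by move=> [[[[|]|]|]|] [].
Qed.

Lemma Delta_disjoint a :
  [/\ Class1 a -> ~ (Class2 a \/ Class3 a \/ Class4 a \/ Class5 a),
      Class2 a -> ~ (Class3 a \/ Class4 a \/ Class5 a),
      Class3 a -> ~ (Class4 a \/ Class5 a)
    & Class4 a -> ~ Class5 a].
Proof.
have CT : ~ center a -> centralizer a <> setT.
  move=> aZ CT; apply: aZ => b; have : centralizer a b by rewrite CT.
  by move=> /centralizerE ->.
split.
- move=> [aZ [NT DC]] [[_ [_ NT' _]]|[[_ [NC _]]|[[_ [NC _ _ _]]|[_ [ND DC']]]]].
  + exact: NT'.
  + by apply: (CT aZ); rewrite -NC.
  + by apply: (CT aZ); rewrite -NC.
  + by apply: (CT aZ); rewrite -DC' -ND.
- move=> [aZ [CN NT DC]] [[_ [NC _]]|[[_ [NC _ _ _]]|[_ [ND DC']]]]; apply: CN.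
  + by rewrite NC.
  + by rewrite NC.
  + by rewrite ND.
- move=> [aZ [NC DT]] [[_ [_ CD DF FT]]|[_ [ND DC]]].
  + by apply: FT; rewrite -DF.
  + by apply: (CT aZ); rewrite -DC.
- by move=> [aZ [NC CD DF FT]] [_ [ND DC]]; apply: CD.
Qed.

(** All elements of C(a) outside of the centre have the same centralizer and the same N.
    If N <> C, then D = C for each of them by [nilp_eq_of_semisimple], and they are all
    strongly or all weakly nilpotent, depending on whether N is the whole of B. If N =
    C, those with D = C are generic; if there is another one a', the others are on its
    line, on which D is constant. *)
Lemma of_kind_exists a : ~ center a -> exists k, of_kind j a k.
Proof.
move=> aZ; have CS b : (centralizer a `\` @center B)%classic b ->
    centralizer b = centralizer a /\ Defs.nilp b = Defs.nilp a.
  by move=> [ab bZ]; split; [exact: centralizer_eq|exact: nilp_eq].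
have SZ b : (centralizer a `\` @center B)%classic b -> ~ center b by case.
have [NC|NC] := pselect (Defs.nilp a = centralizer a); last first.
  have DC b : (centralizer a `\` @center B)%classic b -> diag j b = centralizer b.
    move=> bS; have [bC bN] := CS b bS; apply: contrapT => DC; apply: NC.
    by rewrite -bN -bC; apply: nilp_eq_of_semisimple => //; case: bS.
  have [NT|NT] := pselect (Defs.nilp a = setT).
    exists AllStronglyNilpotent => S b bS; split; first exact: SZ.
    by rewrite DC//; have [_ ->] := CS b bS.
  exists AllWeaklyNilpotent => S b bS; split; first exact: SZ.
  by have [-> ->] := CS b bS; split=> //; [move=> CN; apply: NC|rewrite DC//; case: (CS b bS)].
have NCb b : (centralizer a `\` @center B)%classic b -> Defs.nilp b = centralizer b.
  by move=> bS; have [-> ->] := CS b bS.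
have [[a' [aS DC]]|noss] := pselect (exists a', (centralizer a `\` @center B)%classic a' /\
    diag j a' <> centralizer a'); last first.
  exists AllGeneric => S b bS; have DC : diag j b = centralizer b.
    by apply: contrapT => DC; apply: noss; exists b.
  by split; [exact: SZ|rewrite NCb// DC].
have [aC' aN'] := CS a' aS; have [aa' a'Z] := aS.
have lineS : (affine_line a' `<=` centralizer a `\` @center B)%classic.
  move=> b ba; split; last exact: affine_line_noncentral ba.
  by rewrite -aC'; exact: affine_line_centralizer.
have generic : ((centralizer a `\` @center B) `\` affine_line a' `<=` Class5)%classic.
  move=> b [bS bline]; have DCb : diag j b = centralizer b.
    apply: contrapT => DCb; apply: bline; apply: semisimple_on_line => //.
      by case: bS.
    by rewrite aC'; case: bS.
  by split; [exact: SZ|rewrite NCb// DCb].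
have [DT|DT] := pselect (diag j a' = setT).
  have line3 : (affine_line a' `<=` Class3)%classic.
    move=> b ba; have bS := lineS b ba; split; first exact: SZ.
    by rewrite NCb// (affine_line_diag ba).
  exists GenericButStronglySemisimple; exists a'; split=> //.
  exact/line3/affine_line_id.
have line4 : (affine_line a' `<=` Class4)%classic.
  move=> b ba; have bS := lineS b ba; have [bC _] := CS b bS; have bZ := bS.2.
  have DCb : diag j b <> centralizer b by rewrite (affine_line_diag ba) bC -aC'.
  split=> //; split; [exact: NCb|by move=> CD; apply: DCb|exact: semisimple_locally_finite|].
  by rewrite -semisimple_locally_finite// (affine_line_diag ba).
exists GenericButWeaklySemisimple; exists a'; split=> //.
exact/line4/affine_line_id.
Qed.

Definition exceptional_class k : set B :=
  match k with
  | AllStronglyNilpotent => Class1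
  | AllWeaklyNilpotent => Class2
  | GenericButStronglySemisimple => Class3
  | GenericButWeaklySemisimple => Class4
  | AllGeneric => Class5
  end.

Lemma exceptional_class_inj a k k' :
  exceptional_class k a -> exceptional_class k' a -> k = k'.
Proof.
have [d1 d2 d3 d4] := Delta_disjoint a.
by case: k => /= ak; case: k' => //= ak'; exfalso; tauto.
Qed.

Lemma of_kind_exceptional a k : ~ center a -> of_kind j a k ->
  (exists2 x, (centralizer a `\` @center B)%classic x & exceptional_class k x) /\
  (centralizer a `\` @center B `<=` exceptional_class k `|` Class5)%classic.
Proof.
move=> aZ; have aS : (centralizer a `\` @center B)%classic a.
  by split=> //; exact/centralizerE.
have line Dl : generic_except j Dl (centralizer a `\` @center B)%classic ->
    (exists2 x, (centralizer a `\` @center B)%classic x & Dl x) /\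
    (centralizer a `\` @center B `<=` Dl `|` Class5)%classic.
  move=> [x [Dx xS xD xG]]; split.
    by exists x => //; apply: xS; exact: affine_line_id.
  move=> y yS; have [yx|yx] := pselect (affine_line x y); first by left; exact: xD.
  by right; exact: xG.
case: k => /=; try exact: line.
all: by move=> aD; split; [exists a => //; exact: aD|move=> y yS; left; exact: aD].
Qed.

(** Each kind is determined by one class which occurs in C(a), all the other elements of
    C(a) being generic or in that class; and the classes are disjoint. *)
Lemma of_kind_unique a k k' : ~ center a -> of_kind j a k -> of_kind j a k' -> k = k'.
Proof.
move=> aZ /(of_kind_exceptional aZ)[[x xS xk] kS] /(of_kind_exceptional aZ)[[y yS yk'] kS'].
have [/(exceptional_class_inj xk)//|x5] := kS' x xS.
have [/exceptional_class_inj/(_ yk')//|y5] := kS y yS.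
have -> := exceptional_class_inj (k' := AllGeneric) xk x5.
by have -> := exceptional_class_inj (k' := AllGeneric) yk' y5.
Qed.

Theorem dixmier_conditions_of_growth :
  [/\ Dixmier_partition j B, homogeneous_centralizer_condition j B
    & commutative_centralizer_condition B].
Proof.
split; first exact: Dixmier_partition_of_growth.
  split=> //; first exact: Dixmier_partition_of_growth.
  move=> a aZ; have [k ak] := of_kind_exists aZ; exists k; split=> // k' ak'.
  exact: of_kind_unique ak ak'.
by split=> // a aZ b c; exact: centralizer_commutative.
Qed.
End Subalgebra.

(** * Quadratic filtrations *)

Section QuadraticFiltration.
Variables (R : realType) (K : fieldType) (G : Type).
Variables (E : ncexpr K G -> ncexpr K G -> Prop) (A : algType K).
Variable cls : ncexpr K G -> A.
Hypothesis cls_surj : forall a, exists t, a = cls t.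
Hypothesis clsD : forall s t, cls (s + t)%nc = cls s + cls t.
Hypothesis clsM : forall s t, cls (s * t)%nc = cls s * cls t.
Hypothesis clsC : forall k, cls (Cst k) = k%:A.
Variables (Fil : nat -> A -> Prop) (fs : nat -> seq A) (w c : nat).
Hypothesis Fil1 : Fil 0 1.
Hypothesis FilD : forall d x y, Fil d x -> Fil d y -> Fil d (x + y).
Hypothesis FilZ : forall d k x, Fil d x -> Fil d (k *: x).
Hypothesis Fil_le : forall d e x, (d <= e)%N -> Fil d x -> Fil e x.
Hypothesis Fil_gen : forall g d x, Fil d x -> Fil (d + w)%N (cls (Gen g) * x).
Hypothesis Fil_span : forall d x, Fil d x -> in_span (fs d) x.
Hypothesis fs_size : forall d, (size (fs d) <= (c * d.+1) ^ 2)%N.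

Lemma Fil_mul a : exists e, forall d x, Fil d x -> Fil (d + e)%N (a * x).
Proof.
have [t ->] := cls_surj a; elim: t => [g|k|s [m IHs] t [n IHt]|s [m IHs] t [n IHt]].
- by exists w; exact: Fil_gen.
- by exists 0%N => d x xd; rewrite addn0 clsC mulr_algl; exact: FilZ.
- exists (maxn m n) => d x xd; rewrite clsD mulrDl; apply: FilD.
    by apply: (Fil_le (d := (d + m)%N)); [rewrite leq_add2l leq_maxl|exact: IHs].
  by apply: (Fil_le (d := (d + n)%N)); [rewrite leq_add2l leq_maxr|exact: IHt].
- exists (n + m)%N => d x xd; rewrite clsM -mulrA addnA.
  by apply: IHs; exact: IHt.
Qed.

Lemma Fil_top a : exists d, Fil d a.
Proof. by have [e eP] := Fil_mul a; exists (0 + e)%N; rewrite -[a]mulr1; exact: eP. Qed.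

(** Left multiplication by a given element raises the degree by a bounded amount,
    because this is so for the generators. Hence words of length n in a fixed list have
    degree at most linear in n, and they lie in a space of dimension quadratic in n. *)
Lemma GKdim_lt3_filtration : (GKdim A R < 3%:E)%E.
Proof.
apply: GKdim_lt3 => s.
have [e eP] : exists e, forall b, b \in 1 :: s -> forall d x, Fil d x -> Fil (d + e)%N (b * x).
  elim: (1 :: s) => [|b t [e IH]]; first by exists 0%N.
  have [m mP] := Fil_mul b; exists (maxn m e) => a; rewrite inE => /predU1P[->|/IH aP] d x xd.
    by apply: (Fil_le (d := (d + m)%N)); [rewrite leq_add2l leq_maxl|exact: mP].
  by apply: (Fil_le (d := (d + e)%N)); [rewrite leq_add2l leq_maxr|exact: aP].
have wP n b : b \in words (1 :: s) n -> Fil (n * e)%N b.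
  elim: n b => [|n IH] b; first by rewrite inE => /eqP ->.
  by move=> /allpairsP[[x y] /= [xs ys ->]]; rewrite mulSn addnC; apply: eP => //; exact: IH.
exists (c * e.+1)%N => n; apply: leq_trans (span_dim_le (t := fs (n * e)) _) _.
  by move=> b /wP; exact: Fil_span.
by apply: leq_trans (fs_size _) _; rewrite leq_exp2r//; nia.
Qed.
End QuadraticFiltration.

Section Boxes.
Variables (K : fieldType) (A : algType K) (u v : A).
Implicit Types (p : {poly K}) (P Q : {poly {poly K}}).

Definition box d (P : {poly {poly K}}) := (size P <= d.+1)%N /\ forall k, (size (P`_k)%R <= d.+1)%N.

Definition box_monomials d : seq A :=
  [seq u ^+ i * v ^+ k | i <- iota 0 d.+1, k <- iota 0 d.+1].

Lemma size_box_monomials d : size (box_monomials d) = (d.+1 ^ 2)%N.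
Proof. by rewrite size_allpairs size_iota. Qed.

Lemma box_in_span d P : box d P -> in_span (box_monomials d) (pair_form u v P).
Proof.
move=> [sP cP]; rewrite (pair_formE u v sP).
apply: (big_ind (in_span (box_monomials d))) => [||k _]; [exact: in_span0|exact: in_spanD|].
rewrite (horner_algE u (cP k)) mulr_suml.
apply: (big_ind (in_span (box_monomials d))) => [||i _]; [exact: in_span0|exact: in_spanD|].
rewrite -scalerAl; apply/in_spanZ/mem_in_span/allpairsP; exists (i : nat, k : nat).
by rewrite !mem_iota /= !add0n !ltn_ord.
Qed.

Lemma boxD d P Q : box d P -> box d Q -> box d (P + Q).
Proof.
move=> [sP cP] [sQ cQ]; split=> [|k].
  by rewrite (leq_trans (size_polyD _ _))// geq_max sP.
by rewrite coefD (leq_trans (size_polyD _ _))// geq_max cP cQ.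
Qed.

Lemma box_le d e P : (d <= e)%N -> box d P -> box e P.
Proof.
move=> de [sP cP]; split=> [|k]; first by apply: leq_trans sP _.
by apply: leq_trans (cP k) _.
Qed.

Lemma boxZ d (k : K) P : box d P -> box d (k%:P%:P * P).
Proof.
move=> [sP cP]; rewrite mul_polyC; split=> [|i].
  by rewrite (leq_trans (size_scale_leq _ _)).
by rewrite coefZ mul_polyC (leq_trans (size_scale_leq _ _)).
Qed.

Lemma boxMX d P : box d P -> box d.+1 (P * 'X).
Proof.
move=> [sP cP]; split=> [|[|k]].
- have [->|P0] := eqVneq P 0; first by rewrite mul0r size_poly0.
  by rewrite size_mulX.
- by rewrite coefMX /= size_poly0.
- by rewrite coefMX /=; apply: leq_trans (cP k) _.
Qed.

Lemma boxCM d p P : box d P -> box (d + size p) (p%:P * P).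
Proof.
move=> [sP cP]; rewrite mul_polyC; split=> [|i].
  by rewrite (leq_trans (size_scale_leq _ _))// (leq_trans sP)// ltnS leq_addr.
rewrite coefZ (leq_trans (size_polyMleq _ _))//.
by have := cP i; lia.
Qed.

Lemma boxC d p : (size p <= d.+1)%N -> box d p%:P.
Proof.
move=> sp; split=> [|[|k]]; rewrite ?coefC//= ?size_poly0//.
by rewrite (leq_trans (size_polyC_leq1 _)).
Qed.
End Boxes.

(** * Growth of the first Weyl algebra *)

Section WeylGrowth.
Variables (R : realType) (K : fieldType).

Lemma box_map_deriv d (P : {poly {poly K}}) : box d P -> box d (map_poly (@deriv K) P).
Proof.
move=> [sP cP]; split=> [|k]; first exact: leq_trans (size_poly _ _) sP.
rewrite coef_map; apply: leq_trans (cP k).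
by apply: leq_trans (leq_pred _); exact: size_poly.
Qed.

Lemma weyl_GKdim_lt3 : (GKdim (weyl K) R < 3%:E)%E.
Proof.
pose Fil d (a : weyl K) := exists2 P, box d P & a = pair_form (wx K) (wd K) P.
apply: (@GKdim_lt3_filtration R K weyl_gen (weyl K) (pres_class (@weyl_rel K)) _ _ _ _
  Fil (box_monomials (wx K) (wd K)) 2 1).
- by move=> a; exists (pres_repr a); rewrite pres_reprK.
- by move=> s t; rewrite -pres_classD.
- by move=> s t; rewrite -pres_classM.
- exact: pres_class_alg.
- exists 1; last by rewrite -(polyC1 {poly K}) pair_formC rmorph1.
  by apply: boxC; rewrite size_poly1.
- by move=> d _ _ [P bP ->] [Q bQ ->]; exists (P + Q); [exact: boxD|rewrite raddfD].
- move=> d k _ [P bP ->]; exists (k%:P%:P * P); first exact: boxZ.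
  by rewrite pair_formCM horner_algC mulr_algl.
- by move=> d e _ de [P bP ->]; exists P => //; exact: box_le bP.
- case=> d _ [P bP ->].
    exists ('X%:P * P); first by have := boxCM 'X bP; rewrite size_polyX.
    by rewrite pair_formCM horner_algX.
  exists (P * 'X + map_poly (@deriv K) P); last exact: weyl_d_normal_form.
  rewrite addn2; apply: boxD; first by apply: (@box_le _ d.+1) => //; exact: boxMX.
  by apply: (@box_le _ d); [lia|exact: box_map_deriv].
- by move=> d _ [P bP ->]; exact: box_in_span.
- by move=> d; rewrite size_box_monomials mul1n.
Qed.

Lemma wx_neq0 : wx K != 0.
Proof.
apply/eqP => x0; have /eqP := weyl_dx K; rewrite x0 mulr0 mul0r add0r eq_sym.
by rewrite oner_eq0.
Qed.

Lemma weyl_noncommutative : noncommutative (weyl K).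
Proof.
exists (wd K), (wx K) => /eqP; rewrite weyl_dx addrC -subr_eq0 addrK oner_eq0.
by [].
Qed.
End WeylGrowth.

(** * Growth of A(alpha) *)

Lemma horner_expr (K : fieldType) (G : Type) (A : algType K) (ev : ncexpr K G -> A)
    (u : A) (p : {poly K}) t q :
  (forall s t, ev (s + t)%nc = ev s + ev t) -> (forall s t, ev (s * t)%nc = ev s * ev t) ->
  (forall k, ev (Cst k) = k%:A) ->
  ev t = horner_alg u q -> ev (nc_horner p t) = horner_alg u (p \Po q).
Proof.
move=> evD evM evC tq; rewrite -{2}(polyseqK p) /nc_horner.
elim: (polyseq p) => [|c s IH] /=.
  by rewrite comp_poly0 rmorph0 evC scale0r.
rewrite evD evM tq IH cons_poly_def comp_polyD comp_polyM.
rewrite comp_polyX comp_polyC rmorphD rmorphM /= horner_algC evC addrC.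
by congr (_ + _); rewrite -rmorphM mulrC rmorphM.
Qed.

(** A commutation rule z u = q(u) z extends to all polynomials in u; here q is u - 1 or
    u + 1. *)
Lemma horner_alg_twist (K : fieldType) (A : algType K) (u z : A) (q p : {poly K}) :
  z * u = horner_alg u q * z -> z * horner_alg u p = horner_alg u (p \Po q) * z.
Proof.
move=> zH; elim/poly_ind: p => [|p c IH]; first by rewrite comp_poly0 !rmorph0 mulr0 mul0r.
rewrite comp_polyD comp_polyM comp_polyX comp_polyC !rmorphD !rmorphM /=.
rewrite horner_algX horner_algC mulrDr mulrA IH -mulrA zH mulrA mulrDl.
by congr (_ + _); rewrite mulr_algr mulr_algl.
Qed.

Section Kleinian.
Variables (K : fieldType) (alpha : {poly K}).
Notation Al := (kleinian alpha).
Implicit Types (p : {poly K}) (P Q : {poly {poly K}}).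

Let cls : ncexpr K kleinian_gen -> Al := pres_class (kleinian_rel alpha).
Definition kX : Al := cls (Gen GX).
Definition kY : Al := cls (Gen GY).
Definition kH : Al := cls (Gen GH).

Local Notation down := ('X - 1 : {poly K}).
Local Notation up := ('X + 1 : {poly K}).
Local Notation hp := (horner_alg kH).

Lemma clsC k : cls (Cst k) = k%:A.
Proof. exact: pres_class_alg. Qed.

Lemma clsD s t : cls (s + t)%nc = cls s + cls t.
Proof. exact/esym/pres_classD. Qed.

Lemma clsM s t : cls (s * t)%nc = cls s * cls t.
Proof. exact/esym/pres_classM. Qed.

Lemma cls_rel s t : kleinian_rel alpha s t -> cls s = cls t.
Proof. by move=> st; apply/pres_classP/pe_rel. Qed.

Lemma cls_horner p t q : cls t = hp q -> cls (nc_horner p t) = hp (p \Po q).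
Proof. exact: horner_expr clsD clsM clsC. Qed.

Lemma kleinian_down : cls (Gen GH - Cst 1%R)%nc = hp down.
Proof.
rewrite clsD clsM !clsC mulr_algl scale1r scaleN1r.
by rewrite rmorphB rmorph1 /= horner_algX.
Qed.

Lemma kXH : kX * kH = hp down * kX.
Proof.
have := cls_rel (kleinian_XH alpha).
by rewrite !clsM kleinian_down.
Qed.

Lemma kYH : kY * kH = hp up * kY.
Proof.
have := cls_rel (kleinian_YH alpha).
rewrite !clsM clsD clsC scale1r => ->.
by rewrite rmorphD rmorph1 /= horner_algX.
Qed.

Lemma kYX : kY * kX = hp alpha.
Proof.
have := cls_rel (kleinian_YX alpha).
rewrite clsM => ->; rewrite (cls_horner alpha (q := 'X)).
  by rewrite comp_polyXr.
by rewrite horner_algX.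
Qed.

Lemma kXY : kX * kY = hp (alpha \Po down).
Proof.
have := cls_rel (kleinian_XY alpha).
by rewrite clsM => ->; apply: cls_horner; exact: kleinian_down.
Qed.

Local Notation fX := (pair_form kH kX).
Local Notation fY := (pair_form kH kY).
Local Notation coefcomp q := (map_poly (comp_poly q)).

(** Left multiplication of the powers of z by z: coefficients are shifted and the degree
    increases by one. *)
Lemma twist_pair_form (z : Al) q P : z * kH = hp q * z ->
  z * pair_form kH z P = pair_form kH z (coefcomp q P * 'X).
Proof.
move=> zH; elim/poly_ind: P => [|P c IH]; first by rewrite rmorph0 mul0r !raddf0 mulr0.
rewrite rmorphD rmorphM /= map_polyX map_polyC /= !pair_formMX !raddfD /=.
rewrite !pair_formMX !pair_formC mulrDr mulrA IH (horner_alg_twist _ zH) mulrDl.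
by rewrite pair_formMX.
Qed.

(** Left multiplication by z of the powers of the opposite generator v: as z v is a
    polynomial in H, the degree decreases by one. *)
Lemma cross_pair_form (z v : Al) q (b : {poly K}) P :
  z * kH = hp q * z -> z * v = hp b ->
  z * pair_form kH v (P * 'X) = pair_form kH v (b%:P * coefcomp q P).
Proof.
move=> zH zv; elim/poly_ind: P => [|P c IH].
  by rewrite rmorph0 mul0r mulr0 !raddf0 mulr0.
rewrite rmorphD rmorphM /= map_polyX map_polyC /= mulrDr mulrA -polyCM.
rewrite pair_formMX !raddfD /= mulrA mulrDr IH pair_formMX !pair_formC mulrDl.
rewrite (horner_alg_twist _ zH) -[_ * z * v]mulrA zv; congr (_ + _).
by rewrite -rmorphM; congr (horner_alg _ _); exact: mulrC.
Qed.

(** The normal form with coefficients in K[H]. The part in Y starts at degree one, so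
    that the polynomials in H occur only once. *)
Definition kleinian_box d (a : Al) :=
  exists P Q, [/\ box d P, box d Q & a = fX P + fY (Q * 'X)].

Lemma box_shift d (q : {poly K}) P : size q = 2 -> box d P -> box d (coefcomp q P).
Proof.
move=> sq [sP cP]; split=> [|k]; first exact: leq_trans (size_poly _ _) sP.
by rewrite coef_map /= size_comp_poly2.
Qed.

Lemma box_split d P : box d P ->
  exists P' (c : {poly K}), [/\ box d P', box d c%:P & P = P' * 'X + c%:P].
Proof.
move=> [sP cP]; exists (drop_poly 1 P), P`_0; split; last first.
- rewrite -['X]expr1 -{1}(poly_take_drop 1 P) addrC /take_poly poly_def big_ord1 expr0.
  by rewrite alg_polyC.
- exact: boxC.
- split=> [|k]; last by rewrite coef_drop_poly.
  by rewrite size_drop_poly; lia.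
Qed.

Lemma size_down : size down = 2. Proof. by rewrite -polyC1 size_XsubC. Qed.
Lemma size_up : size up = 2. Proof. by rewrite -polyC1 size_XaddC. Qed.

Lemma kleinian_box_le d e a : (d <= e)%N -> kleinian_box d a -> kleinian_box e a.
Proof.
by move=> de [P [Q [bP bQ ->]]]; exists P, Q; split=> //; exact: box_le de _.
Qed.

(** X raises the degree of the X-part by one and lowers that of the Y-part, whose term
    of degree one falls into K[H] and is added to the X-part; Y does the opposite.
    Coefficients are shifted by one and multiplied by H, alpha or a shift of alpha at
    most, so that their degrees grow by a bounded amount. *)
Lemma kleinian_box_gen g d a : kleinian_box d a ->
  kleinian_box (d + (size alpha).+2) (cls (Gen g) * a).
Proof.
have widen k b P : (k <= d + b)%N -> box k P -> box (d + b) P by exact: box_le.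
move=> [P [Q [bP bQ ->]]]; case: g; rewrite mulrDr.
- have [Q' [c [bQ' bc QE]]] :=
    box_split (boxCM (alpha \Po down) (box_shift size_down bQ)).
  exists (coefcomp down P * 'X + c%:P), Q'; split.
  + apply: boxD; last first.
      by apply: box_le bc; rewrite size_comp_poly2 ?size_down// leq_add2l -addn2 leq_addr.
    by apply: (@box_le _ d.+1); [lia|exact/boxMX/box_shift/bP/size_down].
  + by apply: box_le bQ'; rewrite size_comp_poly2 ?size_down// leq_add2l -addn2 leq_addr.
  rewrite -/kX (twist_pair_form _ kXH) (cross_pair_form _ kXH kXY) QE !raddfD /=.
  by rewrite !pair_formC addrA addrAC.
- have [P' [c [bP' bc PE]]] := box_split bP.
  exists (alpha%:P * coefcomp up P'), (coefcomp up Q * 'X + (c \Po up)%:P); split.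
  + by apply: box_le (boxCM alpha (box_shift size_up bP')); rewrite leq_add2l -addn2 leq_addr.
  + apply: boxD.
      by apply: (@box_le _ d.+1); [lia|exact/boxMX/box_shift/bQ/size_up].
    apply: (@box_le _ d); first lia.
    apply: boxC; rewrite size_comp_poly2 ?size_up//.
    by case: bc => _ /(_ 0); rewrite coefC.
  rewrite -/kY PE raddfD /= mulrDr (cross_pair_form _ kYH kYX) (twist_pair_form _ kYH).
  rewrite pair_formC (horner_alg_twist _ kYH) -addrA; congr (_ + _).
  rewrite rmorphM /= map_polyX [in RHS]mulrDl raddfD /= addrC; congr (_ + _).
  by rewrite pair_formMX pair_formC.
- exists ('X%:P * P), ('X%:P * Q); split.
  + by apply: box_le (boxCM 'X bP); rewrite size_polyX; lia.
  + by apply: box_le (boxCM 'X bQ); rewrite size_polyX; lia.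
  by rewrite -mulrA !pair_formCM horner_algX.
Qed.

Variable R : realType.

Lemma kleinian_boxD d a b : kleinian_box d a -> kleinian_box d b -> kleinian_box d (a + b).
Proof.
move=> [P [Q [bP bQ ->]]] [P' [Q' [bP' bQ' ->]]]; exists (P + P'), (Q + Q').
by split; [exact: boxD|exact: boxD|rewrite mulrDl !raddfD /= addrACA].
Qed.

Lemma kleinian_boxZ d k a : kleinian_box d a -> kleinian_box d (k *: a).
Proof.
move=> [P [Q [bP bQ ->]]]; exists (k%:P%:P * P), (k%:P%:P * Q).
split; [exact: boxZ|exact: boxZ|].
by rewrite -mulrA !pair_formCM horner_algC !mulr_algl scalerDr.
Qed.

Lemma kleinian_box1 : kleinian_box 0 1.
Proof.
exists 1, 0; split.
- by apply: boxC; rewrite size_poly1.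
- by split=> [|k]; rewrite ?coef0 size_poly0.
- by rewrite mul0r raddf0 addr0 -(polyC1 {poly K}) pair_formC rmorph1.
Qed.

Lemma kleinian_GKdim_lt3 : (GKdim Al R < 3%:E)%E.
Proof.
apply: (@GKdim_lt3_filtration R K kleinian_gen Al cls _ _ _ _ kleinian_box
  (fun d => box_monomials kH kX d ++ box_monomials kH kY d.+1) (size alpha).+2 3).
- by move=> a; exists (pres_repr a); rewrite /cls pres_reprK.
- exact: clsD.
- exact: clsM.
- exact: clsC.
- exact: kleinian_box1.
- exact: kleinian_boxD.
- exact: kleinian_boxZ.
- exact: kleinian_box_le.
- by move=> g d x; exact: kleinian_box_gen.
- move=> d _ [P [Q [bP bQ ->]]].
  apply: in_spanD; [apply: (in_span_sub (s := box_monomials kH kX d))|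
    apply: (in_span_sub (s := box_monomials kH kY d.+1))].
  + by move=> x xs; rewrite mem_cat xs.
  + exact: box_in_span.
  + by move=> x xs; rewrite mem_cat xs orbT.
  + exact/box_in_span/boxMX.
- by move=> d; rewrite size_cat !size_box_monomials; nia.
Qed.

Lemma kleinian_form a : exists P Q, a = fX P + fY (Q * 'X).
Proof.
have [|d [P [Q [_ _ ->]]]] := @Fil_top K kleinian_gen Al cls _ clsD clsM clsC kleinian_box
  (size alpha).+2 kleinian_box1 (@kleinian_boxD) (@kleinian_boxZ) (@kleinian_box_le)
  (@kleinian_box_gen) a.
  by move=> b; exists (pres_repr b); rewrite /cls pres_reprK.
by exists P, Q.
Qed.
End Kleinian.

(** * Embedding of A(alpha) in the Weyl division ring *)

(** The polynomial that vanishes at the other eigenvalues isolates the component of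
    index i. *)
Lemma eigen_indep (F : fieldType) (V : lmodType F) (delta : V -> V) (I : finType)
    (lam : I -> F) (z : I -> V) :
  linear delta -> injective lam -> (forall i, delta (z i) = lam i *: z i) ->
  \sum_i z i = 0 -> forall i, z i = 0.
Proof.
move=> dl lam_inj zE z0 i.
pose p : {poly F} := \prod_(k | k != i) ('X - (lam k)%:P).
have := pact_sum dl p (index_enum I) z; rewrite z0 (pact0 dl) (bigD1 i)//= big1 ?addr0.
  rewrite (pact_eigen dl _ (zE i)) => /esym/eqP; rewrite scaler_eq0 => /orP[|/eqP//].
  rewrite horner_prod prodf_seq_eq0 => /hasP[k _ /andP[ki]].
  rewrite hornerXsubC subr_eq0 => /eqP/lam_inj ik; move: ki.
  by rewrite ik eqxx.
move=> k ki; rewrite (pact_eigen dl _ (zE k)) /p (bigD1 k)//= hornerM hornerXsubC.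
by rewrite subrr mul0r scale0r.
Qed.

Lemma horner_alg_morph (K : fieldType) (A B : algType K) (f : {lrmorphism A -> B})
  (u : A) p : f (horner_alg u p) = horner_alg (f u) p.
Proof.
rewrite !(@horner_algE _ _ _ (size p))// rmorph_sum; apply: eq_bigr => i _.
by rewrite /= linearZ /= rmorphXn.
Qed.

Lemma pair_form_morph (K : fieldType) (A B : algType K) (f : {lrmorphism A -> B})
  (u v : A) P : f (pair_form u v P) = pair_form (f u) (f v) P.
Proof.
rewrite !(@pair_formE _ _ _ _ (size P))// rmorph_sum; apply: eq_bigr => i _.
by rewrite rmorphM rmorphXn /= horner_alg_morph.
Qed.

Section KleinianEmbedding.
Variables (K : fieldType) (alpha : {poly K}).
Hypothesis charK : [pchar K] =i pred0.
Hypothesis alpha_neq0 : alpha != 0.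
Variables (Q : unitAlgType K) (x h : Q).
Hypothesis Qdiv : forall q : Q, q != 0 -> q \is a GRing.unit.
Hypothesis x_neq0 : x != 0.
Hypothesis xh : x * h = (h - 1) * x.
Hypothesis h_tr : forall p : {poly K}, horner_alg h p = 0 -> p = 0.

Let xU : x \is a GRing.unit. Proof. exact: Qdiv. Qed.

Let y : Q := horner_alg h alpha / x.

Definition kleinian_gen_image (g : kleinian_gen) : Q :=
  match g with GX => x | GY => y | GH => h end.

Let ev : ncexpr K kleinian_gen -> Q := nc_eval (in_alg Q) kleinian_gen_image.

Let c_central k (z : Q) : in_alg Q k * z = z * in_alg Q k.
Proof. by rewrite /= mulr_algl mulr_algr. Qed.

Let x_down : x * h = horner_alg h ('X - 1) * x.
Proof. by rewrite rmorphB rmorph1 /= horner_algX. Qed.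

Let xV_up : x^-1 * h = horner_alg h ('X + 1) * x^-1.
Proof.
apply: (mulrI xU); apply: (mulIr xU); rewrite mulrA divrr// mul1r -mulrA divrK//.
rewrite rmorphD rmorph1 /= horner_algX mulrDr mulr1 xh mulrBl mul1r subrK.
by [].
Qed.

Lemma kleinian_gen_rel s t : kleinian_rel alpha s t -> ev s = ev t.
Proof.
have evH (p : {poly K}) t' q : ev t' = horner_alg h q ->
    ev (nc_horner p t') = horner_alg h (p \Po q) by exact: horner_expr.
case.
- by rewrite /ev /= !scale1r mulr1 scaleN1r.
- rewrite /ev /= scale1r /y -mulrA xV_up !mulrA; congr (_ / _).
  rewrite rmorphD rmorph1 /= horner_algX mulrDr mulrDl mul1r mulr1; congr (_ + _).
  by rewrite -{2 3}[h](horner_algX h) -!rmorphM mulrC.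
- rewrite (evH alpha _ 'X) ?comp_polyXr; first by rewrite /ev /= /y divrK.
  by rewrite horner_algX.
- rewrite (evH alpha _ ('X - 1)).
    by rewrite /ev /= /y mulrA (horner_alg_twist _ x_down) mulrK.
  by rewrite /ev /= rmorphB rmorph1 /= horner_algX scaleN1r scale1r mulr1.
Qed.

Definition kleinian_fun : kleinian alpha -> Q := pres_eval (in_alg Q) kleinian_gen_image.
HB.instance Definition _ := GRing.isZmodMorphism.Build (kleinian alpha) Q kleinian_fun
  (pres_eval_zmod c_central kleinian_gen_rel).
HB.instance Definition _ := GRing.isMonoidMorphism.Build (kleinian alpha) Q kleinian_fun
  (pres_eval_monoid c_central kleinian_gen_rel).

Lemma kleinian_funE t : kleinian_fun (pres_class _ t) = ev t.
Proof. exact: (pres_evalE c_central kleinian_gen_rel). Qed.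

Lemma kleinian_funX : kleinian_fun (kX alpha) = x. Proof. exact: kleinian_funE. Qed.
Lemma kleinian_funY : kleinian_fun (kY alpha) = y. Proof. exact: kleinian_funE. Qed.
Lemma kleinian_funH : kleinian_fun (kH alpha) = h. Proof. exact: kleinian_funE. Qed.

Fact kleinian_fun_scalable : scalable kleinian_fun.
Proof.
move=> k; elim/pres_ind => t; rewrite [k *: _]pres_classZ !kleinian_funE /ev /=.
by rewrite mulr_algl.
Qed.
HB.instance Definition _ := GRing.isScalable.Build K (kleinian alpha) Q *:%R
  kleinian_fun kleinian_fun_scalable.

(** The images of p(H) X^k and p(H) Y^k are eigenvectors of ad h for the eigenvalues k
    and - k, which are distinct in characteristic zero. So in a normal form with zero
    image each term has zero image, and its coefficient p(h) is zero as x and y are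
    invertible; then p is zero because h is transcendental. *)
Lemma kleinian_fun_inj : injective kleinian_fun.
Proof.
suff ker0 a : kleinian_fun a = 0 -> a = 0.
  move=> a b ab; apply/eqP; rewrite -subr_eq0; apply/eqP/ker0.
  by rewrite rmorphB /= ab subrr.
have [P [R ->]] := kleinian_form a.
rewrite rmorphD /= !pair_form_morph /= kleinian_funX kleinian_funY kleinian_funH => PR0.
have adh (p : {poly K}) : ad h (horner_alg h p) = 0.
  by rewrite /ad horner_alg_comm subrr.
have adx : ad h x = 1 *: x.
  by rewrite /ad xh mulrBl mul1r opprB addrC subrK scale1r.
have ady : ad h y = - 1 *: y.
  rewrite /y ad_mul adh mul0r add0r scaleN1r /ad xV_up rmorphD rmorph1 /= horner_algX.
  by rewrite mulrDl mul1r opprD addrA subrr add0r mulrN.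
have ad_pow (v : Q) (e : K) p k : ad h v = e *: v ->
    ad h (horner_alg h p * v ^+ k) = (e *+ k) *: (horner_alg h p * v ^+ k).
  move=> hv; rewrite ad_mul adh mul0r add0r scalerAr; congr (_ * _).
  elim: k => [|k IH]; first by rewrite mulr0n scale0r expr0 /ad mulr1 mul1r subrr.
  by rewrite exprS ad_mul hv IH -scalerAl -scalerAr -scalerDl -mulrS.
pose n := maxn (size P) (size R).
pose z (i : 'I_n + 'I_n) : Q := match i with
  | inl k => horner_alg h P`_k * x ^+ k | inr k => horner_alg h R`_k * y ^+ k.+1 end.
pose lam (i : 'I_n + 'I_n) : K := match i with inl k => k%:R | inr k => - k.+1%:R end.
have z0 : \sum_i z i = 0.
  rewrite big_sumType /= -[RHS]PR0 pair_formMX !(@pair_formE _ _ _ _ n) ?leq_maxl ?leq_maxr//.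
  by rewrite mulr_suml; congr (_ + _); apply: eq_bigr => k _; rewrite exprSr mulrA.
have lam_inj : injective lam.
  have natK := natr_inj charK; have natK0 := natr_charL charK.
  move=> [k|k] [l|l] /= E.
  - by congr inl; apply: val_inj; exact: natK.
  - by move/eqP: E; rewrite -subr_eq0 opprK -natrD natK0 addnS.
  - by move/eqP: E; rewrite eq_sym -subr_eq0 opprK -natrD natK0 addnS.
  - by congr inr; apply: val_inj; move/oppr_inj/natK: E => -[].
have zz : forall i, z i = 0.
  apply: (eigen_indep (ad_linear h) lam_inj) => // -[] k /=.
    by rewrite (ad_pow _ 1).
  by have := ad_pow y (-1) R`_k k.+1 ady; rewrite mulNrn.
have y0 : y \is a GRing.unit.
  apply: Qdiv; apply: contra_neq alpha_neq0 => y0; apply: h_tr.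
  by rewrite -[LHS](divrK xU) -/y y0 mul0r.
have P0 : P = 0.
  apply/polyP => k; rewrite coef0; have [kn|nk] := ltnP k n; last first.
    by rewrite nth_default// (leq_trans _ nk)// leq_maxl.
  apply: h_tr; have /= := zz (inl (Ordinal kn)).
  by move/(canRL (mulrK (unitrX k xU))); rewrite mul0r.
have R0 : R = 0.
  apply/polyP => k; rewrite coef0; have [kn|nk] := ltnP k n; last first.
    by rewrite nth_default// (leq_trans _ nk)// leq_maxr.
  apply: h_tr; have /= := zz (inr (Ordinal kn)).
  by move/(canRL (mulrK (unitrX k.+1 y0))); rewrite mul0r.
by rewrite P0 R0 mul0r !raddf0 addr0.
Qed.

Lemma kleinian_embedding :
  exists f : {lrmorphism kleinian alpha -> Q}, injective f.
Proof. by exists kleinian_fun; exact: kleinian_fun_inj. Qed.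

Lemma kleinian_noncommutative : noncommutative (kleinian alpha).
Proof.
exists (kX alpha), (kH alpha) => E; have := congr1 kleinian_fun E.
rewrite !rmorphM /= kleinian_funX kleinian_funH xh mulrBl mul1r => /eqP.
by rewrite -subr_eq0 addrAC subrr add0r oppr_eq0 (negbTE x_neq0).
Qed.
End KleinianEmbedding.

Theorem corollary5p3 (R : realType)
    (K : fieldType) (charK : [pchar K] =i pred0)
    (L : closedFieldType) (j : {rmorphism K -> L})
    (algL : forall z : L, algebraicOver j z)
    (Q : unitAlgType K) (phi : {lrmorphism weyl K -> Q})
    (fracQ : division_ring_of_fractions phi) :
  commutative_centralizer_condition Q
  /\
  ([/\ Dixmier_partition j (weyl K),
       homogeneous_centralizer_condition j (weyl K)
     & commutative_centralizer_condition (weyl K)]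
   /\
   (forall alpha : {poly K}, alpha != 0 ->
    [/\ Dixmier_partition j (kleinian alpha),
        homogeneous_centralizer_condition j (kleinian alpha)
      & commutative_centralizer_condition (kleinian alpha)])
   /\
   (forall (B : algType K) (iota : {lrmorphism B -> Q}),
    injective iota -> noncommutative B -> (GKdim B R < 3%:E)%E ->
    [/\ Dixmier_partition j B,
        homogeneous_centralizer_condition j B
      & commutative_centralizer_condition B])).
Proof.
have [D [Psi [D_div D_cent PsiK Psi_scalar]]] := weyl_fractions_embedding charK j fracQ.
have [phi_inj Qdiv _] := fracQ.
have PsiZ k q : Psi (k *: q) = j k *: Psi q.
  by rewrite -mulr_algl rmorphM /= PsiK mulr_algl.
have Psi_eq0 q : Psi q = 0 -> q = 0.
  move=> q0; apply/eqP/negP => /negP/Qdiv qU.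
  have := oner_neq0 D; rewrite -(rmorph1 Psi) -(divrr qU) rmorphM q0 mul0r.
  by rewrite eqxx.
have subalgebra (B : algType K) (iota : {lrmorphism B -> Q}) :
    injective iota -> noncommutative B -> (GKdim B R < 3%:E)%E ->
    [/\ Dixmier_partition j B, homogeneous_centralizer_condition j B
      & commutative_centralizer_condition B].
  move=> iota_inj B_nc GK.
  apply: (@dixmier_conditions_of_growth R K L j charK algL D D_div D_cent B (Psi \o iota)) => //.
  - by move=> k b; rewrite /= linearZ PsiZ.
  - by move=> b /= /Psi_eq0 b0; apply: iota_inj; rewrite b0 rmorph0.
  - move=> l b b' b0 /= bE.
    have b'U : iota b' \is a GRing.unit.
      by apply: Qdiv; apply: contra_neq b0 => b0; apply: iota_inj; rewrite b0 rmorph0.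
    apply: (Psi_scalar l (iota b / iota b')).
    by rewrite rmorphM rmorphV// bE -scalerAl divrr// rmorph_unit.
have x0 : phi (wx K) != 0.
  by apply: contra_neq (wx_neq0 K) => x0; apply: phi_inj; rewrite x0 rmorph0.
split; [|split; [|split]].
- split; last first.
    move=> a aZ b c; exact: (centralizer_commutative D_cent Psi_eq0 aZ).
  have [a [b ab]] := weyl_noncommutative K; exists (phi a), (phi b).
  by rewrite -!rmorphM => /phi_inj.
- exact: (subalgebra (weyl K) phi phi_inj (weyl_noncommutative K) (weyl_GKdim_lt3 R K)).
- move=> alpha alpha0; pose x := phi (wx K); pose h := phi (wx K * wd K).
  have xh : x * h = (h - 1) * x.
    rewrite /x /h -(rmorph1 phi) -rmorphB -!rmorphM; congr (phi _).
    by rewrite mulrBl mul1r -!mulrA weyl_dx mulrDr mulr1 addrK.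
  (* A scalar h would commute with x, in contradiction with x h = (h - 1) x. *)
  have h_ns l : Psi h != l%:A.
    apply/eqP => hl; case/eqP: x0; apply: Psi_eq0.
    have := congr1 Psi xh; rewrite !rmorphM /= rmorphB rmorph1 hl mulr_algr mulrBl mulr_algl.
    by rewrite mul1r => /eqP; rewrite -subr_eq0 opprB addrC subrK => /eqP.
  have h_tr (p : {poly K}) : horner_alg h p = 0 -> p = 0.
    rewrite (@horner_algE _ _ _ (size p))// => /(congr1 Psi); rewrite rmorph_sum rmorph0.
    under eq_bigr do rewrite /= PsiZ rmorphXn.
    move=> /(nonscalar_transcendental D_div h_ns) p0; apply/polyP => i; rewrite coef0.
    have [ip|pi] := ltnP i (size p); last by rewrite nth_default.
    by apply: (fmorph_inj j); rewrite rmorph0; exact: (p0 (Ordinal ip)).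
  have [f f_inj] := kleinian_embedding charK alpha0 Qdiv x0 xh h_tr.
  apply: (subalgebra _ f f_inj); last exact: kleinian_GKdim_lt3.
  exact: kleinian_noncommutative Qdiv x0 xh.
- exact: subalgebra.
Qed.
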